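(* Let $a\in[0,1]$, $\gamma\in\{-1,1\}$, and let $\{\lambda_n\}_{n\ge0}$ be the spectrum of some boundary value problem $\mathcal L(q^*(x),a,\gamma)$ with a complex-valued $q^*\in L_2(0,1)$. For $p\in L_2(0,1/2)$ let $q^{[p]}\in L_2(0,1)$ be the function constructed from $\{\lambda_n\}_{n\ge0}$, $a$, $\gamma$ and $p$ by the procedure described in the context. Then, as $p$ ranges over $L_2(0,1/2)$, the functions $q^{[p]}$ form the set of all iso-spectral potentials for the given spectrum, i.e. $$ \{q\in L_2(0,1):\ \{\lambda_n\}_{n\ge0}\text{ is the spectrum of }\mathcal L(q(x),a,\gamma)\}=\{q^{[p]}:\ p\in L_2(0,1/2)\}. $$
   Context: For a complex-valued $q\in L_2(0,1)$, $a\in[0,1]$ and $\gamma\in\mathbb C\setminus\{0\}$, $\mathcal L(q(x),a,\gamma)$ denotes the boundary value problem $$-y''(x)+q(x)y(a)=\lambda y(x),\quad 0<x<1,\qquad y^{(\nu)}(0)=\gamma y^{(\nu)}(1),\quad \nu=0,1,$$ for $y\in W_2^2[0,1]$, with spectral parameter $\lambda\in\mathbb C$. Let $C(x,\lambda)$, $S(x,\lambda)$ be the solutions of the equation with $C(a,\lambda)=S'(a,\lambda)=1$, $S(a,\lambda)=C'(a,\lambda)=0$; with $\rho^2=\lambda$, $$C(x,\lambda)=\cos\rho(x-a)+\int_a^x\frac{\sin\rho(x-t)}{\rho}q(t)\,dt,\qquad S(x,\lambda)=\frac{\sin\rho(x-a)}{\rho}.$$ The eigenvalues are the zeros of the characteristic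 function $$\Delta(\lambda)=\begin{vmatrix} C(0,\lambda)-\gamma C(1,\lambda) & S(0,\lambda)-\gamma S(1,\lambda)\\ C'(0,\lambda)-\gamma C'(1,\lambda) & S'(0,\lambda)-\gamma S'(1,\lambda)\end{vmatrix},$$ and the spectrum is the collection of zeros of $\Delta$ counted with multiplicity (a multiset). Let $\alpha=0$ if $\gamma=1$ and $\alpha=1$ if $\gamma=-1$. The spectrum is numbered so that $\lambda_{2k}=(2k+\alpha)^2\pi^2+\varkappa_{2k}$ $(k\ge0)$ and $\lambda_{2k-1}=(2k-\alpha)^2\pi^2$ $(k\ge1)$, with $\{\varkappa_{2k}\}\in l_2$. Functions in $L_2$ are complex-valued and identified when equal a.e. Construction of $q^{[p]}$: Step 1. Put $\lambda^0_{2k,\alpha}=(2k+\alpha)^2\pi^2$ $(k\ge0)$, $\lambda^0_{2k-1,\alpha}=(2k-\alpha)^2\pi^2$ $(k\ge1)$ and construct $$\Delta(\lambda)=4\prod_{n=0}^\infty\frac{\lambda_n-\lambda}{\lambda^0_{n,\alpha}}\ \text{ if }\gamma=-1,\qquad \Delta(\lambda)=(\lambda-\lambda_0)\prod_{n=1}^\infty\frac{\lambda_n-\lambda}{\lambda^0_{n,\alpha}}\ \text{ if }\gamma=1.$$ Then let $w\in L_2(0,1)$ be $w(x)=2\sum_{k=1}^\infty f(\pi k)\sin\pi kx$ (convergence in $L_2(0,1)$), where $f(\rho)=\rho\,(1+\gamma^2-2\gamma\cos\rho-\Delta(\rho^2))$. Step 2. Put $q_a(\tfrac12-x)=p(x)$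 for $0<x<\tfrac12$. Step 3. Put $q_a(\tfrac12+x)=\gamma w(\tfrac12-x)-\gamma q_a(\tfrac12-x)$ for $0<x<\tfrac12$, and finally $$q^{[p]}(x)=\begin{cases}\gamma\, q_a(x-a+1), & x\in(0,a),\\ q_a(x-a), & x\in(a,1).\end{cases}$$ *)

(* Defs.v *)
(* R is an arbitrary realType and the complex numbers are R[i].
   R[i]^o is R[i] seen as a normed space over itself; limits and derivatives
   taken in it are the usual complex ones. *)
From HB Require Import structures.
From mathcomp Require Import all_boot all_order all_algebra.
From mathcomp Require Import all_classical all_reals all_analysis.
From mathcomp Require Import complex.

Set Implicit Arguments.
Unset Strict Implicit.
Unset Printing Implicit Defensive.

Import Order.TTheory GRing.Theory Num.Theory numFieldNormedType.Exports.

Local Open Scope classical_set_scope.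
Local Open Scope ring_scope.
Local Open Scope complex_scope.

Definition cabs (R : realType) (z : R[i]) : R := ComplexField.Normc.normc z.

Definition cexp (R : realType) (z : R[i]) : R[i] :=
  (expR (complex.Re z) * cos (complex.Im z)) +i*
  (expR (complex.Re z) * sin (complex.Im z)).

Definition ccos (R : realType) (z : R[i]) : R[i] :=
  (cexp ((0 +i* 1) * z) + cexp (- ((0 +i* 1) * z))) / 2.

Definition csin (R : realType) (z : R[i]) : R[i] :=
  (cexp ((0 +i* 1) * z) - cexp (- ((0 +i* 1) * z))) / (2 * (0 +i* 1)).

(* sin(rho x) / rho, with its limit x at rho = 0 *)
Definition sin_div (R : realType) (rho : R[i]) (x : R) : R[i] :=
  if rho == 0 then x%:C else csin (rho * x%:C) / rho.

Definition cderiv (R : realType) (y : R -> R[i]) (x : R) : R[i] :=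
  (derive1 (fun t => complex.Re (y t)) x) +i*
  (derive1 (fun t => complex.Im (y t)) x).

Definition cintegral (R : realType) (D : set R) (f : R -> R[i]) : R[i] :=
  (\int[@lebesgue_measure R]_(t in D) complex.Re (f t)) +i*
  (\int[@lebesgue_measure R]_(t in D) complex.Im (f t)).

Definition cintegral_from_to (R : realType) (a x : R) (f : R -> R[i]) : R[i] :=
  if a <= x then cintegral `[a, x] f else - cintegral `[x, a] f.

(* f in L_2(D); elements of L_2(D) are represented by functions on R whose
   values outside D are irrelevant. *)
Definition L2 (R : realType) (D : set R) (f : R -> R[i]) : Prop :=
  [/\ measurable_fun D (fun x => complex.Re (f x)),
      measurable_fun D (fun x => complex.Im (f x)) &
      (\int[@lebesgue_measure R]_(x in D) ((cabs (f x)) ^+ 2)%:E < +oo)%E].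

Definition ext0 (R : realType) (q : R -> R[i]) (t : R) : R[i] :=
  if 0 < t < 1 then q t else 0.

(* The solutions C(x, lambda), S(x, lambda) of -y'' + q y(a) = lambda y with
   C(a) = S'(a) = 1, C'(a) = S(a) = 0.  The formulas are even in rho, so any
   rho with rho^2 = lambda can be used.  As q is extended by 0, both are C^1
   functions on the whole line, and their derivatives at the end points 0 and 1
   agree with the one-sided derivatives there. *)
Definition solC (R : realType) (q : R -> R[i]) (a : R) (lambda : R[i])
    (x : R) : R[i] :=
  let rho := sqrtC lambda in
  ccos (rho * (x - a)%:C) +
  cintegral_from_to a x (fun t => sin_div rho (x - t) * ext0 q t).

Definition solS (R : realType) (a : R) (lambda : R[i]) (x : R) : R[i] :=
  sin_div (sqrtC lambda) (x - a).

Definition char_fun (R : realType) (q : R -> R[i]) (a : R) (gamma : R[i])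
    (lambda : R[i]) : R[i] :=
  let C := solC q a lambda in let C' := cderiv C in
  let S := solS a lambda in let S' := cderiv S in
  (C 0 - gamma * C 1) * (S' 0 - gamma * S' 1) -
  (S 0 - gamma * S 1) * (C' 0 - gamma * C' 1).

(* z is a zero of order m of F (not a zero if m = 0): near z,
   F(w) = (w - z)^m g(w) with g holomorphic and g(z) <> 0. *)
Definition zero_order (R : realType) (F : R[i] -> R[i]) (z : R[i]) (m : nat) :
    Prop :=
  exists g : R[i]^o -> R[i]^o,
    [/\ \forall w \near (z : R[i]^o), derivable g w 1,
        g z != 0 &
        \forall w \near (z : R[i]^o), F w = (w - z) ^+ m * g w].

(* The multiset {lam n : n in nat} is the spectrum: every z occurs in lam
   exactly as many times as its order as a zero of the characteristic
   function. *)
Definition is_spectrum (R : realType) (q : R -> R[i]) (a : R) (gamma : R[i])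
    (lam : nat -> R[i]) : Prop :=
  forall z : R[i], exists m : nat,
    zero_order (char_fun q a gamma) z m /\ ([set n | lam n = z] #= `I_m)%card.

(* used for gamma = 1 and gamma = -1 only *)
Definition alpha (R : realType) (gamma : R[i]) : nat :=
  if gamma == 1 then 0%N else 1%N.

(* lam0 gamma (2k) = (2k + alpha)^2 pi^2 and
   lam0 gamma (2k - 1) = (2k - alpha)^2 pi^2 *)
Definition lam0 (R : realType) (gamma : R[i]) (n : nat) : R[i] :=
  let m := if odd n then (n.+1 - alpha gamma)%N else (n + alpha gamma)%N in
  ((m%:R * pi) ^+ 2)%:C.

Definition numbered (R : realType) (gamma : R[i]) (lam : nat -> R[i]) : Prop :=
  (exists kappa : nat -> R[i],
      (\sum_(0 <= k <oo) ((cabs (kappa k)) ^+ 2)%:E < +oo)%E /\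
      forall k, lam (2 * k)%N = lam0 gamma (2 * k) + kappa k) /\
  (forall k, (1 <= k)%N -> lam (2 * k - 1)%N = lam0 gamma (2 * k - 1)).

Definition Delta_prod (R : realType) (gamma : R[i]) (lam : nat -> R[i])
    (z : R[i]) : R[i] :=
  if gamma == 1 then
    (z - lam 0%N) *
    limn (fun N => \prod_(1 <= n < N) ((lam n - z) / lam0 gamma n) : R[i]^o)
  else
    4 * limn (fun N => \prod_(0 <= n < N) ((lam n - z) / lam0 gamma n) : R[i]^o).

Definition f_of (R : realType) (gamma : R[i]) (lam : nat -> R[i])
    (rho : R[i]) : R[i] :=
  rho * (1 + gamma ^+ 2 - 2 * gamma * ccos rho - Delta_prod gamma lam (rho ^+ 2)).

Definition is_w (R : realType) (gamma : R[i]) (lam : nat -> R[i])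
    (w : R -> R[i]) : Prop :=
  L2 `]0, 1[ w /\
  (fun n : nat => (\int[@lebesgue_measure R]_(x in `]0%R, 1%R[)
     ((cabs (w x - 2 * \sum_(1 <= k < n.+1)
         f_of gamma lam (pi *+ k)%:C * (sin (pi *+ k * x))%:C)) ^+ 2)%:E)%E)
    @ \oo --> 0%E.

(* is_w determines w up to equality a.e. on ]0, 1[; a representative is
   chosen *)
Definition w_of (R : realType) (gamma : R[i]) (lam : nat -> R[i]) : R -> R[i] :=
  xget (fun=> 0) [set w | is_w gamma lam w].

Definition qa_of (R : realType) (gamma : R[i]) (w p : R -> R[i]) (y : R) :
    R[i] :=
  if y < 2^-1 then p (2^-1 - y)
  else let x := y - 2^-1 in gamma * w (2^-1 - x) - gamma * p x.

Definition q_of (R : realType) (a : R) (gamma : R[i]) (lam : nat -> R[i])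
    (p : R -> R[i]) (x : R) : R[i] :=
  let qa := qa_of gamma (w_of gamma lam) p in
  if x < a then gamma * qa (x - a + 1) else qa (x - a).

(* Main.v *)
(* Put [q_a y = q (y + a)] for [y < 1 - a], [q_a y = gamma * q (y + a - 1)]
   otherwise, and [w y = q_a y + gamma * q_a (1 - y)].  With [rho ^+ 2 = lambda],
     Delta lambda = 2 - 2 gamma cos rho - \int_0^1 w(y) sin (rho y) / rho dy,
   so the potential enters Delta only through [w], and [f (pi k)] is the integral
   of [w(y) sin (pi k y)]: the expansion of [w] in the sines recovers [w].  Since
   [w (1 - y) = gamma * w y], a potential with a given [w] is given by an
   arbitrary choice of [q_a] on (0, 1/2).
   It remains to see that Delta is the product over its zeros.  On large circles
   avoiding the zeros of Delta_0 = 2 - 2 gamma cos rho, both Delta / Delta_0 and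
   the quotient of the finite products tend to 1; the maximum principle carries
   this over to a fixed point, and Delta_0 has Euler's product.  The maximum
   principle is only needed up to the constant 2, for functions that are limits
   of polynomials on discs; it follows from averaging over roots of unity. *)

Require Import Defs.
From HB Require Import structures.
From mathcomp Require Import all_boot all_order all_algebra.
From mathcomp Require Import all_classical all_reals all_analysis.
From mathcomp Require Import complex measurable_realfun.
From mathcomp Require Import zify ring lra.

Set Implicit Arguments.
Unset Strict Implicit.
Unset Printing Implicit Defensive.

Import Order.TTheory GRing.Theory Num.Theory numFieldNormedType.Exports.

Local Open Scope classical_set_scope.
Local Open Scope ring_scope.
Local Open Scope complex_scope.

Local Notation Re := complex.Re.
Local Notation Im := complex.Im.

(** The product formula is a Hadamard factorization, obtained by comparison with the free case
    instead of growth theory. Holomorphy is replaced by uniform approximability by polynomials on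
    discs, which survives products, division by [z - c] at a zero, and division by tail products
    without zeros on the disc. The factor 2 lost in the maximum principle is harmless because it is
    applied to [H - 1], a quantity of order 1/K on the K-th circle. That order has two main sources:
    the integral against [w] is smaller than Delta_0 by a factor |rho|, and the square-summable
    shifts of the eigenvalues meet distances of order K (K - k) from the circle to the k-th node.
    Euler's partial products also serve as the approximating polynomials: their remainders are
    quotients of Wallis integrals, within C/n of 1 uniformly on discs. Completeness of the sines is
    what gives [w_of] a meaning: a choice operator returns a default unless some function satisfies
    [is_w]. The given potential [qstar] supplies one, and almost everywhere uniqueness passes the
    symmetry of its [w_pot] on to the chosen representative. *)

Lemma small_div (R : realType) (C e : R) : 0 <= C -> 0 < e ->
  exists N, forall n, (N <= n)%N -> C / n.+1%:R < e.
Proof.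
move=> C0 e0; exists (Num.truncn (C / e)).+1 => n Nn.
rewrite ltr_pdivrMr ?ltr0n // mulrC -ltr_pdivrMr //.
rewrite (lt_le_trans (truncnS_gt _)) // ler_nat.
by apply: leq_trans Nn _.
Qed.

(** * Complex numbers and trigonometric functions *)

Section ComplexModulus.
Context {R : realType}.
Implicit Types (z w : R[i]) (x y : R).

Lemma cabsE z : cabs z = Num.sqrt (Re z ^+ 2 + Im z ^+ 2).
Proof. by case: z. Qed.

Lemma normE z : `|z| = (cabs z)%:C.
Proof. by rewrite normc_def cabsE. Qed.

Lemma sqr_cabs z : cabs z ^+ 2 = Re z ^+ 2 + Im z ^+ 2.
Proof. by rewrite cabsE sqr_sqrtr // addr_ge0 // sqr_ge0. Qed.

Lemma cabs_ge0 z : 0 <= cabs z.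
Proof. by rewrite cabsE sqrtr_ge0. Qed.

Lemma cabs0 : cabs (0 : R[i]) = 0. Proof. exact: ComplexField.Normc.normc0. Qed.

Lemma cabs1 : cabs (1 : R[i]) = 1. Proof. exact: ComplexField.Normc.normc1. Qed.

Lemma cabsM z w : cabs (z * w) = cabs z * cabs w.
Proof. exact: ComplexField.Normc.normcM. Qed.

Lemma cabsV z : cabs z^-1 = (cabs z)^-1.
Proof. exact: ComplexField.Normc.normcV. Qed.

Lemma cabsX z n : cabs (z ^+ n) = cabs z ^+ n.
Proof. by elim: n => [|n IH]; rewrite ?expr0 ?cabs1 // !exprS cabsM IH. Qed.

Lemma cabsN z : cabs (- z) = cabs z. Proof. exact: complex.normcN. Qed.

Lemma cabs_leD z w : cabs (z + w) <= cabs z + cabs w.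
Proof. exact: complex.le_normcD. Qed.

Lemma cabs_distC z w : cabs (z - w) = cabs (w - z).
Proof. by rewrite -opprB cabsN. Qed.

Lemma cabs_leB z w : cabs (z - w) <= cabs z + cabs w.
Proof. by rewrite -(cabsN w) cabs_leD. Qed.

Lemma cabs_geB z w : cabs z - cabs w <= cabs (z - w).
Proof. by rewrite lerBlDr (le_trans _ (cabs_leD _ _)) // subrK. Qed.

Lemma cabs_eq0 z : (cabs z == 0) = (z == 0).
Proof.
apply/eqP/eqP => [|->]; last exact: cabs0.
exact: ComplexField.Normc.eq0_normc.
Qed.

Lemma cabs_gt0 z : (0 < cabs z) = (z != 0).
Proof. by rewrite lt_def cabs_ge0 cabs_eq0 andbT. Qed.

Lemma cabs_real x : cabs x%:C = `|x|.
Proof. by rewrite cabsE /= expr0n addr0 sqrtr_sqr. Qed.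

Lemma cabs_Re z : `|Re z| <= cabs z.
Proof. by rewrite cabsE -sqrtr_sqr ler_wsqrtr // lerDl sqr_ge0. Qed.

Lemma cabs_Im z : `|Im z| <= cabs z.
Proof. by rewrite cabsE -sqrtr_sqr ler_wsqrtr // lerDr sqr_ge0. Qed.

Lemma cabs_le_ReIm z : cabs z <= `|Re z| + `|Im z|.
Proof.
rewrite -(@ler_pXn2r _ 2) ?nnegrE ?cabs_ge0 ?addr_ge0 //.
by rewrite sqr_cabs sqrrD !real_normK ?num_real // lerD2r lerDl mulrn_wge0 // mulr_ge0.
Qed.

Lemma cabs_sum (I : Type) (r : seq I) (P : pred I) (F : I -> R[i]) :
  cabs (\sum_(i <- r | P i) F i) <= \sum_(i <- r | P i) cabs (F i).
Proof.
elim/big_rec2: _ => [|i y x _ IH]; first by rewrite cabs0.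
by rewrite (le_trans (cabs_leD _ _)) // lerD2l.
Qed.

Lemma cabs_nat n : cabs (n%:R : R[i]) = n%:R.
Proof. by rewrite -(rmorph_nat (real_complex R)) cabs_real normr_nat. Qed.

Lemma cReM z w : Re (z * w) = Re z * Re w - Im z * Im w.
Proof. by case: z => a b; case: w. Qed.

Lemma cImM z w : Im (z * w) = Re z * Im w + Im z * Re w.
Proof. by case: z => a b; case: w. Qed.

Lemma cReD z w : Re (z + w) = Re z + Re w.
Proof. by case: z => a b; case: w. Qed.

Lemma cImD z w : Im (z + w) = Im z + Im w.
Proof. by case: z => a b; case: w. Qed.

Lemma cReN z : Re (- z) = - Re z. Proof. by case: z. Qed.

Lemma cImN z : Im (- z) = - Im z. Proof. by case: z. Qed.

Lemma complex_eqP z w : Re z = Re w -> Im z = Im w -> z = w.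
Proof. by case: z => a b; case: w => c d /= -> ->. Qed.

(* Convergence in [R[i]^o] is stated with complex radii; only the moduli matter. *)
Lemma cvg_cabsP (u : nat -> R[i]) (l : R[i]) :
  (forall e : R, 0 < e -> \forall n \near \oo, cabs (u n - l) < e) ->
  ((u : nat -> R[i]^o) @ \oo --> (l : R[i]^o)).
Proof.
move=> H; apply/cvgrPdist_lt => e e0.
have [x xe] : exists x, e = x%:C.
  by apply/complex_realP; rewrite gtr0_real.
move: e0; rewrite xe ltcR => /H; apply: filterS => n.
by rewrite distrC normE ltcR.
Qed.

End ComplexModulus.

Section ComplexTrig.
Context {R : realType}.
Implicit Types (z w rho : R[i]) (x y u v t : R).

Lemma mul_i_i : (0 +i* 1) * (0 +i* 1) = -1 :> R[i].
Proof. by apply: complex_eqP => /=; rewrite ?(cReN, cImN) /=; ring. Qed.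

Lemma cexpD z w : cexp (z + w) = cexp z * cexp w.
Proof.
apply: complex_eqP; rewrite /cexp ?(cReM, cImM) /= cReD cImD expRD (cosD, sinD); ring.
Qed.

Lemma cexp0 : cexp (0 : R[i]) = 1.
Proof. by apply: complex_eqP; rewrite /= expR0 ?cos0 ?sin0 ?mul1r. Qed.

Lemma cexpNM z : cexp (- z) * cexp z = 1.
Proof. by rewrite -cexpD addNr cexp0. Qed.

Lemma cexp_neq0 z : cexp z != 0.
Proof. by apply/eqP => z0; have := cexpNM z; rewrite z0 mulr0 => /esym/eqP; rewrite oner_eq0. Qed.

Lemma cexpN z : cexp (- z) = (cexp z)^-1.
Proof. by apply: (mulIf (cexp_neq0 z)); rewrite cexpNM mulVf // cexp_neq0. Qed.

Let i_neq0 : (0 +i* 1) != 0 :> R[i].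
Proof. by rewrite eq_complex /= oner_eq0 andbF. Qed.

Lemma ccosN z : ccos (- z) = ccos z.
Proof. by rewrite /ccos mulrN opprK addrC. Qed.

Lemma csinN z : csin (- z) = - csin z.
Proof. by rewrite /csin mulrN opprK -[RHS]mulNr opprB. Qed.

Lemma ccos0 : ccos (0 : R[i]) = 1.
Proof. by rewrite /ccos mulr0 oppr0 cexp0 -mulr2n divff // pnatr_eq0. Qed.

Lemma csin0 : csin (0 : R[i]) = 0.
Proof. by rewrite /csin mulr0 oppr0 cexp0 subrr mul0r. Qed.

Lemma ccosD z w : ccos (z + w) = ccos z * ccos w - csin z * csin w.
Proof.
rewrite /ccos /csin !mulrDr opprD !cexpD !cexpN.
have := i_neq0; set I := 0 +i* 1 => I0; set a := cexp (I * z); set b := cexp (I * w).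
have I2 : I ^+ 2 = -1 by rewrite expr2 mul_i_i.
rewrite !mulf_div.
have -> : 2 * I * (2 * I) = - 4 by transitivity (4 * I ^+ 2); [ring | rewrite I2; ring].
by field; rewrite ?cexp_neq0.
Qed.

Lemma csinD z w : csin (z + w) = csin z * ccos w + ccos z * csin w.
Proof.
rewrite /ccos /csin !mulrDr opprD !cexpD !cexpN.
have := i_neq0; set I := 0 +i* 1 => I0; set a := cexp (I * z); set b := cexp (I * w).
by field; rewrite ?I0 ?cexp_neq0.
Qed.

Lemma ccos2Dcsin2 z : ccos z ^+ 2 + csin z ^+ 2 = 1.
Proof.
by have := ccosD z (- z); rewrite subrr ccos0 ccosN csinN mulrN opprK !expr2 => ->.
Qed.

(* Both are even in [rho], so they only depend on [rho ^+ 2]. *)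
Lemma ccos_sqr z w : z ^+ 2 = w ^+ 2 -> ccos z = ccos w.
Proof. by move/eqP; rewrite eqf_sqr => /orP[] /eqP->; rewrite ?ccosN. Qed.

Lemma sin_divN rho u : sin_div (- rho) u = sin_div rho u.
Proof.
rewrite /sin_div oppr_eq0; case: ifP => // _.
by rewrite mulNr csinN invrN mulrNN.
Qed.

End ComplexTrig.

(** * Growth of the sine and cosine in the complex plane *)

Section TrigBounds.
Context {R : realType}.
Implicit Types (z w rho : R[i]) (x y u v t : R).

Lemma sin_div0 rho : sin_div rho 0 = 0.
Proof. by rewrite /sin_div; case: ifP => // _; rewrite mulr0 csin0 mul0r. Qed.

Lemma sin_div_oppr rho u : sin_div rho (- u) = - sin_div rho u.
Proof.
rewrite /sin_div; case: ifP => _; first by rewrite rmorphN.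
by rewrite rmorphN mulrN csinN mulNr.
Qed.

Lemma sin_divD rho u v : sin_div rho (u + v) =
  sin_div rho u * ccos (rho * v%:C) + ccos (rho * u%:C) * sin_div rho v.
Proof.
rewrite /sin_div; case: eqP => [->|_].
  by rewrite !mul0r ccos0 mulr1 mul1r rmorphD.
by rewrite rmorphD mulrDr csinD mulrDl mulrAC mulrA.
Qed.

Lemma ccos_mulD rho u v : ccos (rho * (u + v)%:C) =
  ccos (rho * u%:C) * ccos (rho * v%:C) -
  rho ^+ 2 * (sin_div rho u * sin_div rho v).
Proof.
rewrite /sin_div; case: eqP => [->|/eqP r0].
  by rewrite !mul0r ccos0 mulr1 expr0n /= mul0r subr0.
rewrite rmorphD mulrDr ccosD; congr (_ - _).
by field.
Qed.

Lemma ccos_mulN rho u : ccos (rho * (- u)%:C) = ccos (rho * u%:C).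
Proof. by rewrite rmorphN mulrN ccosN. Qed.

Lemma cos2_sin_div2 rho u :
  ccos (rho * u%:C) ^+ 2 + rho ^+ 2 * sin_div rho u ^+ 2 = 1.
Proof.
have := ccos_mulD rho u (- u).
rewrite subrr mulr0 ccos0 ccos_mulN sin_div_oppr => ->; ring.
Qed.

Definition coshR y := (expR y + expR (- y)) / 2.
Definition sinhR y := (expR y - expR (- y)) / 2.

Lemma Re_iM z : Re ((0 +i* 1) * z) = - Im z.
Proof. by rewrite cReM /= mul0r mul1r sub0r. Qed.

Lemma Im_iM z : Im ((0 +i* 1) * z) = Re z.
Proof. by rewrite cImM /= mul0r mul1r add0r. Qed.

Lemma ccosE z : ccos z =
  (cos (Re z) * coshR (Im z)) +i* (- (sin (Re z) * sinhR (Im z))).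
Proof.
have V2 : (2 : R[i])^-1 = (2^-1 : R)%:C by rewrite fmorphV rmorph_nat.
apply: complex_eqP; rewrite /ccos V2 /= ?(cReM, cImM, cReD, cImD, cReN, cImN) /=
  ?(cReM, cImM, cReD, cImD, cReN, cImN) /= /coshR /sinhR;
  rewrite ?mul0r ?mul1r ?mulr0 ?add0r ?addr0 ?subr0 ?sub0r ?opprK ?cosN ?sinN ?Re_iM ?Im_iM ?opprK; by field.
Qed.

Lemma csinE z : csin z =
  (sin (Re z) * coshR (Im z)) +i* (cos (Re z) * sinhR (Im z)).
Proof.
have V2 : (2 * (0 +i* 1) : R[i])^-1 = 0 +i* (- 2^-1).
  apply: (mulfI (x := 2 * (0 +i* 1))).
    by rewrite mulf_neq0 ?pnatr_eq0 // eq_complex /= oner_eq0 andbF.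
  rewrite divff; last by rewrite mulf_neq0 ?pnatr_eq0 // eq_complex /= oner_eq0 andbF.
  by apply: complex_eqP => /=; field.
apply: complex_eqP; rewrite /csin V2 /= ?(cReM, cImM, cReD, cImD, cReN, cImN) /=
  ?(cReM, cImM, cReD, cImD, cReN, cImN) /= /coshR /sinhR;
  rewrite ?mul0r ?mul1r ?mulr0 ?add0r ?addr0 ?subr0 ?sub0r ?opprK ?cosN ?sinN ?Re_iM ?Im_iM ?opprK; by field.
Qed.

Lemma coshR2 y : coshR y ^+ 2 = 1 + sinhR y ^+ 2.
Proof. by rewrite /coshR /sinhR expRN; field; rewrite expR_eq0. Qed.

Lemma coshR_ge1 y : 1 <= coshR y.
Proof.
have c0 : 0 <= coshR y by rewrite divr_ge0 ?addr_ge0 ?expR_ge0.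
by rewrite -(@ler_pXn2r _ 2) ?nnegrE // expr1n coshR2 lerDl sqr_ge0.
Qed.

Lemma coshR_le y : coshR y <= expR `|y|.
Proof.
have h u : 0 <= u -> (expR u + expR (- u)) / 2 <= expR u.
  move=> u0; rewrite ler_pdivrMr // mulr_natr mulr2n lerD2l ler_expR; lra.
have [y0|y0] := leP 0 y; first by rewrite ger0_norm //; exact: h.
have := h (- y); rewrite opprK addrC ltr0_norm // oppr_ge0 => -> //; exact: ltW.
Qed.

Lemma coshR_ge y : expR `|y| / 2 <= coshR y.
Proof.
rewrite ler_pM2r ?invr_gt0 //.
have [y0|y0] := leP 0 y; first by rewrite ger0_norm // lerDl expR_ge0.
by rewrite ltr0_norm // lerDr expR_ge0.
Qed.

Lemma sinhR_le y : `|sinhR y| <= `|y| * expR `|y|.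
Proof.
have h u : 0 <= u -> 0 <= (expR u - expR (- u)) / 2 <= u * expR u.
  move=> u0; apply/andP; split.
    by apply: divr_ge0 => //; rewrite subr_ge0 ler_expR; lra.
  have e1 := expR_ge1Dx (- u); have e2 := expR_gt0 u; have e3 := expRxMexpNx_1 u.
  have e4 := expR_gt0 (- u).
  have : expR u * (1 - u) <= 1 by rewrite -[leRHS]e3 ler_pM2l.
  have e5 : 1 <= expR u by rewrite -(expR0) ler_expR.
  rewrite ler_pdivrMr //.
  have : u <= u * expR u by rewrite ler_peMr.
  nra.
have [y0|y0] := leP 0 y.
  have /andP[a b] := h _ y0.
  by rewrite /sinhR !ger0_norm.
have := h (- y); rewrite opprK oppr_ge0 ltW // => /(_ isT) /andP[a b].
by rewrite -[`|sinhR y|]normrN /sinhR -mulNr opprB ger0_norm // ltr0_norm.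
Qed.

Lemma sin_le_norm x : `|sin x| <= `|x|.
Proof.
have h u : 0 <= u -> `|sin u| <= u.
  move=> u0; have [/eqP->|u1] := boolP (u == 0); first by rewrite sin0 normr0.
  have up : 0 < u by rewrite lt_def u1.
  have [c _] := MVT_segment u0 (fun x _ => is_derive_sin x)
    (continuous_subspaceT (@continuous_sin R)).
  rewrite sin0 !subr0 => ->.
  by rewrite normrM (ger0_norm u0) ler_piMl // cos_max.
have [x0|x0] := leP 0 x; first by rewrite (ger0_norm x0) h.
by rewrite -[`|sin x|]normrN -sinN (ltr0_norm x0) h // oppr_ge0 ltW.
Qed.

(** With [coshR2] the mixed products cancel; the upper bounds on [csin] and [ccos] below reduce to
    real inequalities through these two identities. *)
Lemma sqr_cabs_csin z : cabs (csin z) ^+ 2 = sin (Re z) ^+ 2 + sinhR (Im z) ^+ 2.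
Proof.
by rewrite sqr_cabs csinE /= [(_ * coshR _) ^+ 2]exprMn [(_ * sinhR _) ^+ 2]exprMn coshR2 [cos _ ^+ 2]cos2sin2; ring.
Qed.

Lemma sqr_cabs_ccos z : cabs (ccos z) ^+ 2 = cos (Re z) ^+ 2 + sinhR (Im z) ^+ 2.
Proof.
by rewrite sqr_cabs ccosE /= sqrrN [(_ * coshR _) ^+ 2]exprMn [(_ * sinhR _) ^+ 2]exprMn coshR2 sin2cos2; ring.
Qed.

Lemma cabs_csin_le z : cabs (csin z) <= expR `|Im z|.
Proof.
rewrite -(@ler_pXn2r _ 2) ?nnegrE ?cabs_ge0 ?expR_ge0 // sqr_cabs_csin.
rewrite (@le_trans _ _ (coshR (Im z) ^+ 2)) //.
  by rewrite coshR2 lerD2r sin2cos2 gerBl sqr_ge0.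
by rewrite ler_pXn2r ?nnegrE ?expR_ge0 ?coshR_le // (le_trans ler01) ?coshR_ge1.
Qed.

Lemma cabs_ccos_le z : cabs (ccos z) <= expR `|Im z|.
Proof.
rewrite -(@ler_pXn2r _ 2) ?nnegrE ?cabs_ge0 ?expR_ge0 // sqr_cabs_ccos.
rewrite (@le_trans _ _ (coshR (Im z) ^+ 2)) //.
  by rewrite coshR2 lerD2r cos2sin2 gerBl sqr_ge0.
by rewrite ler_pXn2r ?nnegrE ?expR_ge0 ?coshR_le // (le_trans ler01) ?coshR_ge1.
Qed.

Lemma cabs_csin_le_id z : cabs (csin z) <= cabs z * expR `|Im z|.
Proof.
rewrite -(@ler_pXn2r _ 2) ?nnegrE ?mulr_ge0 ?cabs_ge0 ?expR_ge0 // sqr_cabs_csin.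
rewrite [leRHS]exprMn sqr_cabs mulrDl; apply: lerD.
  rewrite (@le_trans _ _ (Re z ^+ 2)) //.
    rewrite -[sin _ ^+ 2]real_normK ?num_real // -[Re z ^+ 2]real_normK ?num_real //.
    by rewrite ler_pXn2r ?nnegrE // sin_le_norm.
  rewrite ler_peMr ?sqr_ge0 // exprn_ege1 //.
  by rewrite -(@expR0 R) ler_expR.
rewrite -[sinhR _ ^+ 2]real_normK ?num_real // -[Im z ^+ 2]real_normK ?num_real //.
by rewrite -exprMn ler_pXn2r ?nnegrE ?mulr_ge0 ?expR_ge0 // sinhR_le.
Qed.

Lemma one_sub_ccos z : 1 - ccos z = 2 * csin (z / 2) ^+ 2.
Proof.
have {1}-> : z = z / 2 + z / 2 by field.
rewrite ccosD -[X in X - _](ccos2Dcsin2 (z / 2)); ring.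
Qed.

Lemma cabs_one_sub_ccos z : cabs (1 - ccos z) <= cabs z ^+ 2 * expR (cabs z).
Proof.
have c2 : cabs (z / 2) = cabs z / 2 by rewrite cabsM cabsV cabs_nat.
rewrite one_sub_ccos cabsM cabs_nat cabsX.
have h : cabs (csin (z / 2)) ^+ 2 <= (cabs z / 2) ^+ 2 * expR (cabs z).
  have -> : expR (cabs z) = expR (cabs z / 2) ^+ 2.
    by rewrite -expRM_natr; congr expR; field.
  rewrite -exprMn ler_pXn2r ?nnegrE ?mulr_ge0 ?expR_ge0 ?cabs_ge0 ?invr_ge0 //.
  rewrite (le_trans (cabs_csin_le_id _)) // c2 ler_wpM2l ?divr_ge0 ?cabs_ge0 //.
  by rewrite ler_expR -c2 cabs_Im.
apply: (le_trans (ler_wpM2l _ h)) => //.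
have := mulr_ge0 (sqr_ge0 (cabs z)) (expR_ge0 (cabs z)); lra.
Qed.

Lemma cabs_sin_div_le rho u : cabs (sin_div rho u) <= `|u| * expR (cabs rho * `|u|).
Proof.
rewrite /sin_div; case: eqP => [->|/eqP r0].
  by rewrite cabs_real cabs0 mul0r expR0 mulr1.
rewrite cabsM cabsV ler_pdivrMr ?cabs_gt0 //.
rewrite (le_trans (cabs_csin_le_id _)) // cabsM cabs_real.
rewrite [X in _ <= X]mulrAC [cabs rho * _]mulrC ler_wpM2l ?mulr_ge0 ?cabs_ge0 //.
rewrite ler_expR (le_trans (cabs_Im _)) // cabsM cabs_real mulrC //.
Qed.

Lemma cabs_sin_div_le_Im rho u : rho != 0 -> 0 <= u <= 1 ->
  cabs (sin_div rho u) <= expR `|Im rho| / cabs rho.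
Proof.
move=> r0 /andP[u0 u1]; rewrite /sin_div (negPf r0) cabsM cabsV.
rewrite ler_pM2r ?invr_gt0 ?cabs_gt0 // (le_trans (cabs_csin_le _)) // ler_expR.
rewrite cImM /= mulr0 add0r normrM (ger0_norm u0) ler_piMr //.
Qed.

(* [|1 -+ cos rho| = cosh (Im rho) -+ cos (Re rho)] *)
Lemma cabs_one_sub_mul_ccos (g : R) rho : g ^+ 2 = 1 ->
  cabs (1 - g%:C * ccos rho) = coshR (Im rho) - g * cos (Re rho).
Proof.
move=> g2; set C := coshR _; set c := cos _.
have ge : 0 <= C - g * c.
  rewrite subr_ge0 (le_trans _ (coshR_ge1 _)) // (le_trans (ler_norm _)) //.
  have g1 : `|g| = 1.
    by apply/eqP; rewrite -(@eqrXn2 _ 2) // real_normK ?num_real // g2 expr1n.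
  by rewrite normrM g1 mul1r cos_max.
apply/eqP; rewrite -(@eqrXn2 _ 2) ?cabs_ge0 // sqr_cabs ccosE.
rewrite ?(cReM, cImM, cReD, cImD, cReN, cImN) /= ?(cReM, cImM, cReD, cImD, cReN, cImN) /=.
rewrite -/C -/c; set s := sin _; set h := sinhR _.
have s2 : s ^+ 2 = 1 - c ^+ 2 by exact: sin2cos2.
have h2 : h ^+ 2 = C ^+ 2 - 1 by rewrite /C coshR2 addrAC subrr add0r.
apply/eqP; transitivity
  (1 - 2 * g * c * C + g ^+ 2 * (c ^+ 2 * C ^+ 2) + g ^+ 2 * (s ^+ 2 * h ^+ 2)).
  by ring.
rewrite s2 h2 g2; transitivity (C ^+ 2 - 2 * g * c * C + g ^+ 2 * c ^+ 2).
  by rewrite g2; ring.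
by ring.
Qed.

(** The modulus equals cosh (Im rho) - g cos (Re rho). If |Re rho| is within 1 of [T], then g cos
    (Re rho) <= 0, because g cos T = -1, and cosh alone suffices. Otherwise |Im rho|^2 >= 2T - 1 >=
    5, hence exp |Im rho| >= 4 and cosh dominates the possible loss of 1. *)
Lemma circle_lower_bound (g T : R) rho : g ^+ 2 = 1 -> cos T = - g -> sin T = 0 ->
  3 <= T -> cabs rho = T -> expR `|Im rho| / 4 <= cabs (1 - g%:C * ccos rho).
Proof.
move=> g2 cT sT T3 rT; rewrite cabs_one_sub_mul_ccos //.
have C1 := coshR_ge1 (Im rho); have C2 := coshR_ge (Im rho).
have g1 : `|g| = 1.
  by apply/eqP; rewrite -(@eqrXn2 _ 2) // real_normK ?num_real // g2 expr1n.
have e0 := expR_gt0 `|Im rho|.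
have xT := cabs_Re rho; rewrite rT in xT.
have [hx|hx] := leP (T - 1) `|Re rho|.
  have : 0 <= cos (T - `|Re rho|).
    apply: cos_ge0_pihalf; have := @pihalf_ge1 R; lra.
  rewrite cosB cT sT mul0r addr0 cos_norm => h; lra.
have y2 : 2 <= `|Im rho|.
  rewrite -(@ler_pXn2r _ 2) ?nnegrE //.
  have := sqr_cabs rho; rewrite rT -(real_normK (num_real (Re rho))) -(real_normK (num_real (Im rho))) => e.
  have : `|Re rho| ^+ 2 <= (T - 1) ^+ 2 by rewrite ler_pXn2r ?nnegrE ?(ltW hx) //; lra.
  nra.
have e4 : 4 <= expR `|Im rho|.
  have -> : 4 = 2 * 2 :> R by ring.
  have h1 := expR_ge1Dx (1 : R).
  have : expR (1 + 1) <= expR `|Im rho| :> R by rewrite ler_expR; lra.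
  rewrite expRD; nra.
have : g * cos (Re rho) <= 1.
  by rewrite (le_trans (ler_norm _)) // normrM g1 mul1r cos_max.
lra.
Qed.

End TrigBounds.

(** * Derivatives of the trigonometric kernels in the real variable *)

Section ComplexDerivative.
Context {R : realType}.
Implicit Types (z w rho l m : R[i]) (x u t b : R) (f g : R -> R[i]).

Definition is_cderive f x l :=
  is_derive x (1 : R) (fun t => Re (f t)) (Re l) /\
  is_derive x (1 : R) (fun t => Im (f t)) (Im l).

Lemma is_cderive_val f x l : is_cderive f x l -> cderiv f x = l.
Proof.
move=> [h1 h2]; rewrite /cderiv !derive1E.
by rewrite (@derive_val _ _ _ _ _ _ _ h1) (@derive_val _ _ _ _ _ _ _ h2); case: l {h1 h2}.
Qed.

Lemma is_cderiveD f g x l m : is_cderive f x l -> is_cderive g x m ->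
  is_cderive (fun t => f t + g t) x (l + m).
Proof.
move=> [f1 f2] [g1 g2]; split.
  rewrite cReD (_ : (fun t => _) = (fun t => Re (f t)) + (fun t => Re (g t))); first exact: is_deriveD.
  by apply/funext => t; rewrite cReD.
rewrite cImD (_ : (fun t => _) = (fun t => Im (f t)) + (fun t => Im (g t))); first exact: is_deriveD.
by apply/funext => t; rewrite cImD.
Qed.

Lemma is_cderiveM f g x l m : is_cderive f x l -> is_cderive g x m ->
  is_cderive (fun t => f t * g t) x (f x * m + l * g x).
Proof.
move=> [f1 f2] [g1 g2]; split.
  rewrite cReD !cReM (_ : (fun t => _) = (fun t => Re (f t)) * (fun t => Re (g t)) -
     (fun t => Im (f t)) * (fun t => Im (g t))); last by apply/funext => t; rewrite cReM.
  by apply: is_derive_eq; rewrite /GRing.scale /=; ring.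
rewrite cImD !cImM (_ : (fun t => _) = (fun t => Re (f t)) * (fun t => Im (g t)) +
     (fun t => Im (f t)) * (fun t => Re (g t))); last by apply/funext => t; rewrite cImM.
by apply: is_derive_eq; rewrite /GRing.scale /=; ring.
Qed.

Lemma is_cderive_cst z x : is_cderive (fun=> z) x 0.
Proof. by split; apply: is_derive_cst. Qed.

Lemma is_cderiveZ z f x l : is_cderive f x l -> is_cderive (fun t => z * f t) x (z * l).
Proof. by move=> h; have := is_cderiveM (is_cderive_cst z x) h; rewrite mul0r addr0. Qed.

Lemma is_cderive_real (h : R -> R) x d : is_derive x 1 h d ->
  is_cderive (fun t => (h t)%:C) x d%:C.
Proof. by move=> ?; split => //=; exact: is_derive_cst. Qed.

Lemma is_cderive_cexp z b x :
  is_cderive (fun t => cexp (z * (t + b)%:C)) x (z * cexp (z * (x + b)%:C)).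
Proof.
have E t : cexp (z * (t + b)%:C) =
    (expR (Re z * (t + b)) * cos (Im z * (t + b))) +i*
    (expR (Re z * (t + b)) * sin (Im z * (t + b))).
  by rewrite /cexp cReM cImM /= !mulr0 subr0 add0r.
have D c : is_derive x 1 (fun t : R => c * (t + b)) c.
  rewrite (_ : (fun t => _) = c \*: (id + cst b)); last by apply/funext.
  by apply: is_derive_eq; rewrite addr0 /GRing.scale /= mulr1.
split.
  rewrite (_ : (fun t => _) = (expR \o (fun t => Re z * (t + b))) *
    (cos \o (fun t => Im z * (t + b)))); last by apply/funext => t; rewrite E.
  apply: is_derive_eq; rewrite E cReM /= /GRing.scale /=; ring.
rewrite (_ : (fun t => _) = (expR \o (fun t => Re z * (t + b))) *
    (sin \o (fun t => Im z * (t + b)))); last by apply/funext => t; rewrite E.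
apply: is_derive_eq; rewrite E cImM /= /GRing.scale /=; ring.
Qed.

Lemma is_cderive_eq f x l m : is_cderive f x l -> l = m -> is_cderive f x m.
Proof. by move=> h <-. Qed.

Lemma is_cderive_ccos rho b x : is_cderive (fun t => ccos (rho * (t + b)%:C)) x
  (- (rho ^+ 2 * sin_div rho (x + b))).
Proof.
have [->|r0] := eqVneq rho 0.
  rewrite expr0n mul0r oppr0 (_ : (fun t => _) = fun=> 1); first exact: is_cderive_cst.
  by apply/funext => t; rewrite mul0r ccos0.
have := is_cderiveD (is_cderiveZ 2^-1 (is_cderive_cexp ((0 +i* 1) * rho) b x))
   (is_cderiveZ 2^-1 (is_cderive_cexp (- ((0 +i* 1) * rho)) b x)).
rewrite (_ : (fun t => _) = fun t => ccos (rho * (t + b)%:C)); last first.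
  by apply/funext => t; rewrite /ccos !mulNr -!mulrA; ring.
move/is_cderive_eq; apply; rewrite /sin_div (negPf r0) /csin !mulNr -!mulrA.
have I2 : (0 +i* 1) ^+ 2 = -1 :> R[i] by rewrite expr2 mul_i_i.
have I0 : (0 +i* 1) != 0 :> R[i] by rewrite eq_complex /= oner_eq0 andbF.
move: I2 I0; set I := 0 +i* 1; set a := cexp _; set c := cexp _ => I2 I0.
by rewrite -[RHS]mulN1r -I2; field; rewrite r0 I0.
Qed.

Lemma is_cderive_sin_div rho b x : is_cderive (fun t => sin_div rho (t + b)) x
  (ccos (rho * (x + b)%:C)).
Proof.
have [->|r0] := eqVneq rho 0.
  rewrite mul0r ccos0 (_ : (fun t => _) = fun t => (t + b)%:C); last first.
    by apply/funext => t; rewrite /sin_div eqxx.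
  apply: is_cderive_real.
  by rewrite (_ : (fun t => _) = id + cst b) //; apply: is_derive_eq; rewrite addr0.
have I0 : (0 +i* 1) != 0 :> R[i] by rewrite eq_complex /= oner_eq0 andbF.
have := is_cderiveD (is_cderiveZ (2 * (0 +i* 1))^-1 (is_cderiveZ rho^-1 (is_cderive_cexp ((0 +i* 1) * rho) b x)))
   (is_cderiveZ (- (2 * (0 +i* 1))^-1) (is_cderiveZ rho^-1 (is_cderive_cexp (- ((0 +i* 1) * rho)) b x))).
rewrite (_ : (fun t => _) = fun t => sin_div rho (t + b)); last first.
  apply/funext => t; rewrite /sin_div (negPf r0) /csin !mulNr -!mulrA.
  by move: I0; set I := 0 +i* 1 => I0; field; rewrite r0 I0.
move/is_cderive_eq; apply; rewrite /ccos !mulNr -!mulrA.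
by move: I0; set I := 0 +i* 1 => I0; field; rewrite r0 I0.
Qed.

End ComplexDerivative.

(** * Limits of polynomials on discs *)

Section PolynomialDisc.
Context {R : realType}.
Implicit Types (z w c : R[i]) (r e M : R) (p q : {poly R[i]}).

Lemma poly_disc_bound p r :
  exists2 B, 0 <= B & forall z, cabs z <= r -> cabs p.[z] <= B.
Proof.
exists (\sum_(i < size p) cabs p`_i * `|r| ^+ i).
  by apply: sumr_ge0 => i _; rewrite mulr_ge0 ?cabs_ge0 ?exprn_ge0.
move=> z zr; rewrite horner_coef (le_trans (cabs_sum _ _ _)) //.
apply: ler_sum => i _; rewrite cabsM cabsX ler_wpM2l ?cabs_ge0 //.
by rewrite lerXn2r ?nnegrE ?cabs_ge0 // (le_trans zr) // ler_norm.
Qed.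

Lemma unity_root_exists n : (0 < n)%N -> exists w : R[i],
  [/\ cabs w = 1, w ^+ n = 1 & forall k, (0 < k < n)%N -> w ^+ k != 1].
Proof.
move=> n0; have n0' : n%:R != 0 :> R by rewrite pnatr_eq0 -lt0n.
pose th : R := pi *+ 2 / n%:R.
pose w : R[i] := cos th +i* sin th.
have wX k : w ^+ k = cos (th * k%:R) +i* sin (th * k%:R).
  elim: k => [|k IH]; first by rewrite mulr0 cos0 sin0.
  rewrite exprS IH -[in RHS]natr1 mulrDr mulr1 [_ + th]addrC cosD sinD.
  apply: complex_eqP; rewrite ?(cReM, cImM) //= [sin th * cos _ + _]addrC //.
exists w; split.
- apply/eqP; rewrite -(@eqrXn2 _ 2) ?cabs_ge0 // sqr_cabs /= cos2Dsin2 expr1n //.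
- by rewrite wX /th divfK // cos2pi sin2pi.
move=> k /andP[k0 kn]; rewrite wX; apply/negP => /eqP [] c1 _.
have kn' : k%:R < n%:R :> R by rewrite ltr_nat.
have k0' : 0 < k%:R :> R by rewrite ltr0n.
have p0 := @pi_gt0 R.
(* By the double-angle formula cos (2 pi k / n) = 1 would force this sine to vanish, although pi k /
   n lies strictly between 0 and pi. *)
have : 0 < sin (pi * (k%:R / n%:R)) :> R.
  apply: sin_gt0_pi; rewrite pmulr_rgt0 // divr_gt0 ?ltr0n //=.
  by rewrite gtr_pMr // ltr_pdivrMr ?mul1r // ltr0n.
have := cos_mulr2n (pi * (k%:R / n%:R) : R); rewrite cos2sin2.
have -> : pi * (k%:R / n%:R) *+ 2 = th * k%:R :> R by rewrite /th -mulr_natr; field.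
rewrite c1 => h s0.
have : 0 < sin (pi * (k%:R / n%:R)) ^+ 2 :> R by rewrite exprn_gt0.
move: h; rewrite -mulr_natr; lra.
Qed.

Lemma sum_unity_root (w : R[i]) n : w ^+ n = 1 -> w != 1 ->
  \sum_(j < n) w ^+ j = 0.
Proof.
move=> wn w1; have := subrX1 w n; rewrite wn subrr => /esym/eqP.
by rewrite mulf_eq0 subr_eq0 (negPf w1) => /eqP.
Qed.

(** Cauchy's estimate with the contour integral replaced by an average over n-th roots of unity. It
    is exact for a polynomial once [n] exceeds the degree and [k]. The inverse power [w ^- k] is
    written [w ^+ (n - k)]. *)
Lemma cauchy_coef_bound p r M k : 0 < r ->
  (forall z, cabs z = r -> cabs p.[z] <= M) -> cabs p`_k * r ^+ k <= M.
Proof.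
move=> r0 pM.
pose n := (maxn (size p) k).+1.
have kn : (k < n)%N by rewrite ltnS leq_maxr.
have [w [w1 wn wk]] := unity_root_exists (ltn0Sn _ : 0 < n)%N.
have cw j : cabs (r%:C * w ^+ j) = r.
  by rewrite cabsM cabs_real gtr0_norm // cabsX w1 expr1n mulr1.
have E : \sum_(j < n) p.[r%:C * w ^+ j] * (w ^+ (n - k)) ^+ j = n%:R * (p`_k * r%:C ^+ k).
  under eq_bigr => j _.
    rewrite (@horner_coef_wide _ n); last by rewrite ltnW // ltnS leq_maxl.
    rewrite mulr_suml.
    under eq_bigr => i _ do
      rewrite exprMn mulrA -mulrA -!exprM (mulnC j) !exprM -exprMn -exprD.
    over.
  rewrite exchange_big /=.
  under eq_bigr => i _ do rewrite -mulr_sumr.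
  rewrite (bigD1 (Ordinal kn)) //= [X in _ + X]big1 ?addr0.
    rewrite subnKC ?(ltnW kn) // wn; under eq_bigr do rewrite expr1n.
    by rewrite sumr_const card_ord mulrC.
  move=> i /eqP/val_eqP /= ik; rewrite sum_unity_root ?mulr0 //.
    by rewrite -exprM mulnC exprM wn expr1n.
  (* The exponent [i + (n - k)] is not a multiple of [n]: it is positive and below [n] if [i < k],
     and it equals [n] plus the number [i - k < n] if [i > k]. *)
  have [lt|ge] := ltnP i k.
    by apply: wk; rewrite addn_gt0 subn_gt0 kn orbT /= addnBA ?(ltnW kn) //
      ltn_subLR ?ltn_add2r // (leq_trans (ltnW kn)) // leq_addl.
  have ki : (k < i)%N by rewrite ltn_neqAle eq_sym ik.
  rewrite addnBA ?(ltnW kn) // addnC -addnBA // exprD wn mul1r.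
  by apply: wk; rewrite subn_gt0 ki /= (leq_ltn_trans (leq_subr _ _)).
have : cabs (n%:R * (p`_k * r%:C ^+ k)) <= n%:R * M.
  rewrite -E (le_trans (cabs_sum _ _ _)) //.
  rewrite (@le_trans _ _ (\sum_(j < n) M)) //; last by rewrite sumr_const card_ord mulr_natl.
  apply: ler_sum => j _; rewrite cabsM !cabsX w1 !expr1n mulr1.
  exact: pM.
by rewrite cabsM cabs_nat ler_pM2l ?ltr0n // cabsM cabsX cabs_real gtr0_norm.
Qed.

(** At half the radius the Cauchy estimates bound the i-th term by M / 2^i; the factor 2 is the sum
    of the geometric series. *)
Lemma poly_weak_max p r M z : 0 < r ->
  (forall w, cabs w = r -> cabs p.[w] <= M) -> cabs z <= r / 2 ->
  cabs p.[z] <= 2 * M.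
Proof.
move=> r0 pM zr.
have M0 : 0 <= M.
  by rewrite (le_trans _ (pM r%:C _)) ?cabs_ge0 // cabs_real gtr0_norm.
rewrite horner_coef (le_trans (cabs_sum _ _ _)) //.
rewrite (@le_trans _ _ (\sum_(i < size p) M * 2^-1 ^+ i)) //.
  apply: ler_sum => i _; rewrite cabsM cabsX.
  apply: (@le_trans _ _ (cabs p`_i * (r / 2) ^+ i)).
    by rewrite ler_wpM2l ?cabs_ge0 // lerXn2r ?nnegrE ?cabs_ge0 // divr_ge0 // ltW.
  by rewrite exprMn mulrA ler_wpM2r ?exprn_ge0 // cauchy_coef_bound.
rewrite -mulr_sumr mulrC ler_wpM2r //.
have := subrX1 (2^-1 : R) (size p).
have : 0 <= (2^-1 : R) ^+ size p by rewrite exprn_ge0.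
lra.
Qed.

End PolynomialDisc.

(** * Functions approximable by polynomials on a disc *)

Section UniformPolynomialLimits.
Context {R : realType}.
Implicit Types (z w c : R[i]) (r e M : R) (p q : {poly R[i]}) (f g : R[i] -> R[i]).

(** Stands in for holomorphy on the disc. Both facts needed later, the weak maximum principle and
    divisibility by [z - c] at a zero, hold for polynomials with explicit bounds and pass to uniform
    limits. *)
Definition disc_approx r f := forall e, 0 < e ->
  exists p : {poly R[i]}, forall z, cabs z <= r -> cabs (f z - p.[z]) < e.

Definition entire f := forall r, disc_approx r f.

Lemma disc_approx_poly r p : disc_approx r (horner p).
Proof. by move=> e e0; exists p => z _; rewrite subrr cabs0. Qed.

Lemma disc_approx_ext r f g :
  (forall z, cabs z <= r -> f z = g z) -> disc_approx r f -> disc_approx r g.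
Proof. by move=> fg fa e /fa[p pP]; exists p => z zr; rewrite -fg ?pP. Qed.

Lemma disc_approx_cst r c : disc_approx r (fun=> c).
Proof.
by apply: disc_approx_ext (@disc_approx_poly r c%:P) => z _; rewrite hornerC.
Qed.

Lemma disc_approxD r f g : disc_approx r f -> disc_approx r g ->
  disc_approx r (fun z => f z + g z).
Proof.
move=> fa ga e e0; have e2 : 0 < e / 2 by rewrite divr_gt0.
have [p pP] := fa _ e2; have [q qP] := ga _ e2.
exists (p + q) => z zr; rewrite hornerD opprD addrACA.
by rewrite (le_lt_trans (cabs_leD _ _)) // [ltRHS](splitr e) ltrD ?pP ?qP.
Qed.

Lemma disc_approx_bound r f : disc_approx r f ->
  exists2 B, 0 <= B & forall z, cabs z <= r -> cabs (f z) <= B.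
Proof.
move=> /(_ 1 ltr01)[p pP]; have [B B0 BP] := poly_disc_bound p r.
exists (1 + B); first by rewrite addr_ge0.
move=> z zr; rewrite -(subrK p.[z] (f z)) (le_trans (cabs_leD _ _)) //.
by rewrite lerD ?BP // ltW // pP.
Qed.

Lemma disc_approxM r f g : disc_approx r f -> disc_approx r g ->
  disc_approx r (fun z => f z * g z).
Proof.
move=> fa ga e e0.
have [B B0 BP] := disc_approx_bound ga.
have e1 : 0 < e / 2 / (B + 1) by rewrite !divr_gt0 // ltr_wpDl.
have [p pP] := fa _ e1; have [C C0 CP] := poly_disc_bound p r.
have e2 : 0 < e / 2 / (C + 1) by rewrite !divr_gt0 // ltr_wpDl.
have [q qP] := ga _ e2.
exists (p * q) => z zr; rewrite hornerM.
have -> : f z * g z - p.[z] * q.[z] = (f z - p.[z]) * g z + p.[z] * (g z - q.[z]) by ring.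
rewrite (le_lt_trans (cabs_leD _ _)) // [ltRHS](splitr e) !cabsM.
apply: ltrD.
  apply: (@le_lt_trans _ _ (cabs (f z - p.[z]) * B)); first by rewrite ler_wpM2l ?cabs_ge0 ?BP.
  apply: (@le_lt_trans _ _ (e / 2 / (B + 1) * B)).
    by rewrite ler_wpM2r // ltW // pP.
  by rewrite mulrAC ltr_pdivrMr ?ltr_wpDl // ltr_pM2l ?divr_gt0 // ltrDl.
apply: (@le_lt_trans _ _ (C * cabs (g z - q.[z]))); first by rewrite ler_wpM2r ?cabs_ge0 ?CP.
apply: (@le_lt_trans _ _ (C * (e / 2 / (C + 1)))).
  by rewrite ler_wpM2l // ltW // qP.
by rewrite mulrA ltr_pdivrMr ?ltr_wpDl // mulrC ltr_pM2l ?divr_gt0 // ltrDl.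
Qed.

Lemma disc_approx_prod r (I : Type) (s : seq I) (F : I -> R[i] -> R[i]) :
  (forall i, disc_approx r (F i)) -> disc_approx r (fun z => \prod_(i <- s) F i z).
Proof.
move=> h; elim: s => [|i s IH].
  by apply: disc_approx_ext (@disc_approx_cst r 1) => z _; rewrite big_nil.
by apply: disc_approx_ext (disc_approxM (h i) IH) => z _; rewrite big_cons.
Qed.

(** Truncated geometric series in z / c. It allows dividing by a product whose zeros all lie outside
    the disc. *)
Lemma disc_approx_inv_sub r c : 0 <= r -> r < cabs c ->
  disc_approx r (fun z => (c - z)^-1).
Proof.
move=> r0 rc e e0.
have c0 : 0 < cabs c by exact: le_lt_trans rc.
have cn0 : c != 0 by rewrite -cabs_gt0.
pose k := r / cabs c.
have k0 : 0 <= k by rewrite divr_ge0 // ltW.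
have k1 : `|k| < 1 by rewrite ger0_norm // ltr_pdivrMr ?mul1r.
have d0 : 0 < e * (cabs c - r) by rewrite mulr_gt0 // subr_gt0.
have /cvgrPdist_lt /(_ _ d0) [n _ /(_ n (leqnn n))] := cvg_expr k1.
rewrite sub0r normrN ger0_norm ?exprn_ge0 // => kn.
exists (\poly_(i < n) (c^-1 ^+ i.+1)) => z zr.
rewrite horner_poly.
have cz : 0 < cabs (c - z).
  by rewrite (lt_le_trans _ (cabs_geB _ _)) // subr_gt0 (le_lt_trans zr).
have cz0 : c - z != 0 by rewrite -cabs_gt0.
have E : (c - z)^-1 - \sum_(i < n) c^-1 ^+ i.+1 * z ^+ i = (z / c) ^+ n / (c - z).
  apply: (mulIf cz0); rewrite divfK // mulrBl mulVf //.
  under eq_bigr do rewrite exprS -mulrA -exprMn [c^-1 * z]mulrC.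
  rewrite -mulr_sumr.
  have -> : c^-1 * (\sum_(i < n) (z / c) ^+ i) * (c - z) =
     - ((z / c - 1) * \sum_(i < n) (z / c) ^+ i) by field.
  by rewrite -subrX1; ring.
rewrite E cabsM cabsV ltr_pdivrMr // (@le_lt_trans _ _ (k ^+ n)) //.
  rewrite cabsX lerXn2r ?nnegrE ?cabs_ge0 //.
  by rewrite cabsM cabsV ler_pM2r ?invr_gt0.
rewrite (lt_le_trans kn) // ler_wpM2l ?(ltW e0) //.
by rewrite (le_trans _ (cabs_geB _ _)) // lerD2l lerN2.
Qed.

Lemma disc_approx_weak_max f r M z : disc_approx r f -> 0 < r ->
  (forall w, cabs w = r -> cabs (f w) <= M) -> cabs z <= r / 2 ->
  cabs (f z) <= 2 * M.
Proof.
move=> fa r0 fM zr; apply/ler_addgt0Pr => e e0.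
have e3 : 0 < e / 3 by rewrite divr_gt0.
have [p pP] := fa _ e3.
have : cabs p.[z] <= 2 * (M + e / 3).
  apply: (poly_weak_max r0) => // w wr.
  have -> : p.[w] = f w - (f w - p.[w]) by ring.
  by rewrite (le_trans (cabs_leB _ _)) // lerD ?fM // ltW // pP // wr.
have zr' : cabs z <= r by rewrite (le_trans zr) // ler_pdivrMr // ler_peMr ?(ltW r0) // ler1n.
have := pP z zr'.
have := cabs_leD (f z - p.[z]) p.[z]; rewrite subrK.
lra.
Qed.

Lemma disc_approx_continuous f r z e : disc_approx r f -> cabs z < r -> 0 < e ->
  exists2 d, 0 < d & forall w, cabs (w - z) < d -> cabs (f w - f z) < e.
Proof.
move=> fa zr e0.
have e3 : 0 < e / 3 by rewrite divr_gt0.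
have [p pP] := fa _ e3.
have /factor_theorem[q qE] : root (p - p.[z]%:P) z by rewrite rootE !hornerE subrr.
have [B B0 BP] := poly_disc_bound q r.
pose d := Num.min (r - cabs z) (e / 3 / (B + 1)).
have B1 : 0 < B + 1 by rewrite ltr_wpDl.
have d0 : 0 < d by rewrite lt_min subr_gt0 zr divr_gt0.
exists d => // w; rewrite lt_min => /andP[w1 w2].
have wr : cabs w <= r.
  by have := cabs_leD (w - z) z; rewrite subrK; lra.
have pw : p.[w] - p.[z] = q.[w] * (w - z).
  by have := congr1 (fun s => s.[w]) qE; rewrite !hornerE.
have -> : f w - f z = (f w - p.[w]) - (f z - p.[z]) + q.[w] * (w - z) by rewrite -pw; ring.
rewrite (le_lt_trans (cabs_leD _ _)) //.
have h1 := pP w wr; have h2 := pP z (ltW zr).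
have h3 := cabs_leB (f w - p.[w]) (f z - p.[z]).
have : cabs (q.[w] * (w - z)) < e / 3.
  rewrite cabsM (@le_lt_trans _ _ (B * cabs (w - z))) //.
    by rewrite ler_wpM2r ?cabs_ge0 // BP.
  move: w2; rewrite ltr_pdivlMr // mulrC; apply: le_lt_trans.
  by rewrite ler_wpM2r ?cabs_ge0 // lerDl.
lra.
Qed.

End UniformPolynomialLimits.

Lemma geometric_cauchy_cvg (R : realType) (u : nat -> R) (C : R) (N : nat) :
  (forall n m, (N <= n <= m)%N -> `|u n - u m| <= C * 2^-1 ^+ n) ->
  exists l, forall n, (N <= n)%N -> `|l - u n| <= C * 2^-1 ^+ n.
Proof.
move=> H.
have half : `|2^-1 : R| < 1 by rewrite ger0_norm //; lra.
have small e : 0 < e -> \forall n \near \oo, C * 2^-1 ^+ n < e.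
  move=> e0.
  have C1 : 0 < `|C| + 1 by rewrite ltr_wpDl.
  have /cvgrPdist_lt /(_ _ (divr_gt0 e0 C1)) := cvg_expr half.
  apply: filterS => n; rewrite sub0r normrN ger0_norm ?exprn_ge0 // => h.
  rewrite (@le_lt_trans _ _ ((`|C| + 1) * 2^-1 ^+ n)) //.
    by rewrite ler_wpM2r ?exprn_ge0 // (le_trans (ler_norm C)) // lerDl.
  by rewrite mulrC -ltr_pdivlMr.
have cu : cvg (u @ \oo).
  apply: cauchy_cvg; apply: cauchy_exP => e e0.
  have [n0 _ /(_ (maxn n0 N) (leq_maxl _ _)) hn] := small _ e0.
  exists (u (maxn n0 N)); exists (maxn n0 N) => // m /= nm.
  rewrite /ball /= (le_lt_trans (H _ _ _)) //.
  by rewrite nm leq_maxr.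
exists (limn u) => n Nn.
have cn : (fun m => `|u m - u n|) @ \oo --> `|limn u - u n|.
  by apply: cvg_norm; apply: cvgB => //; exact: cvg_cst.
rewrite -(cvg_lim (@Rhausdorff R) cn); apply: limr_le; first by apply/cvg_ex; eexists; exact: cn.
by exists n => // m /= nm; rewrite distrC H // Nn nm.
Qed.

(** * Dividing out a zero *)

Section EntireDivision.
Context {R : realType}.
Implicit Types (z w c : R[i]) (r e M : R) (p q : {poly R[i]}) (f g : R[i] -> R[i]).

Lemma geometric_cauchy_cvg_complex (u : nat -> R[i]) (C : R) (N : nat) :
  (forall n m, (N <= n <= m)%N -> cabs (u n - u m) <= C * 2^-1 ^+ n) ->
  exists l, forall n, (N <= n)%N -> cabs (l - u n) <= 2 * C * 2^-1 ^+ n.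
Proof.
move=> H.
have [x xP] : exists l, forall n, (N <= n)%N -> `|l - Re (u n)| <= C * 2^-1 ^+ n.
  apply: geometric_cauchy_cvg => n m nm; apply: le_trans (H _ _ nm).
  by rewrite -cReN -cReD cabs_Re.
have [y yP] : exists l, forall n, (N <= n)%N -> `|l - Im (u n)| <= C * 2^-1 ^+ n.
  apply: geometric_cauchy_cvg => n m nm; apply: le_trans (H _ _ nm).
  by rewrite -cImN -cImD cabs_Im.
exists (x +i* y) => n Nn; rewrite (le_trans (cabs_le_ReIm _)) //.
rewrite cReD cImD cReN cImN /= -mulrA mulr_natl mulr2n.
by rewrite lerD ?xP ?yP.
Qed.

(** Approximants on growing discs are corrected by their value at [c], which is small since
    [f c = 0], and then divided by [z - c] exactly. The quotients are compared on a circle far from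
    [c], where the division loses nothing, and [poly_weak_max] carries the comparison inside,
    including to [c] itself. *)
Lemma entire_div f c : entire f -> f c = 0 ->
  exists h, entire h /\ forall z, f z = (z - c) * h z.
Proof.
move=> fe fc.
(* On the circle of radius [2 * rad n] the distance to [c] is at least 1. *)
pose rad n : R := n%:R + cabs c + 1.
have half0 n : 0 < (2^-1 : R) ^+ n by rewrite exprn_gt0.
have rad0 n : 0 < rad n by rewrite ltr_wpDl // addr_ge0 ?cabs_ge0.
have [pq pqP] : {pq : nat -> {poly R[i]} & forall n, forall z, cabs z <= 2 * rad n ->
    cabs (f z - (z - c) * (pq n).[z]) <= 2 * 2^-1 ^+ n}.
  apply: (@choice _ _ (fun n q => forall z, cabs z <= 2 * rad n ->
    cabs (f z - (z - c) * q.[z]) <= 2 * 2^-1 ^+ n)) => n.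
  have [p pP] := fe (2 * rad n) _ (half0 n).
  have /factor_theorem[q qE] : root (p - p.[c]%:P) c by rewrite rootE !hornerE subrr.
  exists q => z zr.
  have -> : (z - c) * q.[z] = p.[z] - p.[c].
    by have := congr1 (fun s => s.[z]) qE; rewrite !hornerE mulrC.
  rewrite opprB addrA [f z + _]addrC -addrA.
  rewrite (le_trans (cabs_leD _ _)) // mulr_natl mulr2n lerD // ltW ?pP //.
  have := pP c; rewrite fc sub0r cabsN; apply.
  by have := ler0n R n; have := cabs_ge0 c; rewrite /rad; lra.
(* Each of the two approximations errs by at most 2 / 2^n on the circle, so the quotients differ by
   4 / 2^n there, and the weak maximum principle doubles this. *)
have diff n m z : (n <= m)%N -> cabs z <= rad n ->
    cabs ((pq n).[z] - (pq m).[z]) <= 8 * 2^-1 ^+ n.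
  move=> nm zr.
  rewrite -hornerN -hornerD (_ : 8 = 2 * 4 :> R) -?mulrA; last by ring.
  apply: (@poly_weak_max _ _ (2 * rad n)); first by rewrite mulr_gt0.
    move=> w wr.
    have wc : 1 <= cabs (w - c).
      have := cabs_geB w c; rewrite wr.
      by have := ler0n R n; have := cabs_ge0 c; rewrite /rad; lra.
    have wn : cabs (f w - (w - c) * (pq n).[w]) <= 2 * 2^-1 ^+ n by apply: pqP; rewrite wr.
    have wm : cabs (f w - (w - c) * (pq m).[w]) <= 2 * 2^-1 ^+ n.
      apply: (@le_trans _ _ (2 * 2^-1 ^+ m)).
        apply: pqP; rewrite wr ler_pM2l // /rad lerD2r lerD2r ler_nat //.
      rewrite ler_pM2l // ler_wiXn2l //; lra.
    have : cabs ((w - c) * ((pq n).[w] - (pq m).[w])) <= 4 * 2^-1 ^+ n.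
      have -> : (w - c) * ((pq n).[w] - (pq m).[w]) =
        (f w - (w - c) * (pq m).[w]) - (f w - (w - c) * (pq n).[w]) by ring.
      have := cabs_leB (f w - (w - c) * (pq m).[w]) (f w - (w - c) * (pq n).[w]).
      lra.
    rewrite hornerD hornerN cabsM; apply: le_trans.
    by rewrite ler_peMl ?cabs_ge0.
  lra.
have [h hP] : {h : R[i] -> R[i] & forall z, forall n, cabs z <= rad n ->
    cabs (h z - (pq n).[z]) <= 16 * 2^-1 ^+ n}.
  apply: (@choice _ _ (fun z l => forall n, cabs z <= rad n ->
    cabs (l - (pq n).[z]) <= 16 * 2^-1 ^+ n)) => z.
  (* The default value 0 is never taken: every [z] lies in some disc, see [big] below. *)
  have [zc|zc] := pselect (exists n, cabs z <= rad n); last first.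
    by exists 0 => n zn; exfalso; apply: zc; exists n.
  have [N NP NE] := ex_minnP zc.
  have [l lP] : exists l, forall n, (N <= n)%N -> cabs (l - (pq n).[z]) <= 2 * 8 * 2^-1 ^+ n.
    apply: geometric_cauchy_cvg_complex => n m /andP[Nn nm]; apply: diff => //.
    by rewrite (le_trans NP) // /rad lerD2r lerD2r ler_nat.
  exists l => n zn; have -> : 16 = 2 * 8 :> R by ring.
  by apply: lP; exact: NE.
have vanish (C : R) : forall e, 0 < e -> exists N, forall n, (N <= n)%N -> C * 2^-1 ^+ n < e.
  move=> e e0.
  have C1 : 0 < `|C| + 1 by rewrite ltr_wpDl.
  have half : `|2^-1 : R| < 1 by rewrite ger0_norm //; lra.
  have /cvgrPdist_lt /(_ _ (divr_gt0 e0 C1)) [N _ NP] := cvg_expr half.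
  exists N => n Nn; have := NP _ Nn; rewrite sub0r normrN ger0_norm ?exprn_ge0 // => hn.
  rewrite (@le_lt_trans _ _ ((`|C| + 1) * 2^-1 ^+ n)) //.
    by rewrite ler_wpM2r ?exprn_ge0 // (le_trans (ler_norm C)) // lerDl.
  by rewrite mulrC -ltr_pdivlMr.
have big z : exists N, forall n, (N <= n)%N -> cabs z <= rad n.
  exists (Num.truncn (cabs z)).+1 => n Nn.
  rewrite (le_trans (ltW (truncnS_gt _))) // (@le_trans _ _ n%:R) ?ler_nat //.
  by rewrite /rad -addrA lerDl addr_ge0 ?cabs_ge0.
exists h; split.
  move=> r e e0; have [N NP] := vanish 16 e e0; have [N' NP'] := big r%:C.
  exists (pq (maxn N N')) => z zr; apply: (le_lt_trans (hP _ _ _)).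
    rewrite (le_trans zr) // (le_trans (ler_norm r)) // -cabs_real NP' // leq_maxr //.
  by apply: NP; rewrite leq_maxl.
move=> z; apply/eqP; rewrite -subr_eq0 -cabs_eq0 eq_le cabs_ge0 andbT.
apply/ler_addgt0Pr => e e0; rewrite add0r.
have [N NP] := vanish (2 + cabs (z - c) * 16) e e0; have [N' NP'] := big z.
pose n := maxn N N'.
have zn : cabs z <= rad n by apply: NP'; rewrite leq_maxr.
have -> : f z - (z - c) * h z = (f z - (z - c) * (pq n).[z]) - (z - c) * (h z - (pq n).[z]) by ring.
rewrite (le_trans (cabs_leB _ _)) // (le_trans _ (ltW (NP n (leq_maxl _ _)))) //.
rewrite [leRHS]mulrDl lerD //.
  apply: pqP; rewrite (le_trans zn) // ler_peMl ?ltW //.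
  by rewrite ltr1n.
by rewrite cabsM -mulrA ler_wpM2l ?cabs_ge0 // hP.
Qed.

End EntireDivision.

(** * Complex-valued integrals *)

Section ComplexIntegral.
Context {R : realType}.
Notation mu := (@lebesgue_measure R).
Implicit Types (z w c : R[i]) (r e M B : R) (f g k : R -> R[i]) (D E : set (measurableTypeR R)).

Definition cintegrable D f :=
  mu.-integrable D (EFin \o (fun t => Re (f t))) /\
  mu.-integrable D (EFin \o (fun t => Im (f t))).

(** Uses |Re| + |Im| in place of the modulus, so that integrability follows at once from that of the
    two parts; the price is a factor 2 in the estimates of products below. *)
Definition L1norm D f : R := \int[mu]_(t in D) (`|Re (f t)| + `|Im (f t)|).

Lemma eq_cintegral D f g : {in D, f =1 g} -> cintegral D f = cintegral D g.
Proof.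
move=> fg; rewrite /cintegral; congr (_ +i* _);
  by apply: eq_Rintegral => t tD; rewrite fg.
Qed.

Lemma eq_cintegrable D f g : measurable D -> {in D, f =1 g} ->
  cintegrable D f -> cintegrable D g.
Proof.
move=> mD fg [f1 f2]; split.
  by apply: eq_integrable f1 => // t tD; rewrite /= fg.
by apply: eq_integrable f2 => // t tD; rewrite /= fg.
Qed.

Lemma cintegrableS D E f : measurable D -> measurable E -> E `<=` D ->
  cintegrable D f -> cintegrable E f.
Proof. by move=> mD mE ED [f1 f2]; split; exact: (integrableS mD mE ED). Qed.

Lemma cintegrableD D f g : measurable D -> cintegrable D f -> cintegrable D g ->
  cintegrable D (fun t => f t + g t).
Proof.
move=> mD [f1 f2] [g1 g2]; split.
  by apply: eq_integrable (integrableD mD f1 g1) => // t _; rewrite /= cReD EFinD.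
by apply: eq_integrable (integrableD mD f2 g2) => // t _; rewrite /= cImD EFinD.
Qed.

Lemma cintegralD D f g : measurable D -> cintegrable D f -> cintegrable D g ->
  cintegral D (fun t => f t + g t) = cintegral D f + cintegral D g.
Proof.
move=> mD [f1 f2] [g1 g2]; apply: complex_eqP; rewrite ?cReD ?cImD /= -RintegralD //;
  by apply: eq_Rintegral => t _; rewrite ?cReD ?cImD.
Qed.

Lemma cintegrableZ D c f : measurable D -> cintegrable D f ->
  cintegrable D (fun t => c * f t).
Proof.
move=> mD [f1 f2]; split.
  apply: eq_integrable (integrableB mD (integrableZl mD (Re c) f1)
    (integrableZl mD (Im c) f2)) => // t _.
  by rewrite /= cReM EFinB !EFinM.
apply: eq_integrable (integrableD mD (integrableZl mD (Re c) f2)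
    (integrableZl mD (Im c) f1)) => // t _.
by rewrite /= cImM EFinD !EFinM.
Qed.

Lemma cintegralZ D c f : measurable D -> cintegrable D f ->
  cintegral D (fun t => c * f t) = c * cintegral D f.
Proof.
move=> mD [f1 f2]; apply: complex_eqP; rewrite ?cReM ?cImM /=.
  rewrite -!RintegralZl // -RintegralB //; first by apply: eq_Rintegral => t _; rewrite cReM.
    by apply: eq_integrable (integrableZl mD (Re c) f1).
  by apply: eq_integrable (integrableZl mD (Im c) f2).
rewrite -!RintegralZl // -RintegralD //; first by apply: eq_Rintegral => t _; rewrite cImM.
  by apply: eq_integrable (integrableZl mD (Re c) f2).
by apply: eq_integrable (integrableZl mD (Im c) f1).
Qed.

Lemma cintegrableB D f g : measurable D -> cintegrable D f -> cintegrable D g ->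
  cintegrable D (fun t => f t - g t).
Proof.
move=> mD fi gi.
apply: eq_cintegrable (cintegrableD mD fi (cintegrableZ (-1) mD gi)) => // t _.
by rewrite mulN1r.
Qed.

Lemma cintegralB D f g : measurable D -> cintegrable D f -> cintegrable D g ->
  cintegral D (fun t => f t - g t) = cintegral D f - cintegral D g.
Proof.
move=> mD fi gi; rewrite -[- cintegral D g]mulN1r -cintegralZ // -cintegralD //; last exact: cintegrableZ.
by apply: eq_cintegral => t _; rewrite mulN1r.
Qed.

Lemma cintegral_sum D (n : nat) (F : nat -> R -> R[i]) : measurable D ->
  (forall i, cintegrable D (F i)) ->
  cintegrable D (fun t => \sum_(i < n) F i t) /\
  cintegral D (fun t => \sum_(i < n) F i t) = \sum_(i < n) cintegral D (F i).
Proof.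
move=> mD Fi; elim: n => [|n [IH1 IH2]].
  have E0 : {in D, (fun=> 0) =1 (fun t => \sum_(i < 0) F i t)}.
    by move=> t _; rewrite big_ord0.
  split.
    apply: eq_cintegrable E0 _ => //.
    by apply: eq_cintegrable (cintegrableZ 0 mD (Fi 0%N)) => // t _; rewrite mul0r.
  rewrite big_ord0 -(eq_cintegral E0) /cintegral.
  by apply: complex_eqP; rewrite /= /Rintegral integral0.
have E1 : {in D, (fun t => \sum_(i < n) F i t + F n t) =1 (fun t => \sum_(i < n.+1) F i t)}.
  by move=> t _; rewrite big_ord_recr.
split; first by apply: eq_cintegrable E1 _ => //; exact: cintegrableD.
by rewrite -(eq_cintegral E1) cintegralD // IH2 big_ord_recr.
Qed.

Lemma integrable_L1norm D f : measurable D -> cintegrable D f ->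
  mu.-integrable D (EFin \o (fun t => `|Re (f t)| + `|Im (f t)|)).
Proof.
move=> mD [f1 f2].
apply: eq_integrable (integrableD mD (integrable_norm f1) (integrable_norm f2)) => //.
Qed.

Lemma L1norm_ge0 D f : 0 <= L1norm D f.
Proof. by apply: Rintegral_ge0 => t _; rewrite addr_ge0. Qed.

Lemma cabs_cintegral_le D f : measurable D -> cintegrable D f ->
  cabs (cintegral D f) <= L1norm D f.
Proof.
move=> mD [f1 f2]; rewrite (le_trans (cabs_le_ReIm _)) //= /L1norm.
rewrite RintegralD //; [|exact: integrable_norm|exact: integrable_norm].
by rewrite lerD // le_normr_Rintegral.
Qed.

Lemma cintegrable_mul D k f B : measurable D ->
  measurable_fun D (fun t => Re (k t)) -> measurable_fun D (fun t => Im (k t)) ->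
  (forall t, D t -> cabs (k t) <= B) -> cintegrable D f ->
  cintegrable D (fun t => k t * f t).
Proof.
move=> mD k1 k2 kB [f1 f2].
have b1 : [bounded Re (k x) | x in D].
  exists B; split => [|M BM t Dt]; first exact: num_real.
  by rewrite /= (le_trans (cabs_Re _)) // (le_trans (kB _ Dt)) // ltW.
have b2 : [bounded Im (k x) | x in D].
  exists B; split => [|M BM t Dt]; first exact: num_real.
  by rewrite /= (le_trans (cabs_Im _)) // (le_trans (kB _ Dt)) // ltW.
split.
  apply: eq_integrable (integrableB mD (integrableMr mD k1 b1 f1)
    (integrableMr mD k2 b2 f2)) => // t _.
  by rewrite /= cReM EFinB !EFinM.
apply: eq_integrable (integrableD mD (integrableMr mD k1 b1 f2)
    (integrableMr mD k2 b2 f1)) => // t _.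
by rewrite /= cImM EFinD !EFinM.
Qed.

Lemma cabs_cintegral_mul_le D k f B : measurable D ->
  measurable_fun D (fun t => Re (k t)) -> measurable_fun D (fun t => Im (k t)) ->
  (forall t, D t -> cabs (k t) <= B) -> cintegrable D f ->
  cabs (cintegral D (fun t => k t * f t)) <= 2 * B * L1norm D f.
Proof.
move=> mD k1 k2 kB fi.
have kfi := cintegrable_mul mD k1 k2 kB fi.
apply: (le_trans (cabs_cintegral_le mD kfi)).
rewrite /L1norm -RintegralZl //; last exact: integrable_L1norm.
apply: le_Rintegral => //; first exact: integrable_L1norm.
  apply: eq_integrable (integrableZl mD (2 * B) (integrable_L1norm mD fi)) => //.
move=> t Dt; have := cabs_Re (k t * f t); have := cabs_Im (k t * f t).
have : cabs (k t * f t) <= B * (`|Re (f t)| + `|Im (f t)|).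
  by rewrite cabsM ler_pM ?cabs_ge0 ?kB ?cabs_le_ReIm.
lra.
Qed.

Lemma cintegral_oo_cc (a b : R) f : cintegrable `[a, b] f ->
  cintegral `[a, b] f = cintegral `]a, b[ f.
Proof.
move=> fi.
have [f1 f2] : cintegrable `]a, b[ f.
  by apply: cintegrableS fi => //; exact: subset_itvW.
have [g1 g2] : cintegrable `]a, b] f.
  by apply: cintegrableS fi => //; apply: subset_itvr; rewrite bnd_simp.
apply: complex_eqP => /=.
  by rewrite -Rintegral_itv_obnd_cbnd // -Rintegral_itv_bndo_bndc.
by rewrite -Rintegral_itv_obnd_cbnd // -Rintegral_itv_bndo_bndc.
Qed.

Lemma is_cderive_continuous f (x : R) l : is_cderive f x l ->
  {for x, continuous (fun t => Re (f t))} /\ {for x, continuous (fun t => Im (f t))}.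
Proof.
by move=> [[h1 _] [h2 _]]; split; apply: differentiable_continuous; exact/derivable1_diffP.
Qed.

Lemma is_cderive_measurable f D (l : R -> R[i]) : (forall x, is_cderive f x (l x)) ->
  measurable_fun D (fun t => Re (f t)) /\ measurable_fun D (fun t => Im (f t)).
Proof.
move=> h; split; apply: measurable_funTS; apply: continuous_measurable_fun => x;
  by have [] := is_cderive_continuous (h x).
Qed.

Lemma is_cderive_cintegrable f (l : R -> R[i]) (a b : R) :
  (forall x, is_cderive f x (l x)) -> cintegrable `[a, b] f.
Proof.
move=> h; split; apply: continuous_compact_integrable => //; try exact: segment_compact;
  by apply: continuous_subspaceT => x; have [] := is_cderive_continuous (h x).
Qed.

Lemma cintegral_FTC2 f F (l : R -> R[i]) (a b : R) : a < b ->
  (forall x, is_cderive F x (f x)) -> (forall x, is_cderive f x (l x)) ->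
  cintegral `[a, b] f = F b - F a.
Proof.
move=> ab Ff fl.
have der x : derivable (fun t => Re (F t)) x 1 /\ derivable (fun t => Im (F t)) x 1.
  by have [[? _] [? _]] := Ff x.
apply: complex_eqP; rewrite ?cReD ?cReN ?cImD ?cImN /= /Rintegral.
  rewrite (@continuous_FTC2 _ _ (fun t => Re (F t))) //.
  - by apply: continuous_subspaceT => x; have [] := is_cderive_continuous (fl x).
  - have cF x : {for x, continuous (fun t => Re (F t))} by have [] := is_cderive_continuous (Ff x).
    split; first by move=> x _; have [] := der x.
      by apply: cvg_at_right_filter; exact: cF.
    by apply: cvg_at_left_filter; exact: cF.
  - by move=> x _; rewrite derive1E; have [h _] := Ff x; rewrite (@derive_val _ _ _ _ _ _ _ h).
rewrite (@continuous_FTC2 _ _ (fun t => Im (F t))) //.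
- by apply: continuous_subspaceT => x; have [] := is_cderive_continuous (fl x).
- have cF x : {for x, continuous (fun t => Im (F t))} by have [] := is_cderive_continuous (Ff x).
  split; first by move=> x _; have [] := der x.
    by apply: cvg_at_right_filter; exact: cF.
  by apply: cvg_at_left_filter; exact: cF.
- by move=> x _; rewrite derive1E; have [_ h] := Ff x; rewrite (@derive_val _ _ _ _ _ _ _ h).
Qed.

(** The interval has finite measure, so |x| <= 1 + x^2 gives an integrable majorant of each part. *)
Lemma L2_cintegrable (a b : R) f : L2 `]a, b[ f -> cintegrable `]a, b[ f.
Proof.
move=> [m1 m2 fi].
have mD : measurable (`]a, b[%classic : set (measurableTypeR R)) by exact: measurable_itv.
have i1 : mu.-integrable `]a, b[ (EFin \o cst (1 : R)).
  apply: measurable_bounded_integrable => //.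
    by rewrite /= lebesgue_measure_itv /=; case: ifP => _; rewrite ?ltry.
  by exists 1; split => [|M M1 t _]; rewrite ?num_real // /= normr1 ltW.
have i2 : mu.-integrable `]a, b[ (EFin \o (fun t => cabs (f t) ^+ 2)).
  apply/integrableP; split.
    apply/measurable_EFinP.
    rewrite (_ : (fun t => _) = (fun t => Re (f t) ^+ 2 + Im (f t) ^+ 2)).
      by apply: measurable_funD; apply: measurable_funX.
    by apply/funext => t; rewrite sqr_cabs.
  apply: le_lt_trans fi; rewrite le_eqVlt; apply/orP; left; apply/eqP.
  by apply: eq_integral => t _; rewrite /= ger0_norm // sqr_ge0.
have i3 := integrableD mD i1 i2.
have bd (x y : R) : x ^+ 2 <= y -> `|x| <= 1 + y.
  move=> xy; have [?|?] := leP `|x| 1.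
    by rewrite (le_trans _ (_ : 1 <= 1 + y)) // lerDl (le_trans (sqr_ge0 x)).
  rewrite (le_trans _ (_ : y <= 1 + y)) ?lerDr // (le_trans _ xy) //.
  by rewrite -real_normK ?num_real // expr2 ler_peMr // ltW.
split; apply: le_integrable i3 => //=; try exact/measurable_EFinP;
  move=> t _; rewrite lee_fin; rewrite [leRHS]ger0_norm ?addr_ge0 ?sqr_ge0 //;
  apply: bd; rewrite sqr_cabs ?lerDl ?lerDr sqr_ge0 //.
Qed.

End ComplexIntegral.

(** * Change of variables by translations and reflections *)

Section AffineChange.
Context {R : realType}.
Notation mu := (@lebesgue_measure R).
Notation TR := (measurableTypeR R).
Variables (s b : R).
Hypothesis s1 : s = 1 \/ s = -1.
Implicit Types (D A : set TR).

Let phi (x : R) : R := s * x + b.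

Lemma measurable_affine : @measurable_fun _ _ TR TR setT phi.
Proof.
suff : measurable_fun setT phi by [].
by apply: measurable_funD => //; exact: mulrl_measurable.
Qed.

Let phim : {mfun TR >-> TR} := @mfun_Sub _ _ TR TR phi (mem_set measurable_affine).

Lemma measurable_affine_preimage D : measurable D -> measurable (phi @^-1` D : set TR).
Proof. by move=> mD; rewrite -(setTI (_ @^-1` _)); exact: measurable_affine. Qed.

(** By uniqueness of Lebesgue measure, half-open intervals suffice. A reflection exchanges the
    closed and the open end, which does not affect the length. *)
Lemma lebesgue_measure_affine A : measurable A -> mu A = mu (phi @^-1` A).
Proof.
apply: (@lebesgue_measure_unique R (pushforward mu phim)).
move=> X [[c d] _ <-] /=; rewrite /pushforward /=.
case: s1 => sE.
  have -> : phi @^-1` `]c, d] = `]c - b, d - b]%classic.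
    by apply/seteqP; split => x /=; rewrite /phi sE !in_itv /= mul1r ltrBlDr lerBrDr.
  rewrite !lebesgue_measure_itv /= !lte_fin ltrD2r; case: ifP => // _.
  by rewrite -!EFinB; congr EFin; ring.
have -> : phi @^-1` `]c, d] = `[b - d, b - c[%classic.
  by apply/seteqP; split => x /=; rewrite /phi sE !in_itv /= mulN1r => /andP[h1 h2];
    apply/andP; split; lra.
rewrite !lebesgue_measure_itv /= !lte_fin ltrD2l ltrN2; case: ifP => // _.
by rewrite -!EFinB; congr EFin; ring.
Qed.

Lemma ge0_integral_affine D (f : R -> \bar R) : measurable D ->
  measurable_fun D f -> (forall x, D x -> (0 <= f x)%E) ->
  (\int[mu]_(x in D) f x = \int[mu]_(x in phi @^-1` D) f (phi x))%E.
Proof.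
move=> mD mf f0.
rewrite -(@ge0_integral_pushforward _ _ TR TR R phi measurable_affine mu D f mD mf); last first.
  by move=> y; rewrite inE => /f0.
apply: (@eq_measure_integral _ TR R D (pushforward mu phim) mu) => A mA _.
exact: lebesgue_measure_affine.
Qed.

Lemma measurable_fun_affine D (f : R -> R) : measurable D -> measurable_fun D f ->
  measurable_fun (phi @^-1` D) (fun x => f (phi x)).
Proof.
move=> mD mf; apply: (measurable_comp mD) => //; first by move=> _ [x Dx <-].
by apply: measurable_funTS; exact: measurable_affine.
Qed.

Lemma Rintegral_affine D (f : R -> R) : measurable D -> mu.-integrable D (EFin \o f) ->
  \int[mu]_(x in D) f x = \int[mu]_(x in phi @^-1` D) f (phi x).
Proof.
move=> mD fi; have mf := measurable_int _ fi.
rewrite /Rintegral integralE [in RHS]integralE; congr (fine (_ - _)%E).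
  rewrite (ge0_integral_affine mD) //; [by apply: eq_integral => x _; rewrite !funeposE|exact: measurable_funepos].
rewrite (ge0_integral_affine mD) //; [by apply: eq_integral => x _; rewrite !funenegE|exact: measurable_funeneg].
Qed.

Lemma cintegral_affine D (f : R -> R[i]) : measurable D -> cintegrable D f ->
  cintegral D f = cintegral (phi @^-1` D) (fun x => f (phi x)).
Proof.
by move=> mD [f1 f2]; rewrite /cintegral (Rintegral_affine mD f1) (Rintegral_affine mD f2).
Qed.

Lemma L2_affine D (f : R -> R[i]) : measurable D -> L2 D f ->
  L2 (phi @^-1` D) (fun x => f (phi x)).
Proof.
move=> mD [f1 f2 fi]; split.
- exact: (measurable_fun_affine mD f1).
- exact: (measurable_fun_affine mD f2).
rewrite -(@ge0_integral_affine D (fun x => ((cabs (f x)) ^+ 2)%:E)) //.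
  apply/measurable_EFinP.
  rewrite (_ : (fun t => _) = (fun t => Re (f t) ^+ 2 + Im (f t) ^+ 2)).
    by apply: measurable_funD; apply: measurable_funX.
  by apply/funext => t; rewrite sqr_cabs.
by move=> x _; rewrite lee_fin sqr_ge0.
Qed.

End AffineChange.

Lemma sqr_le_twice (R : realType) (x y z : R) : 0 <= z -> z <= x + y ->
  z ^+ 2 <= 2 * x ^+ 2 + 2 * y ^+ 2.
Proof.
move=> z0 zxy; have xy0 := le_trans z0 zxy.
rewrite (@le_trans _ _ ((x + y) ^+ 2)) ?lerXn2r ?nnegrE //.
rewrite -subr_ge0 (_ : _ - _ = (x - y) ^+ 2) ?sqr_ge0 //; ring.
Qed.

(** * The spaces of square integrable functions *)

Section SquareIntegrable.
Context {R : realType}.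
Notation mu := (@lebesgue_measure R).
Notation TR := (measurableTypeR R).
Implicit Types (D E : set TR) (f g : R -> R[i]) (c : R[i]).

Lemma L2_measurable_sqr D f : L2 D f -> measurable_fun D (fun t => cabs (f t) ^+ 2).
Proof.
move=> [m1 m2 _]; rewrite (_ : (fun t => _) = (fun t => Re (f t) ^+ 2 + Im (f t) ^+ 2)).
  by apply: measurable_funD; apply: measurable_funX.
by apply/funext => t; rewrite sqr_cabs.
Qed.

Lemma L2_integrable_sqr D f : L2 D f ->
  mu.-integrable D (EFin \o (fun t => cabs (f t) ^+ 2)).
Proof.
move=> fL; have [_ _ fi] := fL; apply/integrableP; split.
  by apply/measurable_EFinP; exact: L2_measurable_sqr.
apply: le_lt_trans fi; rewrite le_eqVlt; apply/orP; left; apply/eqP.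
by apply: eq_integral => t _; rewrite /= ger0_norm // sqr_ge0.
Qed.

Lemma L2_le D f (h : R -> R) : measurable D ->
  measurable_fun D (fun t => Re (f t)) -> measurable_fun D (fun t => Im (f t)) ->
  (forall t, D t -> cabs (f t) ^+ 2 <= h t) -> mu.-integrable D (EFin \o h) -> L2 D f.
Proof.
move=> mD m1 m2 fh hi; split => //.
apply: le_lt_trans (integrable_lty mD hi).
apply: le_integral => //; last by move=> t; rewrite inE => /fh; rewrite lee_fin.
apply: le_integrable hi => //.
  apply/measurable_EFinP.
  rewrite (_ : (fun t => _) = (fun t => Re (f t) ^+ 2 + Im (f t) ^+ 2)).
    by apply: measurable_funD; apply: measurable_funX.
  by apply/funext => t; rewrite sqr_cabs.
move=> t Dt; rewrite /= lee_fin ger0_norm ?sqr_ge0 //.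
by rewrite (le_trans (fh _ Dt)) // ler_norm.
Qed.

Lemma L2_addM D f g c : measurable D -> L2 D f -> L2 D g ->
  L2 D (fun t => f t + c * g t).
Proof.
move=> mD fL gL.
have [f1 f2 _] := fL; have [g1 g2 _] := gL.
pose h t := 2 * cabs (f t) ^+ 2 + 2 * cabs c ^+ 2 * cabs (g t) ^+ 2.
apply: (@L2_le D _ h) => //.
- rewrite (_ : (fun t => _) = (fun t => Re (f t) + (Re c * Re (g t) - Im c * Im (g t)))).
    apply: measurable_funD => //; apply: measurable_funB; exact: measurable_funM.
  by apply/funext => t; rewrite cReD cReM.
- rewrite (_ : (fun t => _) = (fun t => Im (f t) + (Re c * Im (g t) + Im c * Re (g t)))).
    apply: measurable_funD => //; apply: measurable_funD; exact: measurable_funM.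
  by apply/funext => t; rewrite cImD cImM.
- move=> t _; rewrite /h.
  have := cabs_leD (f t) (c * g t); rewrite cabsM.
  have := cabs_ge0 (f t + c * g t); have := cabs_ge0 (f t).
  have := mulr_ge0 (cabs_ge0 c) (cabs_ge0 (g t)).
  rewrite -mulrA -exprMn => h1 h2 h3 h4.
  exact: sqr_le_twice.
have hi := integrableD mD (integrableZl mD 2 (L2_integrable_sqr fL))
  (integrableZl mD (2 * cabs c ^+ 2) (L2_integrable_sqr gL)).
by apply: eq_integrable hi.
Qed.

Lemma L2_sub D E f : measurable D -> measurable E -> E `<=` D -> L2 D f -> L2 E f.
Proof.
move=> mD mE ED fL; have [f1 f2 _] := fL.
apply: (@L2_le E _ (fun t => cabs (f t) ^+ 2)) => //.
- exact: measurable_funS f1.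
- exact: measurable_funS f2.
exact: (integrableS mD mE ED (L2_integrable_sqr fL)).
Qed.

Lemma L2_eq D f g : measurable D -> {in D, f =1 g} -> L2 D f -> L2 D g.
Proof.
move=> mD fg fL; have [f1 f2 fi] := fL; split.
- by apply: eq_measurable_fun f1 => t tD; rewrite fg.
- by apply: eq_measurable_fun f2 => t tD; rewrite fg.
apply: le_lt_trans fi; rewrite le_eqVlt; apply/orP; left; apply/eqP.
by apply: eq_integral => t tD; rewrite fg.
Qed.

Lemma L2_glue (a b c : R) f : a <= b -> b <= c -> L2 `]a, b[ f -> L2 `]b, c[ f ->
  L2 `]a, c[ f.
Proof.
move=> ab bc f1 f2.
have mp : measurable ([set b] : set TR) by exact: measurable_set1.
have m1 : measurable (`]a, b[%classic : set TR) by exact: measurable_itv.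
have m2 : measurable (`]b, c[%classic : set TR) by exact: measurable_itv.
have E : `]a, c[%classic `<=` (`]a, b[%classic `|` `]b, c[%classic) `|` [set b].
  move=> x /=; rewrite !in_itv /= => /andP[ax xc].
  have [h|h|h] := ltgtP x b; [by left; left; rewrite ax | by left; right; rewrite xc | by right].
have mU : measurable (((`]a, b[%classic `|` `]b, c[%classic) `|` [set b]) : set TR).
  by do 2 apply: measurableU => //.
suff : L2 (((`]a, b[%classic `|` `]b, c[%classic) `|` [set b]) : set TR) f.
  by apply: L2_sub => //; exact: measurable_itv.
have [u1 u2 ui] := f1; have [v1 v2 vi] := f2.
split.
- by apply/measurable_funU => //; [exact: measurableU|split;
    [exact/measurable_funU|exact: measurable_fun_set1]].
- by apply/measurable_funU => //; [exact: measurableU|split;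
    [exact/measurable_funU|exact: measurable_fun_set1]].
have hm : measurable_fun (((`]a, b[%classic `|` `]b, c[%classic) `|` [set b]) : set TR)
    (fun x => ((cabs (f x)) ^+ 2)%:E).
  apply/measurable_EFinP/measurable_funU => //; first exact: measurableU.
  split; last exact: measurable_fun_set1.
  by apply/measurable_funU => //; split; exact: L2_measurable_sqr.
rewrite ge0_integral_setU //=; last 3 first.
- exact: measurableU.
- by move=> x _; rewrite lee_fin sqr_ge0.
- by apply/disj_set2P/seteqP; split => // x [] /= [] h xb; move: h; rewrite xb in_itv /= ltxx ?andbF.
rewrite integral_set1 adde0 ge0_integral_setU //=; last 3 first.
- by apply: (measurable_funS mU _ hm) => x; left.
- by move=> x _; rewrite lee_fin sqr_ge0.
- apply/disj_set2P/seteqP; split => // x [] /=; rewrite !in_itv /= => /andP[_ xb] /andP[bx _].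
  by have := lt_trans xb bx; rewrite ltxx.
exact: lte_add_pinfty.
Qed.

End SquareIntegrable.

(** * Euler's products for sine and cosine *)

Section EulerProducts.
Context {R : realType}.
Notation mu := (@lebesgue_measure R).
Notation TR := (measurableTypeR R).
Implicit Types (z sg : R[i]) (t x r : R) (n m K : nat).

(** These integrals generate Euler's products: for [n = 0] and [n = 1] they give sin (pi sg / 2) /
    sg and cos (pi sg / 2) / (1 - sg^2), and each passage from [n] to [n + 2] splits off one factor
    of the product. *)
Definition wallis n sg : R[i] :=
  cintegral `[0, (pi / 2 : R)] (fun t => (cos t ^+ n)%:C * ccos (sg * t%:C)).

(** Normalized to be 1 at [sg = 0]; this is what remains of the infinite product after finitely many
    factors have been removed. *)
Definition euler_rem n sg : R[i] := wallis n sg / wallis n 0.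

Let mI : measurable (`[0, (pi / 2 : R)]%classic : set TR).
Proof. exact: measurable_itv. Qed.

Let pihalf_gt0 : 0 < pi / 2 :> R.
Proof. by rewrite divr_gt0 ?pi_gt0. Qed.

Lemma is_cderive_ccos_mul sg x :
  is_cderive (fun t => ccos (sg * t%:C)) x (- (sg ^+ 2 * sin_div sg x)).
Proof.
have := is_cderive_ccos sg 0 x; rewrite addr0; congr (is_cderive _ _ _).
by apply/funext => t; rewrite addr0.
Qed.

Lemma is_cderive_sin_div_id sg x :
  is_cderive (sin_div sg) x (ccos (sg * x%:C)).
Proof.
have := is_cderive_sin_div sg 0 x; rewrite addr0; congr (is_cderive _ _ _).
by apply/funext => t; rewrite addr0.
Qed.

Lemma is_cderive_cosX n x :
  is_cderive (fun t => (cos t ^+ n)%:C) x (n%:R * cos x ^+ n.-1 * - sin x)%:C.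
Proof.
apply: is_cderive_real; case: n => [|n].
  rewrite !mul0r (_ : (fun t => _) = cst 1); first exact: is_derive_cst.
  by apply/funext => t; rewrite expr0.
rewrite (_ : (fun t => _) = cos ^+ n.+1); last by apply/funext => t; rewrite exprfctE.
by apply: is_derive_eq; rewrite /GRing.scale /= -mulr_natl.
Qed.

Lemma is_cderive_wallis n sg x :
  is_cderive (fun t => (cos t ^+ n)%:C * ccos (sg * t%:C)) x
   ((cos x ^+ n)%:C * - (sg ^+ 2 * sin_div sg x) +
    (n%:R * cos x ^+ n.-1 * - sin x)%:C * ccos (sg * x%:C)).
Proof. exact: is_cderiveM (is_cderive_cosX n x) (is_cderive_ccos_mul sg x). Qed.

Lemma wallis_integrable n sg :
  cintegrable `[0, (pi / 2 : R)] (fun t => (cos t ^+ n)%:C * ccos (sg * t%:C)).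
Proof. exact: is_cderive_cintegrable (is_cderive_wallis n sg). Qed.

Lemma wallis_rec n sg : (n.+2%:R ^+ 2 - sg ^+ 2) * wallis n.+2 sg =
  (n.+2 * n.+1)%:R * wallis n sg.
Proof.
(* An antiderivative of [f] that vanishes at 0, through sin 0, and at pi / 2, through cos (pi / 2).
   The recurrence says that the integral of [f] is 0. *)
pose F t := n.+2%:R * ((cos t ^+ n.+1)%:C * ((sin t)%:C * ccos (sg * t%:C))) +
  - sg ^+ 2 * ((cos t ^+ n.+2)%:C * sin_div sg t).
pose f t := (n.+2%:R ^+ 2 - sg ^+ 2) * ((cos t ^+ n.+2)%:C * ccos (sg * t%:C)) -
  (n.+2 * n.+1)%:R * ((cos t ^+ n)%:C * ccos (sg * t%:C)).
have Ff x : is_cderive F x (f x).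
  have := is_cderiveD (is_cderiveZ n.+2%:R (is_cderiveM (is_cderive_cosX n.+1 x)
     (is_cderiveM (is_cderive_real (is_derive_sin x)) (is_cderive_ccos_mul sg x))))
     (is_cderiveZ (- sg ^+ 2) (is_cderiveM (is_cderive_cosX n.+2 x) (is_cderive_sin_div_id sg x))).
  move/is_cderive_eq; apply; rewrite /f /=.
  have s2 : (sin x)%:C ^+ 2 = 1 - (cos x)%:C ^+ 2.
    by rewrite -!rmorphXn sin2cos2 rmorphB rmorph1.
  rewrite !(rmorphM, rmorphN, rmorphXn, rmorph_nat) natrM.
  set a := (cos x)%:C in s2 *; set b := (sin x)%:C in s2 *.
  rewrite !exprS.
  transitivity (n.+2%:R * (a * (a * a ^+ n) * ccos (sg * x%:C)) * 1
    - n.+2%:R * n.+1%:R * a ^+ n * ccos (sg * x%:C) * b ^+ 2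
    - sg ^+ 2 * (a * (a * a ^+ n) * ccos (sg * x%:C))); first by ring.
  rewrite s2 -(natr1 n.+1); ring.
have fl x := is_cderiveD (is_cderiveZ (n.+2%:R ^+ 2 - sg ^+ 2) (is_cderive_wallis n.+2 sg x))
  (is_cderiveZ (-1) (is_cderiveZ (n.+2 * n.+1)%:R (is_cderive_wallis n sg x))).
have fE : (fun t => (n.+2%:R ^+ 2 - sg ^+ 2) * ((cos t ^+ n.+2)%:C * ccos (sg * t%:C)) +
   -1 * ((n.+2 * n.+1)%:R * ((cos t ^+ n)%:C * ccos (sg * t%:C)))) = f.
  by apply/funext => t; rewrite mulN1r.
rewrite fE in fl.
have := cintegral_FTC2 pihalf_gt0 Ff fl.
rewrite /F cos_pihalf sin0 sin_div0 !expr0n /= !(mul0r, mulr0) addr0 subr0.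
rewrite /f cintegralB //; [|exact: cintegrableZ (wallis_integrable _ _)|exact: cintegrableZ (wallis_integrable _ _)].
rewrite !cintegralZ //; [|exact: wallis_integrable|exact: wallis_integrable].
by move/eqP; rewrite subr_eq0 => /eqP.
Qed.

Lemma wallis0E sg : wallis 0 sg = sin_div sg (pi / 2).
Proof.
rewrite /wallis (eq_cintegral (g := fun t => ccos (sg * t%:C))); last first.
  by move=> t _; rewrite expr0 mul1r.
rewrite (cintegral_FTC2 pihalf_gt0 (is_cderive_sin_div_id sg) (is_cderive_ccos_mul sg)).
by rewrite sin_div0 subr0.
Qed.

Lemma wallis1E sg : (1 - sg ^+ 2) * wallis 1 sg = ccos (sg * (pi / 2)%:C).
Proof.
pose F t := (sin t)%:C * ccos (sg * t%:C) + - sg ^+ 2 * ((cos t ^+ 1)%:C * sin_div sg t).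
pose f t := (1 - sg ^+ 2) * ((cos t ^+ 1)%:C * ccos (sg * t%:C)).
have Ff x : is_cderive F x (f x).
  have := is_cderiveD (is_cderiveM (is_cderive_real (is_derive_sin x)) (is_cderive_ccos_mul sg x))
     (is_cderiveZ (- sg ^+ 2) (is_cderiveM (is_cderive_cosX 1 x) (is_cderive_sin_div_id sg x))).
  move/is_cderive_eq; apply; rewrite /f /= !(rmorphM, rmorphN, rmorphXn, rmorph1) ?expr0 ?expr1.
  ring.
have := cintegral_FTC2 pihalf_gt0 Ff (fun x => is_cderiveZ (1 - sg ^+ 2) (is_cderive_wallis 1 sg x)).
rewrite cintegralZ //; last exact: wallis_integrable.
rewrite -/(wallis 1 sg) => ->.
by rewrite /F !expr1 cos_pihalf sin_pihalf sin0 sin_div0 !(mul0r, mulr0) mul1r !addr0 subr0.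
Qed.

Lemma wallis0_gt0 n : exists2 W : R, 0 < W & wallis n 0 = W%:C.
Proof.
have H m : (exists2 W : R, 0 < W & wallis m 0 = W%:C) ->
    exists2 W : R, 0 < W & wallis m.+2 0 = W%:C.
  move=> [W W0 WE]; exists (m.+1%:R / m.+2%:R * W); first by rewrite mulr_gt0 // divr_gt0 ?ltr0n.
  have := wallis_rec m 0; rewrite WE expr0n subr0 natrM => e.
  have n0 : m.+2%:R != 0 :> R[i] by rewrite pnatr_eq0.
  apply: (mulfI (expf_neq0 2 n0)); rewrite e !rmorphM fmorphV !rmorph_nat.
  by move: (m.+2%:R) (m.+1%:R) n0 => u v u0; field.
suff [] : (exists2 W : R, 0 < W & wallis n 0 = W%:C) /\
          (exists2 W : R, 0 < W & wallis n.+1 0 = W%:C) by [].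
elim: n => [|n [IH1 IH2]]; last by split => //; exact: H.
split; first by exists (pi / 2); rewrite ?wallis0E // /sin_div eqxx.
by exists 1 => //; have := wallis1E 0; rewrite expr0n subr0 mul1r mul0r ccos0.
Qed.

Lemma wallis0_neq0 n : wallis n 0 != 0.
Proof. by have [W W0 ->] := wallis0_gt0 n; rewrite -cabs_gt0 cabs_real normr_gt0 gt_eqF. Qed.

(** The recurrence for [wallis] divided by its own case [sg = 0]. *)
Lemma euler_rem_rec n sg :
  euler_rem n sg = (1 - sg ^+ 2 / n.+2%:R ^+ 2) * euler_rem n.+2 sg.
Proof.
have h0 := wallis_rec n 0; have hs := wallis_rec n sg.
rewrite expr0n subr0 /= in h0.
have w0 := wallis0_neq0 n; have w2 := wallis0_neq0 n.+2.
have n0 : n.+2%:R != 0 :> R[i] by rewrite pnatr_eq0.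
have p0 : (n.+2 * n.+1)%:R != 0 :> R[i] by rewrite pnatr_eq0.
rewrite /euler_rem -[LHS](mulKf p0) [_ * (wallis n sg / _)]mulrA -hs.
have -> : wallis n 0 = n.+2%:R ^+ 2 * wallis n.+2 0 / (n.+2 * n.+1)%:R.
  by rewrite h0 mulrC mulKf.
move: (wallis n.+2 sg) (wallis n.+2 0) w2 => a b b0.
move: (n.+2%:R) ((n.+2 * n.+1)%:R) n0 p0 => u v u0 v0.
by field; rewrite u0 v0 b0.
Qed.

Lemma euler_rem_prod n K sg : euler_rem n sg =
  \prod_(k < K) (1 - sg ^+ 2 / (n + 2 * k.+1)%:R ^+ 2) * euler_rem (n + 2 * K) sg.
Proof.
elim: K => [|K IH]; first by rewrite big_ord0 mul1r muln0 addn0.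
rewrite big_ord_recr /= IH -mulrA; congr (_ * _).
by rewrite euler_rem_rec (_ : (n + 2 * K.+1 = (n + 2 * K).+2)%N) // mulnS addnCA.
Qed.

(** A crude form of Jordan's inequality: the mean value theorem with cos >= cos 1 on [0, 1], and t
    <= 2, sin t >= sin 1 beyond. It replaces t^2 by sin^2 t, which combines with the weight cos^n
    t. *)
Lemma id_le_sin : exists2 C : R, 0 < C & forall t, 0 <= t <= pi / 2 -> t <= C * sin t.
Proof.
have c1 := @cos1_gt0 R; have p1 := @pihalf_ge1 R; have p2 := @pihalf_lt2 R.
have s1 : 0 < sin 1 :> R by apply: sin2_gt0; lra.
have C0 : 0 < (cos 1)^-1 + 2 / sin 1 :> R by rewrite addr_gt0 ?invr_gt0 ?divr_gt0.
exists ((cos 1)^-1 + 2 / sin 1) => // t /andP[t0 tp].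
have st : 0 <= sin t by apply: sin_ge0_pi; rewrite t0 /=; lra.
rewrite mulrDl.
have [t1|t1] := leP t 1.
  rewrite (@le_trans _ _ ((cos 1)^-1 * sin t)) //; last first.
    by rewrite lerDl mulr_ge0 // divr_ge0 // ltW.
  rewrite mulrC ler_pdivlMr //.
  have [-> | tn] := eqVneq t 0; first by rewrite mul0r sin0.
  have tp' : 0 < t by rewrite lt_def tn.
  have [c cI] := MVT_segment t0 (fun x _ => is_derive_sin x) (continuous_subspaceT (@continuous_sin R)).
  rewrite sin0 !subr0 => ->; rewrite mulrC ler_pM2r //.
  move: cI; rewrite in_itv /= => /andP[c0 ct].
  have cP : c \in `[0, pi] by rewrite in_itv /= c0; lra.
  have oP : 1 \in `[0, (pi : R)] by rewrite in_itv /=; lra.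
  by rewrite leNgt (ltr_cos oP cP) -leNgt (le_trans ct).
rewrite (@le_trans _ _ (2 / sin 1 * sin t)) //; last first.
  by rewrite lerDr mulr_ge0 // invr_ge0 ltW.
have : sin 1 <= sin t.
  have tP : t \in `[-(pi/2), (pi / 2)] by rewrite in_itv /=; lra.
  have oP : 1 \in `[-(pi/2), (pi / 2 : R)] by rewrite in_itv /=; lra.
  by rewrite leNgt (ltr_sin tP oP) -leNgt ltW.
move=> h; rewrite mulrAC ler_pdivlMr // ler_pM ?(ltW s1) //; lra.
Qed.

(* The weight [cos t ^+ n] concentrates at [t = 0], where [ccos (sg * t) = 1]. *)
Lemma euler_rem_cvg r : exists2 C : R, 0 <= C & forall n sg, cabs sg <= r ->
  cabs (euler_rem n sg - 1) <= C / n.+2%:R.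
Proof.
have [C C0 CP] := id_le_sin.
pose K := r ^+ 2 * expR (r * 2) * C ^+ 2.
exists (2 * `|K|); first by rewrite mulr_ge0.
move=> n sg sr.
have r0 : 0 <= r := le_trans (cabs_ge0 _) sr.
have K0 : 0 <= K by apply: mulr_ge0 (sqr_ge0 _); apply: mulr_ge0 (expR_ge0 _); exact: sqr_ge0.
rewrite (ger0_norm K0).
have [W W0 WE] := wallis0_gt0 n.
(* |cos (sg t) - 1| is at most a constant times t^2, hence at most K sin^2 t. Since sin^2 = 1 -
   cos^2, the weighted bound is a difference of powers of the cosine, whose integral is W / (n + 2)
   by the recurrence at [sg = 0]. *)
have bound t : 0 <= t <= pi / 2 ->
    cabs ((cos t ^+ n)%:C * ccos (sg * t%:C) - (cos t ^+ n)%:C * ccos (0 * t%:C)) <=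
    K * (cos t ^+ n - cos t ^+ n.+2).
  move=> tI; have /andP[t0 tp] := tI; have p2 := @pihalf_lt2 R.
  have ct : 0 <= cos t by apply: cos_ge0_pihalf; rewrite tp andbT; lra.
  rewrite mul0r ccos0 -mulrBr cabsM cabs_real ger0_norm ?exprn_ge0 //.
  have -> : K * (cos t ^+ n - cos t ^+ n.+2) = cos t ^+ n * (K * sin t ^+ 2).
    by rewrite sin2cos2 !exprS expr0; ring.
  rewrite ler_wpM2l ?exprn_ge0 // cabs_distC (le_trans (cabs_one_sub_ccos _)) //.
  rewrite cabsM cabs_real (ger0_norm t0) exprMn /K.
  have h1 : cabs sg ^+ 2 <= r ^+ 2 by rewrite lerXn2r ?nnegrE ?cabs_ge0.
  have h2 : t ^+ 2 <= C ^+ 2 * sin t ^+ 2.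
    by rewrite -exprMn lerXn2r ?nnegrE ?CP // (le_trans t0) ?CP.
  have h3 : expR (cabs sg * t) <= expR (r * 2).
    by rewrite ler_expR ler_pM ?cabs_ge0 //; lra.
  have -> : r ^+ 2 * expR (r * 2) * C ^+ 2 * sin t ^+ 2 =
    r ^+ 2 * (C ^+ 2 * sin t ^+ 2) * expR (r * 2) by ring.
  by apply: ler_pM h3; [exact: mulr_ge0 (sqr_ge0 _) (sqr_ge0 _) | exact: expR_ge0 | exact: ler_pM (sqr_ge0 _) (sqr_ge0 _) h1 h2].
have cosI m : mu.-integrable `[0, (pi / 2 : R)] (EFin \o (fun t => cos t ^+ m)).
  have [h _] := wallis_integrable m 0.
  by apply: eq_integrable h => // t _; rewrite /comp mul0r ccos0 mulr1.
have WR m : wallis m 0 = (\int[mu]_(t in `[0, (pi / 2 : R)]) (cos t ^+ m))%:C.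
  rewrite /wallis (eq_cintegral (g := fun t => (cos t ^+ m)%:C)); last first.
    by move=> t _; rewrite mul0r ccos0 mulr1.
  by apply: complex_eqP => //=; rewrite /Rintegral integral0.
have fi := cintegrableB mI (wallis_integrable n sg) (wallis_integrable n 0).
have h : cabs (wallis n sg - wallis n 0) <= 2 * K * (W / n.+2%:R).
  rewrite /wallis -cintegralB //; [|exact: wallis_integrable|exact: wallis_integrable].
  rewrite (le_trans (cabs_cintegral_le mI fi)) //.
  have di := integrableB mI (cosI n) (cosI n.+2).
  have -> : W / n.+2%:R = \int[mu]_(t in `[0, (pi / 2 : R)]) (cos t ^+ n - cos t ^+ n.+2).
    apply: complexI; rewrite RintegralB // rmorphB /= -!WR.
    have n0 : n.+2%:R != 0 :> R[i] by rewrite pnatr_eq0.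
    have := wallis_rec n 0; rewrite expr0n subr0 natrM => e.
    have -> : wallis n.+2 0 = n.+1%:R / n.+2%:R * wallis n 0.
      by apply: (mulfI (expf_neq0 2 n0)); rewrite e; move: (n.+2%:R) (n.+1%:R) n0 => u v u0; field.
    rewrite [in LHS]rmorphM fmorphV rmorph_nat WE; move: n0; rewrite -(natr1 n.+1).
    by move: (n.+1%:R) => v v0; field.
  rewrite -RintegralZl //; apply: le_Rintegral => //.
  - exact: integrable_L1norm.
  - by apply: eq_integrable (integrableZl mI (2 * K) di).
  move=> t; rewrite /= in_itv /= => tI.
  have b := bound _ tI.
  have := cabs_Re ((cos t ^+ n)%:C * ccos (sg * t%:C) - (cos t ^+ n)%:C * ccos (0 * t%:C)).
  have := cabs_Im ((cos t ^+ n)%:C * ccos (sg * t%:C) - (cos t ^+ n)%:C * ccos (0 * t%:C)).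
  lra.
have -> : euler_rem n sg - 1 = (wallis n sg - wallis n 0) / wallis n 0.
  by rewrite /euler_rem mulrBl divff ?wallis0_neq0.
rewrite cabsM cabsV WE cabs_real (gtr0_norm W0) ler_pdivrMr // -WE.
by rewrite (le_trans h) // mulrA mulrAC.
Qed.

Lemma sin_div_euler K rho x : sin_div rho x =
  x%:C * (\prod_(k < K) (1 - rho ^+ 2 * x%:C ^+ 2 / ((k.+1)%:R * pi%:C) ^+ 2) *
    euler_rem (2 * K) (2 * rho * x%:C / pi%:C)).
Proof.
have pi0 : pi%:C != 0 :> R[i] by rewrite -cabs_gt0 cabs_real normr_gt0 gt_eqF // pi_gt0.
have p2 : (pi / 2)%:C = pi%:C / 2 :> R[i] by rewrite rmorphM fmorphV rmorph_nat.
have two0 : 2 != 0 :> R[i] by rewrite pnatr_eq0.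
have [->|x0] := eqVneq x 0; first by rewrite sin_div0 mul0r.
have xC0 : x%:C != 0 :> R[i] by rewrite -cabs_gt0 cabs_real normr_gt0.
have -> : sin_div rho x = x%:C * euler_rem 0 (2 * rho * x%:C / pi%:C).
  rewrite /euler_rem !wallis0E /sin_div eqxx p2.
  have [->|r0] := eqVneq rho 0; first by rewrite mulr0 !mul0r eqxx divff ?mulr1 // mulf_neq0 ?invr_eq0.
  rewrite !mulf_eq0 (negPf r0) (negPf xC0) invr_eq0 (negPf pi0) (negPf two0) /=.
  have -> : 2 * rho * x%:C / pi%:C * (pi%:C / 2) = rho * x%:C.
    by move: (pi%:C) pi0 => P P0; field.
  move: (csin _) => c; move: (pi%:C) pi0 (x%:C) xC0 => P P0 X X0; field.
  by rewrite ?r0 ?X0 ?P0.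
congr (_ * _); rewrite (euler_rem_prod 0 K) add0n; congr (_ * _).
apply: eq_bigr => k _; congr (1 - _).
have k0 : k.+1%:R != 0 :> R[i] by rewrite pnatr_eq0.
rewrite add0n natrM; move: (pi%:C) pi0 (x%:C) (k.+1%:R) k0 => P P0 X u u0; field.
by rewrite ?P0 ?u0.
Qed.

(** The factor [1 - sg ^+ 2] in [wallis1E] supplies the first of the [K.+1] factors, the recurrence
    the other [K]. *)
Lemma ccos_euler K rho : ccos (rho / 2) =
  \prod_(k < K.+1) (1 - rho ^+ 2 / ((2 * k + 1)%:R * pi%:C) ^+ 2) *
    euler_rem (2 * K + 1) (rho / pi%:C).
Proof.
have pi0 : pi%:C != 0 :> R[i] by rewrite -cabs_gt0 cabs_real normr_gt0 gt_eqF // pi_gt0.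
have two0 : 2 != 0 :> R[i] by rewrite pnatr_eq0.
have p2 : (pi / 2)%:C = pi%:C / 2 :> R[i] by rewrite rmorphM fmorphV rmorph_nat.
have w1 : wallis 1 0 = 1 by have := wallis1E 0; rewrite expr0n subr0 mul1r mul0r ccos0.
have -> : rho / 2 = rho / pi%:C * (pi / 2)%:C by rewrite p2; move: (pi%:C) pi0 => P P0; field.
rewrite -wallis1E; have -> : wallis 1 (rho / pi%:C) = euler_rem 1 (rho / pi%:C).
  by rewrite /euler_rem w1 divr1.
rewrite (euler_rem_prod 1 K) mulrA big_ord_recl addnC; congr (_ * _ * _).
  by rewrite muln0 add0n mul1r expr_div_n.
apply: eq_bigr => k _; congr (1 - _).
rewrite lift0 add1n -[(2 * k.+1).+1]addn1.
have k0 : (2 * k.+1 + 1)%:R != 0 :> R[i] by rewrite pnatr_eq0 addn1.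
move: (pi%:C) pi0 ((2 * k.+1 + 1)%:R) k0 => P P0 u u0; field.
by rewrite ?P0 ?u0.
Qed.

Lemma sin_half_euler K rho : sin_div rho 2^-1 =
  2^-1 * (\prod_(k < K) (1 - rho ^+ 2 / ((2 * k.+1)%:R * pi%:C) ^+ 2) *
    euler_rem (2 * K) (rho / pi%:C)).
Proof.
have pi0 : pi%:C != 0 :> R[i] by rewrite -cabs_gt0 cabs_real normr_gt0 gt_eqF // pi_gt0.
have two0 : 2 != 0 :> R[i] by rewrite pnatr_eq0.
have p2 : (2^-1)%:C = 2^-1 :> R[i] by rewrite fmorphV rmorph_nat.
rewrite (sin_div_euler K) p2; congr (_ * (_ * euler_rem _ _)); last by move: (pi%:C) pi0 => P P0; field.
apply: eq_bigr => k _; congr (1 - _).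
have k0 : k.+1%:R != 0 :> R[i] by rewrite pnatr_eq0.
rewrite natrM; move: (pi%:C) pi0 (k.+1%:R) k0 => P P0 u u0; field.
by rewrite ?P0 ?u0.
Qed.

End EulerProducts.

(** * The characteristic function *)

Section VariableEndpoint.
Context {R : realType}.
Notation mu := (@lebesgue_measure R).
Notation TR := (measurableTypeR R).
Implicit Types (f g h q : R -> R[i]) (a b x t : R) (c rho : R[i]).

Lemma integrable_ext0 (h : R -> R) : mu.-integrable `]0, 1[ (EFin \o h) ->
  mu.-integrable setT (EFin \o (fun t => if 0 < t < 1 then h t else 0)).
Proof.
have m01 : measurable (`]0, 1[%classic : set TR) by exact: measurable_itv.
move/(integrable_mkcond _ m01); apply: eq_integrable => // t _.
by rewrite patchE mem_setE in_itv /=; case: ifP.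
Qed.

Lemma cintegrable_ext0 h : cintegrable `]0, 1[ h -> cintegrable setT (ext0 h).
Proof.
move=> [/integrable_ext0 h1 /integrable_ext0 h2]; split.
  by apply: eq_integrable h1 => // t _; rewrite /ext0 /=; case: ifP.
by apply: eq_integrable h2 => // t _; rewrite /ext0 /=; case: ifP.
Qed.

Lemma mul_ext0 f h t : f t * ext0 h t = ext0 (fun u => f u * h u) t.
Proof. by rewrite /ext0; case: ifP => _ //; rewrite mulr0. Qed.

(** Expressing the oriented integral through a primitive based at a common lower bound removes the
    case distinction on the order of the end points; additivity becomes ring arithmetic. *)
Lemma from_to_primitive l f a x : cintegrable setT f -> l <= a -> l <= x ->
  cintegral_from_to a x f = cintegral `[l, x] f - cintegral `[l, a] f.
Proof.
move=> fi.
have sub (i : interval R) : cintegrable [set` i] f by apply: cintegrableS fi.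
have H b y : l <= b -> b <= y -> cintegral `[b, y] f =
    cintegral `[l, y] f - cintegral `[l, b] f.
  move=> b1 bY; have [f1 f2] := sub `[l, y]; have [g1 g2] := sub `]b, y].
  apply: complex_eqP; rewrite ?cReD ?cReN ?cImD ?cImN /=.
    by rewrite (Rintegral_itvB f1) ?bnd_simp // Rintegral_itv_obnd_cbnd.
  by rewrite (Rintegral_itvB f2) ?bnd_simp // Rintegral_itv_obnd_cbnd.
move=> a1 x1; rewrite /cintegral_from_to; case: leP => ax; first exact: H.
by rewrite (H x a) ?(ltW ax) // opprB.
Qed.

Lemma from_to_split f a b x : cintegrable setT f ->
  cintegral_from_to a x f = cintegral_from_to a b f + cintegral_from_to b x f.
Proof.
move=> fi; pose l := Num.min a (Num.min b x).
have la : l <= a by rewrite ge_min lexx.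
have lb : l <= b by rewrite ge_min ge_min lexx orbT.
have lx : l <= x by rewrite ge_min ge_min lexx !orbT.
by rewrite !(@from_to_primitive l) //; ring.
Qed.

Lemma from_to_cst_mulD f g a x c d : cintegrable setT f -> cintegrable setT g ->
  cintegral_from_to a x (fun t => c * f t + d * g t) =
  c * cintegral_from_to a x f + d * cintegral_from_to a x g.
Proof.
move=> fi gi; pose l := Num.min a x.
have la : l <= a by rewrite ge_min lexx.
have lx : l <= x by rewrite ge_min lexx orbT.
have cfi := cintegrableZ c measurableT fi; have dgi := cintegrableZ d measurableT gi.
rewrite !(@from_to_primitive l) //; last exact: cintegrableD.
have sub k (i : interval R) : cintegrable setT k -> cintegrable [set` i] k.
  by move=> ki; apply: cintegrableS ki.
rewrite !cintegralD //; try (by apply: sub); try exact: measurable_itv.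
rewrite !cintegralZ //; try (by apply: sub); try exact: measurable_itv.
ring.
Qed.

Lemma is_derive_small (r m : R -> R) x0 : r x0 = 0 ->
  (\forall x \near x0, `|r x| <= `|x - x0| * m x) ->
  (m x @[x --> x0] --> 0) -> is_derive x0 1 r 0.
Proof.
move=> r0 rm m0.
suff H : (fun h : R => h^-1 *: ((r \o shift x0) (h *: (1 : R)) - r x0)) @ 0^' --> (0 : R).
  by apply: DeriveDef; [apply/cvg_ex; exists 0; exact: H | exact: cvg_lim H].
apply/cvgrPdist_le => e e0.
have /cvgrPdist_le /(_ _ e0) me := m0.
have : \forall x \near x0, `|r x| <= `|x - x0| * e.
  near=> x; apply: (le_trans (_ : _ <= `|x - x0| * m x)); first by near: x.
  rewrite ler_wpM2l // (le_trans (ler_norm _)) // -normrN -[- m x]sub0r.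
  by near: x.
move=> /nbhs_ballP[d /= d0 hd].
apply: (@filterS _ (nbhs 0) _ [set h : R | `|0 - h| < d]); last by exists d.
move=> h /= hd0 hn0; rewrite sub0r normrN r0 subr0 /shift /= normrM normfV.
rewrite mulrC ler_pdivrMr ?normr_gt0 // [_ *: 1]mulr1.
have := hd (h + x0); rewrite /ball /= addrK mulrC; apply.
by rewrite opprD addrCA subrr addr0 -normrN opprK -normrN -sub0r.
Unshelve. all: by end_near. Qed.

Lemma is_cderive_sin_div_sub rho x t :
  is_cderive (fun u => sin_div rho (x - u)) t (- ccos (rho * (t - x)%:C)).
Proof.
have := is_cderiveZ (-1) (is_cderive_sin_div rho (- x) t); rewrite mulN1r.
congr (is_cderive _ _ _); apply/funext => u.
by rewrite mulN1r -sin_div_oppr opprB.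
Qed.

Lemma sin_div_ext0_integrable rho q x : cintegrable `]0, 1[ q ->
  cintegrable setT (fun t => sin_div rho (x - t) * ext0 q t).
Proof.
move=> qi; rewrite (_ : (fun t => _) = ext0 (fun t => sin_div rho (x - t) * q t)); last first.
  by apply/funext => t; exact: (mul_ext0 (fun u => sin_div rho (x - u))).
apply: cintegrable_ext0.
have [k1 k2] := is_cderive_measurable `]0, 1[ (is_cderive_sin_div_sub rho x).
pose B := (`|x| + 1) * expR (cabs rho * (`|x| + 1)).
apply: (cintegrable_mul (B := B)) => // t; rewrite /= in_itv /= => /andP[t0 t1].
have xt : `|x - t| <= `|x| + 1.
  by rewrite (le_trans (ler_normB _ _)) // lerD2l gtr0_norm // ltW.
rewrite (le_trans (cabs_sin_div_le _ _)) // ler_pM ?expR_ge0 // ler_expR.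
by rewrite ler_wpM2l ?cabs_ge0.
Qed.

Lemma ccos_ext0_integrable rho q : cintegrable `]0, 1[ q ->
  cintegrable setT (fun t => ccos (rho * t%:C) * ext0 q t).
Proof.
move=> qi; rewrite (_ : (fun t => _) = ext0 (fun t => ccos (rho * t%:C) * q t)); last first.
  by apply/funext => t; exact: (mul_ext0 (fun u => ccos (rho * u%:C))).
apply: cintegrable_ext0.
have d x : is_cderive (fun t => ccos (rho * t%:C)) x (- (rho ^+ 2 * sin_div rho x)).
  have := is_cderive_ccos rho 0 x; rewrite addr0; congr (is_cderive _ _ _).
  by apply/funext => t; rewrite addr0.
have [k1 k2] := is_cderive_measurable `]0, 1[ d.
apply: (cintegrable_mul (B := expR (cabs rho))) => // t; rewrite /= in_itv /= => /andP[t0 t1].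
rewrite (le_trans (cabs_ccos_le _)) // ler_expR (le_trans (cabs_Im _)) // cabsM cabs_real.
by rewrite ler_piMr ?cabs_ge0 // gtr0_norm // ltW.
Qed.

Lemma is_cderive_from_to_self rho q x0 : cintegrable `]0, 1[ q ->
  is_cderive (fun x => cintegral_from_to x0 x (fun t => sin_div rho (x - t) * ext0 q t)) x0 0.
Proof.
move=> qi; have gi := cintegrable_ext0 qi; set g := ext0 q in gi *.
pose l := x0 - 1; pose N t := `|Re (g t)| + `|Im (g t)|.
have Ni (i : interval R) : mu.-integrable [set` i] (EFin \o N).
  by have := integrable_L1norm measurableT gi; apply: integrableS.
pose G x := parameterized_integral mu l x N.
have cG : {for x0, continuous G}.
  have lb : l < x0 + 1 by rewrite /l ltrBlDr -addrA ltrDl.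
  have := parameterized_integral_continuous (ltW lb) (Ni _).
  move/(continuous_within_itvP _ lb) => [+ _ _]; apply.
  by rewrite in_itv /= /l ltrBlDr !ltrDl ltr01.
pose K := 2 * expR (cabs rho).
have K0 : 0 <= K by rewrite mulr_ge0 ?expR_ge0.
pose m x := K * `|G x - G x0|.
have m0 : m x @[x --> x0] --> 0.
  have h : (G x - G x0) @[x --> x0] --> G x0 - G x0 by apply: cvgB => //; exact: cvg_cst.
  have := cvgM (cvg_cst K) (cvg_norm h); rewrite subrr normr0 mulr0.
  exact.
pose S x := cintegral_from_to x0 x (fun t => sin_div rho (x - t) * g t).
have S0 : S x0 = 0 by rewrite /S (@from_to_primitive x0) ?subrr //; exact: sin_div_ext0_integrable.
have bound y z x : l <= y -> y <= z -> z - y <= 1 -> y <= x <= z ->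
    cabs (cintegral `[y, z] (fun t => sin_div rho (x - t) * g t)) <=
    (z - y) * (K * `|G z - G y|).
  move=> ly yz yz1 /andP[yx xz].
  have [k1 k2] := is_cderive_measurable `[y, z] (is_cderive_sin_div_sub rho x).
  have gy : cintegrable `[y, z] g by apply: cintegrableS gi.
  have kB t : t \in `[y, z] -> cabs (sin_div rho (x - t)) <= (z - y) * expR (cabs rho).
    rewrite in_itv /= => /andP[yt tz].
    have h : `|x - t| <= z - y by rewrite ler_norml; lra.
    rewrite (le_trans (cabs_sin_div_le _ _)) // ler_pM ?expR_ge0 // ler_expR.
    by rewrite ler_piMr ?cabs_ge0 // (le_trans h).
  have := cabs_cintegral_mul_le (measurable_itv _) k1 k2 kB gy.
  move/le_trans; apply.
  have -> : L1norm `[y, z] g = G z - G y.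
    rewrite /G /parameterized_integral (Rintegral_itvB (Ni _)) ?bnd_simp //.
    by rewrite Rintegral_itv_obnd_cbnd.
  rewrite /K (le_trans (ler_norm _)) // !normrM (ger0_norm (expR_ge0 _)).
  rewrite (ger0_norm (_ : 0 <= z - y)) ?subr_ge0 // ger0_norm //.
  by rewrite le_eqVlt; apply/orP; left; apply/eqP; ring.
have near1 : \forall x \near x0, cabs (S x) <= `|x - x0| * m x.
  exists 1 => //= x /= xx; rewrite /S /cintegral_from_to /m.
  rewrite distrC in xx.
  have [x0x|x0x] := leP x0 x.
    rewrite (ger0_norm (_ : 0 <= x - x0)) ?subr_ge0 //.
    apply: bound; rewrite ?x0x ?lexx //; first by rewrite /l gerBl.
    by move: xx; rewrite ger0_norm ?subr_ge0 // => /ltW.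
  rewrite cabsN distrC (distrC (G x)) (ger0_norm (_ : 0 <= x0 - x)) ?subr_ge0 ?(ltW x0x) //.
  move: xx; rewrite ltr0_norm ?subr_lt0 // opprB => xx.
  apply: bound; [by rewrite /l; lra | exact: ltW | exact: ltW | by rewrite lexx ltW].
split; apply: (is_derive_small _ _ m0).
- by rewrite -/(S x0) S0.
- by apply: filterS near1 => x; apply: le_trans; exact: cabs_Re.
- by rewrite -/(S x0) S0.
- by apply: filterS near1 => x; apply: le_trans; exact: cabs_Im.
Qed.

Lemma sin_div_sub rho x t : sin_div rho (x - t) =
  sin_div rho x * ccos (rho * t%:C) - ccos (rho * x%:C) * sin_div rho t.
Proof. by rewrite sin_divD sin_div_oppr ccos_mulN mulrN. Qed.

Lemma from_to_sin_div_sub rho q a b x : cintegrable `]0, 1[ q ->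
  cintegral_from_to a b (fun t => sin_div rho (x - t) * ext0 q t) =
  sin_div rho x * cintegral_from_to a b (fun t => ccos (rho * t%:C) * ext0 q t) -
  ccos (rho * x%:C) * cintegral_from_to a b (fun t => sin_div rho t * ext0 q t).
Proof.
move=> qi; rewrite -mulNr -from_to_cst_mulD; last 2 first.
- exact: ccos_ext0_integrable.
- have := cintegrableZ (-1) measurableT (sin_div_ext0_integrable rho 0 qi).
  apply: eq_cintegrable => // t _.
  by rewrite sub0r sin_div_oppr mulrA mulN1r opprK.
congr (cintegral_from_to _ _ _); apply/funext => t.
by rewrite sin_div_sub; ring.
Qed.

(** The variable occurs both in the kernel and in the limit. Splitting at [x0] separates the two:
    over [a, x0] the addition formula leaves a combination of sine and cosine with fixed
    coefficients, and the rest has derivative 0 at [x0]. *)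
Lemma is_cderive_from_to rho q a x0 : cintegrable `]0, 1[ q ->
  is_cderive (fun x => cintegral_from_to a x (fun t => sin_div rho (x - t) * ext0 q t)) x0
   (ccos (rho * x0%:C) * cintegral_from_to a x0 (fun t => ccos (rho * t%:C) * ext0 q t) +
    rho ^+ 2 * sin_div rho x0 * cintegral_from_to a x0 (fun t => sin_div rho t * ext0 q t)).
Proof.
move=> qi.
set A := cintegral_from_to a x0 (fun t => ccos _ * _).
set B := cintegral_from_to a x0 (fun t => sin_div rho t * _).
have -> : (fun x => cintegral_from_to a x (fun t => sin_div rho (x - t) * ext0 q t)) =
  fun x => (A * sin_div rho x + - B * ccos (rho * x%:C)) +
    cintegral_from_to x0 x (fun t => sin_div rho (x - t) * ext0 q t).
  apply/funext => x; rewrite (from_to_split a x0 x (sin_div_ext0_integrable rho x qi)).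
  by rewrite from_to_sin_div_sub // -/A -/B; ring.
have ds : is_cderive (sin_div rho) x0 (ccos (rho * x0%:C)).
  have := is_cderive_sin_div rho 0 x0; rewrite addr0; congr (is_cderive _ _ _).
  by apply/funext => t; rewrite addr0.
have dc : is_cderive (fun t => ccos (rho * t%:C)) x0 (- (rho ^+ 2 * sin_div rho x0)).
  have := is_cderive_ccos rho 0 x0; rewrite addr0; congr (is_cderive _ _ _).
  by apply/funext => t; rewrite addr0.
have := is_cderiveD (is_cderiveD (is_cderiveZ A ds) (is_cderiveZ (- B) dc))
  (is_cderive_from_to_self rho x0 qi).
by move/is_cderive_eq; apply; ring.
Qed.

End VariableEndpoint.

(** * The determinant as an integral against [w] *)

Section CharacteristicFunction.
Context {R : realType}.
Notation mu := (@lebesgue_measure R).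
Notation TR := (measurableTypeR R).
Implicit Types (f g h q : R -> R[i]) (a b x t y : R) (c rho gamma : R[i]).

(** Undoes the last gluing in the construction of the potential; [gamma] is its own inverse for the
    values considered. *)
Definition q_shift gamma q a y : R[i] :=
  if y < 1 - a then q (y + a) else gamma * q (y + a - 1).

Definition w_pot gamma q a y : R[i] :=
  q_shift gamma q a y + gamma * q_shift gamma q a (1 - y).

Lemma gamma2 gamma : gamma = 1 \/ gamma = -1 -> gamma ^+ 2 = 1.
Proof. by case=> ->; rewrite ?sqrrN expr1n. Qed.

Lemma q_shift_L2 gamma q a : 0 <= a <= 1 -> L2 `]0, 1[ q -> L2 `]0, 1[ (q_shift gamma q a).
Proof.
move=> /andP[a0 a1] qL.
have a1' : 0 <= 1 - a by rewrite subr_ge0.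
have a1'' : 1 - a <= 1 by rewrite gerBl.
apply: (L2_glue a1' a1'').
  have qa : L2 `]a, 1[ q.
    apply: L2_sub qL => //; apply: subset_itv; rewrite ?bnd_simp //.
  have := L2_affine a (or_introl erefl : 1 = 1 \/ 1 = -1) (measurable_itv _) qa.
  have -> : (fun x : R => 1 * x + a) @^-1` `]a, 1[ = `]0, 1 - a[%classic.
    by apply/seteqP; split=> x /=; rewrite !in_itv /= => /andP[h1 h2]; apply/andP; split; lra.
  apply: L2_eq => // x; rewrite inE /= in_itv /= => /andP[_ h].
  by rewrite /q_shift h mul1r.
have qa : L2 `]0, a[ q.
  apply: L2_sub qL => //; apply: subset_itv; rewrite ?bnd_simp //.
have mD : measurable (`]1 - a, 1[%classic : set TR) by exact: measurable_itv.
have h := L2_affine (a - 1) (or_introl erefl : 1 = 1 \/ 1 = -1) (measurable_itv _) qa.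
have E : (fun x : R => 1 * x + (a - 1)) @^-1` `]0, a[ = `]1 - a, 1[%classic.
  by apply/seteqP; split=> x /=; rewrite !in_itv /= => /andP[h1 h2]; apply/andP; split; lra.
rewrite E in h.
have := L2_addM (gamma - 1) mD h h.
apply: L2_eq => // x; rewrite inE /= in_itv /= => /andP[h1 _].
rewrite /q_shift ltNge (ltW h1) /= mul1r addrA; ring.
Qed.

Lemma L2_onem f : L2 `]0, 1[ f -> L2 `]0, 1[ (fun y => f (1 - y)).
Proof.
move=> fL.
have := L2_affine 1 (or_intror erefl : -1 = 1 \/ -1 = -1) (measurable_itv _) fL.
have -> : (fun x : R => -1 * x + 1) @^-1` `]0, 1[ = `]0, 1[%classic.
  by apply/seteqP; split=> x /=; rewrite !in_itv /= => /andP[h1 h2]; apply/andP; split; lra.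
by apply: L2_eq => // x _; rewrite mulN1r addrC.
Qed.

Lemma w_pot_L2 gamma q a : 0 <= a <= 1 -> L2 `]0, 1[ q -> L2 `]0, 1[ (w_pot gamma q a).
Proof.
by move=> aI qL; apply: L2_addM => //; [exact: q_shift_L2|apply: L2_onem; exact: q_shift_L2].
Qed.

Lemma w_pot_onem gamma q a y : gamma = 1 \/ gamma = -1 ->
  w_pot gamma q a (1 - y) = gamma * w_pot gamma q a y.
Proof.
move=> /gamma2 g2; rewrite /w_pot subKr mulrDr mulrA -expr2 g2 mul1r addrC //.
Qed.

Lemma sin_div_integrable01 rho f : cintegrable `]0, 1[ f ->
  cintegrable `]0, 1[ (fun t => sin_div rho t * f t).
Proof.
move=> fi; have := cintegrableZ (-1) measurableT (sin_div_ext0_integrable rho 0 fi).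
move=> h; have : cintegrable `]0, 1[ (fun t => -1 * (sin_div rho (0 - t) * ext0 f t)).
  by apply: cintegrableS h.
apply: eq_cintegrable => // t; rewrite inE /= in_itv /= => tI.
by rewrite /ext0 tI sub0r sin_div_oppr mulrA mulN1r opprK.
Qed.

Lemma ccos_integrable01 rho f : cintegrable `]0, 1[ f ->
  cintegrable `]0, 1[ (fun t => ccos (rho * t%:C) * f t).
Proof.
move=> fi; have h := ccos_ext0_integrable rho fi.
have : cintegrable `]0, 1[ (fun t => ccos (rho * t%:C) * ext0 f t).
  by apply: cintegrableS h.
apply: eq_cintegrable => // t; rewrite inE /= in_itv /= => tI.
by rewrite /ext0 tI.
Qed.

Lemma from_to_0_ext0 f h a : 0 <= a <= 1 -> cintegrable `]0, 1[ (fun t => f t * h t) ->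
  cintegral_from_to a 0 (fun t => f t * ext0 h t) = - cintegral `]0, a[ (fun t => f t * h t).
Proof.
move=> /andP[a0 a1] fi.
have fe : cintegrable setT (fun t => f t * ext0 h t).
  have := cintegrable_ext0 fi; apply: eq_cintegrable => // t _.
  by rewrite mul_ext0.
have -> : cintegral_from_to a 0 (fun t => f t * ext0 h t) = - cintegral `[0, a] (fun t => f t * ext0 h t).
  rewrite (@from_to_primitive _ 0) // /cintegral_from_to set_itv1.
  by rewrite /cintegral !Rintegral_set1 sub0r.
rewrite cintegral_oo_cc; last by apply: cintegrableS fe.
congr (- _); apply: eq_cintegral => t; rewrite inE /= in_itv /= => /andP[t0 ta].
by rewrite /ext0 t0 (lt_le_trans ta a1).
Qed.

Lemma from_to_1_ext0 f h a : 0 <= a <= 1 -> cintegrable `]0, 1[ (fun t => f t * h t) ->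
  cintegral_from_to a 1 (fun t => f t * ext0 h t) = cintegral `]a, 1[ (fun t => f t * h t).
Proof.
move=> /andP[a0 a1] fi.
have fe : cintegrable setT (fun t => f t * ext0 h t).
  have := cintegrable_ext0 fi; apply: eq_cintegrable => // t _.
  by rewrite mul_ext0.
rewrite /cintegral_from_to a1 cintegral_oo_cc; last by apply: cintegrableS fe.
apply: eq_cintegral => t; rewrite inE /= in_itv /= => /andP[t0 ta].
by rewrite /ext0 (le_lt_trans a0 t0) ta.
Qed.

(** Each term of the determinant contains [C] or its derivative exactly once, so the potential
    enters linearly. The part without [q] collapses by [cos2_sin_div2] and the addition formula; in
    the rest gamma^2 = 1 and the addition formulas merge products of kernels into values at [a],
    [1 - a] and [1 + a]. *)
Lemma char_fun_sincos q a gamma lambda : 0 <= a <= 1 -> gamma = 1 \/ gamma = -1 ->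
  cintegrable `]0, 1[ q ->
  let rho := sqrtC lambda in
  let c t := ccos (rho * t%:C) in let s := sin_div rho in
  char_fun q a gamma lambda = 2 - 2 * gamma * c 1 -
   ((s a + gamma * s (1 - a)) * cintegral `]0, a[ (fun t => c t * q t) +
    (gamma * c (1 - a) - c a) * cintegral `]0, a[ (fun t => s t * q t) +
    (gamma * s (1 + a) - s a) * cintegral `]a, 1[ (fun t => c t * q t) +
    (c a - gamma * c (1 + a)) * cintegral `]a, 1[ (fun t => s t * q t)).
Proof.
move=> aI gE qi rho c s.
have g2 := gamma2 gE.
have ci := ccos_integrable01 rho qi; have si := sin_div_integrable01 rho qi.
have rho2 : rho ^+ 2 = lambda by exact: sqrtCK.
rewrite /char_fun /=.
have dC x0 : cderiv (solC q a lambda) x0 =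
   - (rho ^+ 2 * s (x0 - a)) + 
   (c x0 * cintegral_from_to a x0 (fun t => c t * ext0 q t) +
    rho ^+ 2 * s x0 * cintegral_from_to a x0 (fun t => s t * ext0 q t)).
  apply: is_cderive_val; apply: is_cderiveD (is_cderive_from_to _ _ _ qi).
  exact: is_cderive_ccos.
have dS x0 : cderiv (solS a lambda) x0 = c (x0 - a).
  by apply: is_cderive_val; exact: is_cderive_sin_div.
have eC x0 : solC q a lambda x0 = c (x0 - a) +
   (s x0 * cintegral_from_to a x0 (fun t => c t * ext0 q t) -
    c x0 * cintegral_from_to a x0 (fun t => s t * ext0 q t)).
  by rewrite /solC -/rho from_to_sin_div_sub.
have eS x0 : solS a lambda x0 = s (x0 - a) by [].
rewrite !dC !dS !eC !eS.
rewrite !from_to_0_ext0 // !from_to_1_ext0 //.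
set A0 := cintegral `]0, a[ (fun t => c t * q t).
set B0 := cintegral `]0, a[ (fun t => s t * q t).
set A1 := cintegral `]a, 1[ (fun t => c t * q t).
set B1 := cintegral `]a, 1[ (fun t => s t * q t).
have c0 : c 0 = 1 by rewrite /c mulr0 ccos0.
have s0 : s 0 = 0 by exact: sin_div0.
rewrite sub0r c0 s0.
have -> : c (- a) = c a by exact: ccos_mulN.
have -> : s (- a) = - s a by exact: sin_div_oppr.
have e1 : c 1 = c a * c (1 - a) - rho ^+ 2 * (s a * s (1 - a)).
  by rewrite /c -ccos_mulD addrC subrK.
have sub1 : 1 - (1 - a) = a by rewrite subKr.
have e2 : s a = s 1 * c (1 - a) - c 1 * s (1 - a).
  by rewrite -[in LHS]sub1 /s sin_div_sub.
have e3 : c a = c 1 * c (1 - a) + rho ^+ 2 * (s 1 * s (1 - a)).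
  by rewrite -[in LHS]sub1 /c ccos_mulD sin_div_oppr ccos_mulN mulrN mulrN opprK.
have e4 : s (1 + a) = s 1 * c a + c 1 * s a by exact: sin_divD.
have e5 : c (1 + a) = c 1 * c a - rho ^+ 2 * (s 1 * s a) by exact: ccos_mulD.
have p1 : c a ^+ 2 + rho ^+ 2 * s a ^+ 2 = 1 by exact: cos2_sin_div2.
have p2 : c (1 - a) ^+ 2 + rho ^+ 2 * s (1 - a) ^+ 2 = 1 by exact: cos2_sin_div2.
(* From here the trigonometric values are indeterminates subject to the seven relations, and the
   claim is a polynomial identity that also covers [rho = 0]. *)
move: (c a) (s a) (c (1 - a)) (s (1 - a)) (c 1) (s 1) (s (1 + a)) (c (1 + a)) (rho ^+ 2)
  e1 e2 e3 e4 e5 p1 p2 => ca sa cb sb c1 s1 sp cp l e1 e2 e3 e4 e5 p1 p2.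
transitivity ((ca ^+ 2 + l * sa ^+ 2) + gamma ^+ 2 * (cb ^+ 2 + l * sb ^+ 2)
   - 2 * gamma * (ca * cb - l * (sa * sb)) -
   ((sa + gamma * sb) * A0 + (gamma * cb - ca) * B0
    + (gamma * (s1 * ca + c1 * sa) - gamma ^+ 2 * (s1 * cb - c1 * sb)) * A1
    + (gamma ^+ 2 * (c1 * cb + l * (s1 * sb)) - gamma * (c1 * ca - l * (s1 * sa))) * B1)); first by ring.
by rewrite p1 p2 g2 -e1 -e2 -e3 -e4 -e5; ring.
Qed.

(** The reflection y -> 1 - y moves the second half of [w_pot] onto the kernel, which becomes s(y) +
    gamma s(1 - y) against [q_shift]. Splitting at [1 - a] and translating each piece brings back
    [q], and the addition formulas separate [a] from [t]. *)
Lemma w_pot_integral q a gamma rho : 0 <= a <= 1 -> gamma = 1 \/ gamma = -1 ->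
  L2 `]0, 1[ q ->
  let c t := ccos (rho * t%:C) in let s := sin_div rho in
  cintegral `]0, 1[ (fun y => s y * w_pot gamma q a y) =
   (s a + gamma * s (1 - a)) * cintegral `]0, a[ (fun t => c t * q t) +
    (gamma * c (1 - a) - c a) * cintegral `]0, a[ (fun t => s t * q t) +
    (gamma * s (1 + a) - s a) * cintegral `]a, 1[ (fun t => c t * q t) +
    (c a - gamma * c (1 + a)) * cintegral `]a, 1[ (fun t => s t * q t).
Proof.
move=> aI gE qL c s; have g2 := gamma2 gE.
have /andP[a0 a1] := aI.
have m01 : measurable (`]0, 1[%classic : set TR) by exact: measurable_itv.
have qi := L2_cintegrable qL.
have ci := ccos_integrable01 rho qi; have si := sin_div_integrable01 rho qi.
have sL := q_shift_L2 gamma aI qL.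
set Q := q_shift gamma q a in sL *.
have Qi := L2_cintegrable sL; have Qi' := L2_cintegrable (L2_onem sL).
have sQ := sin_div_integrable01 rho Qi; have sQ' := sin_div_integrable01 rho Qi'.
have cQ := ccos_integrable01 rho Qi.
have refl f : cintegrable `]0, 1[ f -> cintegral `]0, 1[ f = cintegral `]0, 1[ (fun y => f (1 - y)).
  move=> fi; rewrite (cintegral_affine 1 (or_intror erefl : -1 = 1 \/ -1 = -1) m01 fi).
  have -> : (fun x : R => -1 * x + 1) @^-1` `]0, 1[ = `]0, 1[%classic.
    by apply/seteqP; split=> x /=; rewrite !in_itv /= => /andP[h1 h2]; apply/andP; split; lra.
  by apply: eq_cintegral => y _; rewrite mulN1r addrC.
pose k y := s y + gamma * s (1 - y).
have kE y : k y = (1 - gamma * c 1) * s y + gamma * s 1 * c y.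
  by rewrite /k /s sin_div_sub -/(c y) -/(c 1); ring.
have kQi : cintegrable `]0, 1[ (fun y => k y * Q y).
  have := cintegrableD m01 (cintegrableZ (1 - gamma * c 1) m01 sQ) (cintegrableZ (gamma * s 1) m01 cQ).
  by apply: eq_cintegrable => // y _; rewrite kE /s /c; ring.
have -> : cintegral `]0, 1[ (fun y => s y * w_pot gamma q a y) = cintegral `]0, 1[ (fun y => k y * Q y).
  rewrite (eq_cintegral (g := fun y => s y * Q y + gamma * (s y * Q (1 - y)))); last first.
    by move=> y _; rewrite /w_pot -/Q; ring.
  rewrite cintegralD //; last exact: cintegrableZ.
  rewrite cintegralZ // (refl _ sQ').
  have sQr : cintegrable `]0, 1[ (fun y => s (1 - y) * Q y).
    have := cintegrableD m01 (cintegrableZ (s 1) m01 cQ) (cintegrableZ (- c 1) m01 sQ).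
    by apply: eq_cintegrable => // y _; rewrite /s sin_div_sub /c; ring.
  rewrite (eq_cintegral (f := fun y => s (1 - y) * Q (1 - (1 - y))) (g := fun y => s (1 - y) * Q y)); last first.
    by move=> y _; rewrite subKr.
  rewrite -cintegralZ // -cintegralD //; last exact: cintegrableZ.
  by apply: eq_cintegral => y _; rewrite /k; ring.
have sub (i : interval R) f : [set` i] `<=` `]0, 1[ -> cintegrable `]0, 1[ f -> cintegrable [set` i] f.
  by move=> ii fi; apply: cintegrableS fi.
have I1 : `]0, (1 - a)[%classic `<=` `]0, 1[ by apply: subset_itv; rewrite bnd_simp ?gerBl.
have I2 : `](1 - a), 1[%classic `<=` `]0, 1[ by apply: subset_itv; rewrite bnd_simp ?subr_ge0.
have I3 : `]0, a[%classic `<=` `]0, 1[ by apply: subset_itv; rewrite bnd_simp.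
have I4 : `]a, 1[%classic `<=` `]0, 1[ by apply: subset_itv; rewrite bnd_simp.
have split01 f : cintegrable `]0, 1[ f ->
    cintegral `]0, 1[ f = cintegral `]0, (1 - a)[ f + cintegral `](1 - a), 1[ f.
  move=> fi; have fe := cintegrable_ext0 fi.
  have L b : 0 <= b <= 1 -> cintegral `]0, b[ f = - cintegral_from_to b 0 (ext0 f).
    move=> bI; have := @from_to_0_ext0 (fun=> 1) f b bI.
    rewrite (_ : (fun t => _ * ext0 f t) = ext0 f); last by apply/funext => t; rewrite mul1r.
    rewrite (_ : (fun t => _ * f t) = f); last by apply/funext => t; rewrite mul1r.
    by move=> ->; rewrite ?opprK.
  have L' b : 0 <= b <= 1 -> cintegral `]b, 1[ f = cintegral_from_to b 1 (ext0 f).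
    move=> bI; have := @from_to_1_ext0 (fun=> 1) f b bI.
    rewrite (_ : (fun t => _ * ext0 f t) = ext0 f); last by apply/funext => t; rewrite mul1r.
    rewrite (_ : (fun t => _ * f t) = f); last by apply/funext => t; rewrite mul1r.
    by move=> ->.
  have bI : 0 <= 1 - a <= 1 by rewrite subr_ge0 a1 gerBl a0.
  rewrite (L' 0) ?lexx ?ler01 // (L _ bI) (L' _ bI).
  by rewrite !(@from_to_primitive _ 0) ?subr_ge0 //; ring.
rewrite split01 //.
have P1 : cintegral `]0, (1 - a)[ (fun y => k y * Q y) =
   (gamma * s (1 + a) - s a) * cintegral `]a, 1[ (fun t => c t * q t) +
    (c a - gamma * c (1 + a)) * cintegral `]a, 1[ (fun t => s t * q t).
  rewrite -!cintegralZ //; [|exact: sub I4 _|exact: sub I4 _].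
  rewrite -cintegralD //; last 2 first.
  - by apply: cintegrableZ => //; exact: sub I4 _.
  - by apply: cintegrableZ => //; exact: sub I4 _.
  have fi : cintegrable `]a, 1[ (fun t => (gamma * s (1 + a) - s a) * (c t * q t) +
      (c a - gamma * c (1 + a)) * (s t * q t)).
    by apply: cintegrableD => //; apply: cintegrableZ => //; exact: sub I4 _.
  rewrite (cintegral_affine a (or_introl erefl : 1 = 1 \/ 1 = -1) (measurable_itv _) fi).
  have -> : (fun x : R => 1 * x + a) @^-1` `]a, 1[ = `]0, 1 - a[%classic.
    by apply/seteqP; split=> x /=; rewrite !in_itv /= => /andP[h1 h2]; apply/andP; split; lra.
  apply: eq_cintegral => y; rewrite inE /= in_itv /= => /andP[_ ya].
  rewrite /Q /q_shift ya mul1r mulrA mulrA -mulrDl; congr (_ * _).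
  have -> : k y = s ((y + a) - a) + gamma * s ((1 + a) - (y + a)).
    by rewrite /k addrK; congr (_ + _ * s _); ring.
  by rewrite /s !sin_div_sub /c; ring.
have P2 : cintegral `](1 - a), 1[ (fun y => k y * Q y) =
   (s a + gamma * s (1 - a)) * cintegral `]0, a[ (fun t => c t * q t) +
    (gamma * c (1 - a) - c a) * cintegral `]0, a[ (fun t => s t * q t).
  rewrite -!cintegralZ //; [|exact: sub I3 _|exact: sub I3 _].
  rewrite -cintegralD //; last 2 first.
  - by apply: cintegrableZ => //; exact: sub I3 _.
  - by apply: cintegrableZ => //; exact: sub I3 _.
  have fi : cintegrable `]0, a[ (fun t => (s a + gamma * s (1 - a)) * (c t * q t) +
      (gamma * c (1 - a) - c a) * (s t * q t)).
    by apply: cintegrableD => //; apply: cintegrableZ => //; exact: sub I3 _.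
  rewrite (cintegral_affine (a - 1) (or_introl erefl : 1 = 1 \/ 1 = -1) (measurable_itv _) fi).
  have -> : (fun x : R => 1 * x + (a - 1)) @^-1` `]0, a[ = `]1 - a, 1[%classic.
    by apply/seteqP; split=> x /=; rewrite !in_itv /= => /andP[h1 h2]; apply/andP; split; lra.
  apply: eq_cintegral => y; rewrite inE /= in_itv /= => /andP[ya _].
  rewrite /Q /q_shift ltNge (ltW ya) /= mul1r -addrA; set t := y + (a - 1).
  have -> : k y = gamma * s (a - t) + s (t - - (1 - a)).
    rewrite /k addrC; congr (gamma * s _ + s _); rewrite /t; ring.
  rewrite /s (sin_div_sub rho a t) (sin_div_sub rho t (- (1 - a))) sin_div_oppr ccos_mulN /c.
  transitivity (gamma ^+ 2 * (sin_div rho a * ccos (rho * t%:C) - ccos (rho * a%:C) * sin_div rho t) * q t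
    + gamma * (sin_div rho t * ccos (rho * (1 - a)%:C) + ccos (rho * t%:C) * sin_div rho (1 - a)) * q t); first by ring.
  by rewrite g2; ring.
by rewrite P1 P2; ring.
Qed.

Lemma char_fun_formula q a gamma lambda : 0 <= a <= 1 -> gamma = 1 \/ gamma = -1 ->
  L2 `]0, 1[ q ->
  char_fun q a gamma lambda = 2 - 2 * gamma * ccos (sqrtC lambda) -
   cintegral `]0, 1[ (fun y => sin_div (sqrtC lambda) y * w_pot gamma q a y).
Proof.
move=> aI gE qL.
rewrite (char_fun_sincos lambda aI gE (L2_cintegrable qL)) /=.
by rewrite (w_pot_integral (sqrtC lambda) aI gE qL) /= mulr1.
Qed.

End CharacteristicFunction.

(** * The characteristic function as a product over its zeros *)

Section EntireCharacteristic.
Context {R : realType}.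
Notation mu := (@lebesgue_measure R).
Notation TR := (measurableTypeR R).
Implicit Types (f w : R -> R[i]) (z rho gamma : R[i]) (r e : R).

Lemma cabs_sqrtC_le z r : cabs z <= r -> cabs (sqrtC z) <= 1 + r.
Proof.
move=> zr; have h : cabs (sqrtC z) ^+ 2 = cabs z by rewrite -cabsX sqrtCK.
have r0 := le_trans (cabs_ge0 z) zr.
have [c1|c1] := leP (cabs (sqrtC z)) 1; first by rewrite (le_trans c1) // lerDl.
rewrite (le_trans _ (_ : r <= 1 + r)) ?lerDr // (le_trans _ zr) // -h expr2.
by rewrite ler_peMl ?cabs_ge0 // ltW.
Qed.

(** Turns an Euler product into an approximation: [s] is the trigonometric function, [q] the partial
    product and [c] the remainder, and |s - q| = |q| |c - 1|. *)
Lemma cabs_near1_product (B e : R) (s c q : R[i]) :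
  0 <= e -> e <= 2^-1 -> s = q * c -> cabs s <= B -> cabs (c - 1) <= e ->
  cabs (s - q) <= 2 * B * e.
Proof.
move=> e0 e2 -> sB ce.
have c2 : 2^-1 <= cabs c.
  by have := cabs_geB 1 (1 - c); rewrite subKr cabs1 (cabs_distC 1 c); lra.
have qB : cabs q <= 2 * B.
  move: sB; rewrite cabsM => sB.
  have h : cabs q * 2^-1 <= cabs q * cabs c by rewrite ler_wpM2l ?cabs_ge0.
  lra.
rewrite -{2}(mulr1 q) -mulrBr cabsM ler_pM ?cabs_ge0 //.
Qed.

(** The partial Euler products are polynomials in rho^2 = z. The argument is doubled because
    [ccos_euler] expands the cosine of a half. *)
Lemma entire_ccos_sqrt : entire (fun z => ccos (sqrtC z)).
Proof.
move=> r e e0.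
have [C C0 CP] := euler_rem_cvg (2 * (1 + r)).
pose B := expR (1 + r).
have B0 : 0 < B := expR_gt0 _.
have m0 : 0 < Num.min (2^-1) (e / (2 * B)).
  by rewrite lt_min invr_gt0 ltr0n divr_gt0 // mulr_gt0.
have [N NP] := small_div C0 m0.
  exists (\prod_(k < N.+1) (1 - (4 / ((2 * k + 1)%:R * pi%:C) ^+ 2) *: 'X)) => z zr.
  have sr := cabs_sqrtC_le zr.
  have E := ccos_euler N (2 * sqrtC z).
  rewrite [2 * _]mulrC mulfK ?pnatr_eq0 // in E.
  have h : cabs (euler_rem (2 * N + 1) (sqrtC z * 2 / pi%:C) - 1) <= C / N.+1%:R.
    apply: (le_trans (CP _ _ _)); last first.
      rewrite ler_wpM2l // lef_pV2 ?posrE ?ltr0n // ler_nat.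
      by rewrite ltnS mul2n -addnn addn1 ltnW // ltnS leqW // leq_addr.
    rewrite cabsM cabsV cabs_real gtr0_norm ?pi_gt0 // cabsM cabs_nat.
    rewrite ler_pdivrMr ?pi_gt0 // [leLHS]mulrC -[leLHS]mulr1 ler_pM ?mulr_ge0 ?cabs_ge0 //.
      by rewrite ler_pM2l.
    by rewrite (le_trans _ (pi_ge2 R)) // ler1n.
  have := NP N (leqnn N); rewrite lt_min => /andP[h1 h2].
  apply: (@le_lt_trans _ _ (2 * B * (C / N.+1%:R))); last first.
    by rewrite mulrC -ltr_pdivlMr // mulr_gt0.
  apply: (cabs_near1_product _ (ltW h1) _ _ h).
  - by rewrite divr_ge0.
  - rewrite E horner_prod; congr (_ * _).
    apply: eq_bigr => k _; rewrite !hornerE exprMn sqrtCK.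
    by move: ((_ ^+ 2)^-1) => X; ring.
  - rewrite (le_trans (cabs_ccos_le _)) // ler_expR (le_trans (cabs_Im _)) //.
Qed.

(** One polynomial serves all [y] in [0, 1], since the product depends on [z] and [y] only through z
    y^2 apart from the leading factor [y]. This uniformity permits integration against [w]. *)
Lemma sin_div_poly_approx r e : 0 < e -> exists p : {poly R[i]},
  forall z (y : R), cabs z <= r -> 0 <= y <= 1 ->
  cabs (sin_div (sqrtC z) y - y%:C * p.[z * y%:C ^+ 2]) <= e.
Proof.
move=> e0.
have [C C0 CP] := euler_rem_cvg (2 * (1 + r)).
pose B := expR (1 + r).
have B0 : 0 < B := expR_gt0 _.
have m0 : 0 < Num.min (2^-1) (e / (2 * B)).
  by rewrite lt_min invr_gt0 ltr0n divr_gt0 // mulr_gt0.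
have [N NP] := small_div C0 m0.
  exists (\prod_(k < N) (1 - (((k.+1)%:R * pi%:C) ^+ 2)^-1 *: 'X)) => z y zr /andP[y0 y1].
  have sr := cabs_sqrtC_le zr.
  have E := sin_div_euler N (sqrtC z) y.
  have h : cabs (euler_rem (2 * N) (2 * sqrtC z * y%:C / pi%:C) - 1) <= C / N.+1%:R.
    apply: (le_trans (CP _ _ _)); last first.
      rewrite ler_wpM2l // lef_pV2 ?posrE ?ltr0n // ler_nat.
      by rewrite ltnS mul2n -addnn leqW // leq_addr.
    rewrite cabsM cabsV cabs_real gtr0_norm ?pi_gt0 // !cabsM cabs_nat.
    rewrite ler_pdivrMr ?pi_gt0 // -[leLHS]mulr1 ler_pM ?mulr_ge0 ?cabs_ge0 //.
      rewrite cabs_real ger0_norm // -[leRHS]mulr1 ler_pM ?mulr_ge0 ?cabs_ge0 //.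
      by rewrite ler_pM2l.
    by rewrite (le_trans _ (pi_ge2 R)) // ler1n.
  have := NP N (leqnn N); rewrite lt_min => /andP[h1 h2].
  apply: (@le_trans _ _ (2 * B * (C / N.+1%:R))); last first.
    by rewrite mulrC -ler_pdivlMr ?mulr_gt0 // ltW.
  apply: (cabs_near1_product _ (ltW h1) _ _ h).
  - by rewrite divr_ge0.
  - rewrite E [LHS]mulrA horner_prod; congr (_ * _ * _).
    apply: eq_bigr => k _; rewrite sqrtCK; move: (z * y%:C ^+ 2) => v; rewrite !hornerE.
    by move: ((_ ^+ 2)^-1) => X; ring.
  - rewrite (le_trans (cabs_sin_div_le _ _)) // ger0_norm // -[leRHS]mul1r.
    rewrite ler_pM ?expR_ge0 // ler_expR (le_trans _ sr) // ler_piMr ?cabs_ge0 //.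
Qed.

Lemma is_cderive_pow n (x : R) : is_cderive (fun t => t%:C ^+ n) x (n%:R * x%:C ^+ n.-1).
Proof.
elim: n => [|n IH].
  by rewrite mul0r (_ : (fun t => _) = fun=> 1); [exact: is_cderive_cst|apply/funext => t; rewrite expr0].
have := is_cderiveM (is_cderive_real (is_derive_id x (1 : R))) IH.
rewrite (_ : (fun t => _) = (fun t => t%:C ^+ n.+1)); last by apply/funext => t; rewrite exprS.
move/is_cderive_eq; apply; rewrite /= -natr1 rmorph1.
by case: n {IH} => [|n] /=; rewrite ?expr0 ?exprS; ring.
Qed.

Lemma pow_integrable01 n w : cintegrable `]0, 1[ w ->
  cintegrable `]0, 1[ (fun y => y%:C ^+ n * w y).
Proof.
have [k1 k2] := is_cderive_measurable `]0, 1[ (is_cderive_pow n).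
apply: (cintegrable_mul (B := 1)) => // t; rewrite /= in_itv /= => /andP[t0 t1].
by rewrite cabsX cabs_real gtr0_norm // exprn_ile1 // ltW.
Qed.

Lemma entire_sin_integral w : cintegrable `]0, 1[ w ->
  entire (fun z => cintegral `]0, 1[ (fun y => sin_div (sqrtC z) y * w y)).
Proof.
move=> wi r e e0.
have m01 : measurable (`]0, 1[%classic : set TR) by exact: measurable_itv.
pose L := 2 * (L1norm `]0, 1[ w + 1).
have L0 : 0 < L by rewrite mulr_gt0 // ltr_wpDl ?L1norm_ge0.
have [p pP] := sin_div_poly_approx r (divr_gt0 e0 L0).
(* Integrating y p(z y^2) against [w] gives a polynomial in [z] whose coefficients are those of [p]
   times the odd moments of [w]. *)
pose m i := cintegral `]0, 1[ (fun y => y%:C ^+ (2 * i + 1) * w y).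
exists (\poly_(i < size p) (p`_i * m i)) => z zr.
have Fi i := cintegrableZ (p`_i * z ^+ i) m01 (pow_integrable01 (2 * i + 1) wi).
have [si sE] := cintegral_sum (size p) m01 Fi.
have E : (\poly_(i < size p) (p`_i * m i)).[z] =
    cintegral `]0, 1[ (fun y => y%:C * p.[z * y%:C ^+ 2] * w y).
  rewrite horner_poly.
  transitivity (\sum_(i < size p) cintegral `]0, 1[ (fun y => p`_i * z ^+ i * (y%:C ^+ (2 * i + 1) * w y))).
    apply: eq_bigr => i _; rewrite cintegralZ //; last exact: pow_integrable01.
    by rewrite /m; ring.
  rewrite -sE; apply: eq_cintegral => y _.
  rewrite horner_coef mulr_sumr mulr_suml; apply: eq_bigr => i _.
  by rewrite exprMn -exprM exprD expr1; ring.
have pi : cintegrable `]0, 1[ (fun y => y%:C * p.[z * y%:C ^+ 2] * w y).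
  apply: eq_cintegrable si => // y _.
  rewrite horner_coef mulr_sumr mulr_suml; apply: eq_bigr => i _.
  by rewrite exprMn -exprM exprD expr1; ring.
have swi := sin_div_integrable01 (sqrtC z) wi.
rewrite E -cintegralB //.
have di := cintegrableB m01 swi pi.
apply: (le_lt_trans (cabs_cintegral_le m01 di)).
apply: (@le_lt_trans _ _ (2 * (e / L) * L1norm `]0, 1[ w)); last first.
  rewrite (_ : 2 * (e / L) * _ = e * (2 * L1norm `]0, 1[ w / L)); last by ring.
  by rewrite -[ltRHS]mulr1 ltr_pM2l // ltr_pdivrMr // mul1r /L ltr_pM2l // ltrDl.
rewrite /L1norm -RintegralZl //; last exact: integrable_L1norm.
apply: le_Rintegral => //; first exact: integrable_L1norm.
  by apply: eq_integrable (integrableZl m01 (2 * (e / L)) (integrable_L1norm m01 wi)).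
move=> y; rewrite /= in_itv /= => /andP[y0 y1].
rewrite -mulrBl.
have h : cabs ((sin_div (sqrtC z) y - y%:C * p.[z * y%:C ^+ 2]) * w y) <=
    e / L * (`|Re (w y)| + `|Im (w y)|).
  by rewrite cabsM ler_pM ?cabs_ge0 ?cabs_le_ReIm // pP // (ltW y0) (ltW y1).
rewrite -mulrA mulr_natl mulr2n lerD // (le_trans _ h) // ?cabs_Re ?cabs_Im //.
Qed.

End EntireCharacteristic.

(** * Removing finitely many zeros with their multiplicities *)

Section ZeroFactorization.
Context {R : realType}.
Implicit Types (z w : R[i]) (F G : R[i] -> R[i]).

Lemma near_cabs z (P : R[i] -> Prop) : (\forall w \near (z : R[i]^o), P w) ->
  exists2 d : R, 0 < d & forall w, cabs (w - z) < d -> P w.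
Proof.
move=> /nbhs_normP[e /= e0 eP].
have [x xe] : exists x, e = x%:C by apply/complex_realP; rewrite gtr0_real.
exists x; first by move: e0; rewrite xe ltcR.
by move=> w wz; apply: eP; rewrite /ball_ /= normE xe ltcR cabs_distC.
Qed.

Lemma continuous_bounded_near (g : R[i]^o -> R[i]^o) z : derivable g z 1 ->
  exists2 d : R, 0 < d & forall w, cabs (w - z) < d -> cabs (g w) <= cabs (g z) + 1.
Proof.
move=> /derivable1_diffP/differentiable_continuous gc.
have : \forall w \near (z : R[i]^o), `|g z - g w| < 1.
  by have /cvgrPdist_lt := gc; apply.
move=> /near_cabs[d d0 dP]; exists d => // w /dP.
rewrite normE (_ : 1 = (1 : R)%:C) // ltcR => h.
have -> : g w = g z - (g z - g w) by rewrite opprB addrC subrK.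
by rewrite (le_trans (cabs_leB _ _)) // lerD2l ltW.
Qed.

Lemma card_level_set (lam : nat -> R[i]) z m N : ([set n | lam n = z] #= `I_m)%card ->
  lam N = z -> (count (fun n => lam n == z) (iota 0 N) < m)%N.
Proof.
move=> Am Nz; pose s := [seq n <- iota 0 N.+1 | lam n == z].
have us : uniq s by rewrite filter_uniq // iota_uniq.
have -> : (count (fun n => lam n == z) (iota 0 N)).+1 = size s.
  by rewrite size_filter -addn1 -[N.+1]addn1 iotaD count_cat /= add0n Nz eqxx.
rewrite -(@card_le_II (size s) m) -(card_le_eqr Am).
have inj : {in `I_(size s) &, injective (fun k => nth 0%N s k)}.
  move=> i j; rewrite !inE /= => hi hj /eqP; rewrite nth_uniq // => /eqP.
  exact.
rewrite -(card_le_eql (inj_card_eq inj)); apply: subset_card_le => _ [k /= ks <-].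
by have := mem_nth 0%N ks; rewrite mem_filter => /andP[/eqP].
Qed.

(** Zeros are divided out one at a time, so the quotient [G] must vanish at the next one, z0. Fewer
    than [m] earlier indices carry the value z0, where [m] is its order. If [G] did not vanish
    there, cancelling those factors would leave a function nonzero at z0 equal to a positive power
    of [w - z0] times the locally bounded [g]. *)
Lemma zero_factorization F (lam : nat -> R[i]) : entire F ->
  (forall z, exists m, zero_order F z m /\ ([set n | lam n = z] #= `I_m)%card) ->
  forall N, exists G, entire G /\ forall z, F z = \prod_(n < N) (z - lam n) * G z.
Proof.
move=> Fe Fz; elim=> [|N [G [Ge GE]]].
  by exists F; split=> // z; rewrite big_ord0 mul1r.
suff G0 : G (lam N) = 0.
  have [h [he hE]] := entire_div Ge G0.
  by exists h; split=> // z; rewrite GE hE big_ord_recr /= mulrA.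
apply/eqP/negPn/negP => Gn0.
set z0 := lam N in Gn0.
have [m [[g [gd gz gF]] cm]] := Fz z0.
have jm := card_level_set cm (erefl : lam N = z0).
set j := count _ _ in jm.
pose A w := \prod_(n < N | lam n != z0) (w - lam n).
have PA w : \prod_(n < N) (w - lam n) = (w - z0) ^+ j * A w.
  rewrite (bigID (fun n : 'I_N => lam n == z0)) /=; congr (_ * _).
  rewrite (eq_bigr (fun=> w - z0)); last by move=> i /eqP->.
  rewrite prodr_const; congr (_ ^+ _).
  rewrite /j -[iota 0 N]val_enum_ord count_map -sum1_count big_enum_cond -sum1_card.
  by apply: eq_bigl => i.
have Ae : entire A.
  have -> : A = fun w => \prod_(n < N) (if lam n != z0 then w - lam n else 1).
    by apply/funext => w; rewrite /A big_mkcond.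
  move=> r; apply: disc_approx_prod => i; case: (lam i != z0); last exact: disc_approx_cst.
  apply: disc_approx_ext (@disc_approx_poly _ r ('X - (lam i)%:P)) => w _.
  by rewrite !hornerE.
have Az : A z0 != 0.
  by apply/prodf_neq0 => i h; rewrite subr_eq0 eq_sym.
pose h w := A w * G w.
have hz : 0 < cabs (h z0) by rewrite cabs_gt0 mulf_neq0.
have he : disc_approx (cabs z0 + 1) h by apply: disc_approxM; [exact: Ae|exact: Ge].
have h2 : 0 < cabs (h z0) / 2 by rewrite divr_gt0.
have z01 : cabs z0 < cabs z0 + 1 by rewrite ltrDl.
have [d1 d10 d1P] := disc_approx_continuous he z01 h2.
have [d2 d20 d2P] := near_cabs gF.
have gd0 : derivable g z0 1 by exact: nbhs_singleton gd.
have [d3 d30 d3P] := continuous_bounded_near gd0.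
pose B := cabs (g z0) + 1.
have B0 : 0 < B by rewrite ltr_wpDl ?cabs_ge0.
pose d4 := cabs (h z0) / 2 / B.
have d40 : 0 < d4 by rewrite divr_gt0.
(* A single test point at distance [t] suffices: within [d1] the left side keeps more than half its
   modulus, within [d2] and [d3] the factorization and the bound on [g] hold, and [t < d4] makes the
   right side smaller than that half. *)
pose t := Num.min (Num.min d1 d2) (Num.min (Num.min d3 d4) 1) / 2.
have t0 : 0 < t by rewrite divr_gt0 // !lt_min d10 d20 d30 d40 ltr01.
have [t1 t2 t3 t4 t5] : [/\ t < d1, t < d2, t < d3, t < d4 & t < 1].
  have : t < t *+ 2 by rewrite mulr2n ltrDl.
  rewrite {2}/t -[ltRHS]mulr_natr divfK ?pnatr_eq0 // !lt_min.
  by move=> /andP[/andP[-> ->] /andP[/andP[-> ->] ->]].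
pose w := z0 + t%:C.
have wz : w - z0 = t%:C by rewrite /w addrC addKr.
have cw : cabs (w - z0) = t by rewrite wz cabs_real gtr0_norm.
have E : h w = (w - z0) ^+ (m - j) * g w.
  have wn0 : (w - z0) ^+ j != 0.
    by rewrite expf_neq0 // -cabs_gt0 cw.
  apply: (mulfI wn0); rewrite [RHS]mulrA -exprD subnKC ?(ltnW jm) //.
  by rewrite -d2P ?cw // GE PA mulrA.
have : cabs (h w) <= t * B.
  rewrite E cabsM cabsX cw ler_pM ?exprn_ge0 ?cabs_ge0 ?(ltW t0) //.
    by rewrite -[leRHS]expr1 ler_wiXn2l ?(ltW t0) ?(ltW t5) // subn_gt0.
  by rewrite d3P ?cw.
have : cabs (h w - h z0) < cabs (h z0) / 2 by rewrite d1P ?cw.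
have : t * B < cabs (h z0) / 2 by rewrite -ltr_pdivlMr.
have := cabs_geB (h z0) (h z0 - h w); rewrite subKr (cabs_distC (h z0)).
clear; move: (cabs (h w)) (cabs (h w - h z0)) (cabs (h z0)) (t * B) => a b c d; lra.
Qed.

End ZeroFactorization.

(** A termwise substitute for the Cauchy-Schwarz inequality: after summation the squares of [x] and
    the inverse squares of [j] are bounded separately. *)
Lemma amgm_div (R : realType) (x k j : R) : 0 < k -> 0 < j ->
  x / (2 * k * j) <= (x ^+ 2 + (j ^+ 2)^-1) / k.
Proof.
move=> k0 j0; have -> : x / (2 * k * j) = x * j^-1 / 2 / k by field; rewrite !gt_eqF.
rewrite ler_pM2r ?invr_gt0 // -exprVn; move: (j^-1) => y.
rewrite -subr_ge0 (_ : _ - _ = ((x - y) ^+ 2 + 3 * x ^+ 2 + 3 * y ^+ 2) / 4); last by field.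
apply: divr_ge0 => //; apply: addr_ge0; [apply: addr_ge0; [exact: sqr_ge0|]|]; by apply: mulr_ge0 => //; exact: sqr_ge0.
Qed.

(** * Products of numbers close to 1 *)

Section NearOne.
Context {R : realType}.
Implicit Types (x y z : R[i]) (a b s : R).

Lemma near1_mul x y a b : cabs (x - 1) <= a -> cabs (y - 1) <= b -> b <= 1 ->
  cabs (x * y - 1) <= 2 * a + b.
Proof.
move=> xa yb b1.
have -> : x * y - 1 = (x - 1) * y + (y - 1) by ring.
rewrite (le_trans (cabs_leD _ _)) // lerD // cabsM mulrC.
rewrite ler_pM ?cabs_ge0 // -(subrK 1 y) (le_trans (cabs_leD _ _)) // cabs1.
by rewrite lerD // (le_trans yb).
Qed.

Lemma near1_ge x a : cabs (x - 1) <= a -> 1 - a <= cabs x.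
Proof.
move=> xa; have := cabs_geB 1 (1 - x); rewrite subKr cabs1 (cabs_distC 1).
by apply: le_trans; rewrite lerD2l lerN2.
Qed.

Lemma near1_inv x a : cabs (x - 1) <= a -> a <= 2^-1 -> cabs (x^-1 - 1) <= 2 * a.
Proof.
move=> xa a2; have x2 : 2^-1 <= cabs x by rewrite (le_trans _ (near1_ge xa)) //; lra.
have x0 : x != 0 by rewrite -cabs_gt0 (lt_le_trans _ x2) // invr_gt0 ltr0n.
have -> : x^-1 - 1 = (1 - x) / x by rewrite mulrBl divff // mul1r.
rewrite cabsM cabsV cabs_distC ler_pdivrMr ?cabs_gt0 // (le_trans xa) //.
have a0 := le_trans (cabs_ge0 _) xa.
have := ler_wpM2l a0 x2; lra.
Qed.

Lemma expR_sub1_le s : 0 <= s -> s <= 2^-1 -> expR s - 1 <= 2 * s.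
Proof.
move=> s0 s2; have := expR_ge1Dx (- s); have e0 := expR_gt0 s.
have e1 : expR s * expR (- s) = 1 := expRxMexpNx_1 s.
move=> h; have : expR s * (1 - s) <= 1 by rewrite -[leRHS]e1 ler_pM2l.
move=> h2; have h3 : expR s <= 1 / (1 - s) by rewrite ler_pdivlMr //; lra.
have : 1 / (1 - s) <= 1 + 2 * s.
  rewrite ler_pdivrMr; last lra.
  have := mulr_ge0 s0 s0; have := ler_wpM2l s0 s2; lra.
lra.
Qed.

(** Induction bounds the deviation by exp (sum of |u i|) - 1, and exp s - 1 <= 2 s for s up to
    1/2. *)
Lemma prod_near1 (I : Type) (r : seq I) (u : I -> R[i]) s :
  \sum_(i <- r) cabs (u i) <= s -> s <= 2^-1 ->
  cabs (\prod_(i <- r) (1 + u i) - 1) <= 2 * s.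
Proof.
move=> us s2.
have S0 : 0 <= \sum_(i <- r) cabs (u i) by apply: sumr_ge0 => i _; exact: cabs_ge0.
apply: (@le_trans _ _ (expR (\sum_(i <- r) cabs (u i)) - 1)); last first.
  rewrite (le_trans (expR_sub1_le S0 (le_trans us s2))) // ler_pM2l //.
elim: r {us S0} => [|i r IH]; first by rewrite !big_nil expR0 !subrr cabs0.
rewrite !big_cons expRD.
set P := \prod_(j <- r) _ in IH *; set S := expR _ in IH *.
have -> : (1 + u i) * P - 1 = (P - 1) * (1 + u i) + u i by ring.
rewrite (le_trans (cabs_leD _ _)) // cabsM.
have h1 : cabs (1 + u i) <= 1 + cabs (u i) by rewrite (le_trans (cabs_leD _ _)) // cabs1.
have S1 : 0 <= S by exact: expR_ge0.
have h2 : cabs (P - 1) * cabs (1 + u i) <= (S - 1) * (1 + cabs (u i)).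
  by rewrite ler_pM ?cabs_ge0.
have h3 : (1 + cabs (u i)) * S <= expR (cabs (u i)) * S.
  by rewrite ler_wpM2r // expR_ge1Dx.
rewrite (le_trans (lerD h2 (lexx _))) // (le_trans _ (lerD h3 (lexx _))) //.
by rewrite le_eqVlt; apply/orP; left; apply/eqP; ring.
Qed.

(** Telescoping: 1 / (k + 1)^2 <= 1 / k - 1 / (k + 1). *)
Lemma sum_inv_sqr_tail (K M : nat) : (0 < K)%N ->
  \sum_(K <= k < M) (k.+1%:R ^+ 2)^-1 <= (K%:R : R)^-1.
Proof.
move=> K0; have K0' : 0 < K%:R :> R by rewrite ltr0n.
have [KM|MK] := leqP K M; last by rewrite big_geq ?invr_ge0 ?ltW // ltnW.
apply: (@le_trans _ _ (K%:R^-1 - M%:R^-1)); last by rewrite gerBl invr_ge0.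
elim: M KM => [|M IH]; first by rewrite leqn0 => /eqP K00; rewrite K00 in K0.
rewrite leq_eqVlt => /predU1P[<-|KM]; first by rewrite big_geq // subrr.
rewrite big_nat_recr //= (le_trans (lerD (IH KM) (lexx _))) //.
have M0 : 0 < M%:R :> R by rewrite ltr0n (leq_trans K0).
rewrite -addrA lerD2l -(natr1 M).
have M1 : 0 < M%:R + 1 :> R by rewrite addr_gt0.
rewrite addrC -subr_ge0.
have -> : - (M%:R + 1)^-1 - (((M%:R + 1) ^+ 2)^-1 - M%:R^-1) =
  (M%:R * (M%:R + 1) ^+ 2)^-1 :> R.
  by field; rewrite !gt_eqF.
by rewrite invr_ge0 mulr_ge0 ?sqr_ge0 ?ltW.
Qed.

Lemma sum_inv_sqr_le2 (K : nat) : \sum_(k < K) (k.+1%:R ^+ 2)^-1 <= 2 :> R.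
Proof.
case: K => [|K]; first by rewrite big_ord0.
rewrite big_ord_recl expr1n invr1 (_ : 2 = 1 + 1 :> R) // lerD2l.
have := @sum_inv_sqr_tail 1 K.+1 isT; rewrite invr1 big_add1 /= big_mkord.
by [].
Qed.

End NearOne.

(** * Comparison with the free product on large circles *)

Section HadamardCore.
Context {R : realType}.
Variable dl : nat.
Hypothesis dl0 : (0 < dl)%N.
Implicit Types (z : R[i]) (K M k : nat).

(** With [dl = 1] for gamma = -1 and [dl = 2] for gamma = 1 these are the nonzero double zeros of
    the free function. The square root of the K-th circle radius, for K > 0, is midway between the
    square roots of nodes K - 1 and K, where the cosine equals -gamma. *)
Definition node k : R := ((2 * k + dl)%:R * pi) ^+ 2.
Definition circle_radius K : R := ((2 * K + dl).-1%:R * pi) ^+ 2.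

Lemma node_ge k : (k.+1%:R ^+ 2 : R) <= node k.
Proof.
rewrite /node lerXn2r ?nnegrE ?mulr_ge0 ?pi_ge0 //.
rewrite -[leLHS]mulr1 ler_pM ?ler_nat //.
  by rewrite -addn1 leq_add // leq_pmull.
by rewrite (le_trans _ (pi_ge2 R)) // ler1n.
Qed.

Lemma node_gt0 k : 0 < node k.
Proof. by rewrite (lt_le_trans _ (node_ge k)) // exprn_gt0 // ltr0n. Qed.

Lemma nodeC_neq0 k : (node k)%:C != 0.
Proof. by rewrite -cabs_gt0 cabs_real normr_gt0 gt_eqF // node_gt0. Qed.

Lemma circle_radius_lt_node K k : (K <= k)%N -> circle_radius K < node k.
Proof.
move=> Kk; rewrite /circle_radius /node ltrXn2r ?nnegrE ?mulr_ge0 ?pi_ge0 //.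
rewrite ltr_pM2r ?pi_gt0 // ltr_nat.
rewrite (@leq_trans (2 * K + dl)) ?leq_add2r ?leq_mul2l //.
by rewrite prednK // addn_gt0 dl0 orbT.
Qed.

(** Difference of squares: the sum of the roots is at least 2K, their difference at least K - k. The
    first factor yields the decay in [K], the second a summable series. *)
Lemma circle_radius_sub_node K k : (k < K)%N ->
  2 * K%:R * (K - k)%:R <= circle_radius K - node k.
Proof.
move=> kK; rewrite /circle_radius /node subr_sqr -mulrBl -mulrDl.
have pi1 : 1 <= pi :> R by rewrite (le_trans _ (pi_ge2 R)) // ler1n.
have h1 : (K - k)%:R <= ((2 * K + dl).-1%:R - (2 * k + dl)%:R) * pi :> R.
  rewrite -natrB; last by rewrite -ltnS prednK ?addn_gt0 ?dl0 ?orbT // ltn_add2r ltn_mul2l.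
  rewrite -[leLHS]mulr1 ler_pM // ler_nat.
  by lia.
have h2 : 2 * K%:R <= ((2 * K + dl).-1%:R + (2 * k + dl)%:R) * pi :> R.
  rewrite -natrD -[2]/(2%:R) -natrM -[leLHS]mulr1 ler_pM // ler_nat.
  by lia.
by rewrite mulrC ler_pM.
Qed.

Lemma circle_radius_ge K : (0 < K)%N -> K%:R <= circle_radius K.
Proof.
move=> K0; have pi1 : 1 <= pi :> R by rewrite (le_trans _ (pi_ge2 R)) // ler1n.
have h : K%:R <= (2 * K + dl).-1%:R * pi :> R.
  rewrite -[leLHS]mulr1 ler_pM // ler_nat; lia.
rewrite /circle_radius expr2 (le_trans h) // ler_peMl ?mulr_ge0 ?pi_ge0 //.
by rewrite (le_trans _ h) // ler1n.
Qed.

Variables (F F0 pre pre0 : R[i] -> R[i]) (E : nat -> R[i] -> R[i]).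
Variables (b : nat -> R[i]) (S A : R).

(** Of the two zeros at a node, one stays fixed, as the odd-numbered eigenvalues do, and the other
    moves to [b k]. [pre] and [pre0] hold what belongs to no node: the constant 4, or the factors
    [z - lam 0] and [z]. *)
Definition partial_prod K z : R[i] :=
  pre z * \prod_(k < K) ((1 - z / (node k)%:C) * ((b k - z) / (node k)%:C)).
Definition partial_prod0 K z : R[i] :=
  pre0 z * \prod_(k < K) (1 - z / (node k)%:C) ^+ 2.

Hypothesis S0 : 0 <= S.
Hypothesis A0 : 0 <= A.
Hypothesis bS : forall K, \sum_(k < K) cabs (b k - (node k)%:C) ^+ 2 <= S.
Hypothesis F_factor : forall K, exists G, entire G /\ forall z, F z = partial_prod K z * G z.
Hypothesis F_circle : forall K z, (0 < K)%N -> cabs z = circle_radius K ->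
  F0 z != 0 /\ cabs (F z - F0 z) <= A / K%:R * cabs (F0 z).
Hypothesis F0_prod : forall M z, (0 < M)%N -> F0 z = partial_prod0 M z * E M z.
Hypothesis E_cvg : forall r e : R, 0 < e -> exists N, forall M z, (N <= M)%N ->
  cabs z <= r -> cabs (E M z - 1) <= e.
Hypothesis pre_circle : forall K z, (0 < K)%N -> cabs z = circle_radius K ->
  cabs (pre z - pre0 z) <= A / K%:R * cabs (pre0 z).

(** The distance to the circle is at least 2K(K - k), so [amgm_div] splits the sum into the
    square-summable shifts, at most [S], and the series of inverse squares, at most 2, each divided
    by [K]. *)
Lemma node_ratio_circle K z : (0 < K)%N -> cabs z = circle_radius K ->
  \sum_(k < K) cabs ((b k - (node k)%:C) / ((node k)%:C - z)) <= (S + 2) / K%:R.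
Proof.
move=> K0 zK; have K0' : 0 < K%:R :> R by rewrite ltr0n.
apply: (@le_trans _ _ (\sum_(k < K) (cabs (b k - (node k)%:C) ^+ 2 + ((K - k)%:R ^+ 2)^-1) / K%:R)).
  apply: ler_sum => k _; rewrite cabsM cabsV.
  set x := cabs (b k - _); have x0 : 0 <= x := cabs_ge0 _.
  have j0 : 0 < (K - k)%:R :> R by rewrite ltr0n subn_gt0.
  have h : 2 * K%:R * (K - k)%:R <= cabs ((node k)%:C - z).
    rewrite cabs_distC (le_trans (circle_radius_sub_node (ltn_ord k))) //.
    rewrite -zK -[in leLHS](gtr0_norm (node_gt0 k)) -(cabs_real (node k)).
    exact: cabs_geB.
  have p0 : 0 < 2 * K%:R * (K - k)%:R :> R by rewrite !mulr_gt0.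
  apply: (@le_trans _ _ (x / (2 * K%:R * (K - k)%:R))).
    by rewrite ler_wpM2l // lef_pV2 ?posrE // (lt_le_trans p0).
  exact: amgm_div.
rewrite -mulr_suml ler_pM2r ?invr_gt0 // big_split lerD ?bS //.
(* Reversing the order of summation turns [K - k] into [k.+1]. *)
rewrite (reindex_inj rev_ord_inj) /=.
under eq_bigr => k _ do rewrite subKn //.
exact: sum_inv_sqr_le2.
Qed.

Definition tail_prod K M z : R[i] := \prod_(K <= k < M) (1 - z / (node k)%:C) ^+ 2.

Lemma partial_prod0_split K M z : (K <= M)%N ->
  partial_prod0 M z = partial_prod0 K z * tail_prod K M z.
Proof.
move=> KM; rewrite /partial_prod0 /tail_prod -mulrA; congr (_ * _).
by rewrite -!(big_mkord xpredT (fun k => (1 - z / (node k)%:C) ^+ 2)) -big_cat_nat.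
Qed.

(** The ratio to the free product is a ratio of leading factors times the product of 1 + (b k - node
    k) / (node k - z), both controlled on the circle. *)
Lemma partial_prod_circle K z t : (0 < K)%N -> cabs z = circle_radius K ->
  A / K%:R <= t -> (S + 2) / K%:R <= t -> t <= 2^-1 ->
  exists2 y, partial_prod K z = partial_prod0 K z * y & cabs (y - 1) <= 4 * t.
Proof.
move=> K0 zK At St t2.
have [F0n _] := F_circle K0 zK.
have pre0n : pre0 z != 0.
  by move: F0n; rewrite (F0_prod z K0) /partial_prod0 !mulf_eq0 !negb_or => /andP[/andP[]].
have ezn (k : 'I_K) : (node k)%:C - z != 0.
  rewrite subr_eq0; apply/eqP => e.
  have := circle_radius_sub_node (ltn_ord k); rewrite -zK -e cabs_real gtr0_norm ?node_gt0 //.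
  by rewrite subrr leNgt !mulr_gt0 // ltr0n // subn_gt0.
pose u (k : 'I_K) := (b k - (node k)%:C) / ((node k)%:C - z).
exists ((1 + (pre z - pre0 z) / pre0 z) * \prod_(k < K) (1 + u k)).
  rewrite /partial_prod /partial_prod0 mulrACA -big_split /=; congr (_ * _).
    by rewrite mulrDr mulr1 mulrC divfK // addrC subrK.
  apply: eq_bigr => k _; rewrite /u.
  move: ((node k)%:C) (nodeC_neq0 k) (ezn k) => e e0 ez.
  by field; rewrite e0 ez.
have h1 : cabs ((1 + (pre z - pre0 z) / pre0 z) - 1) <= t.
  rewrite addrC addKr cabsM cabsV ler_pdivrMr ?cabs_gt0 //.
  by rewrite (le_trans (pre_circle K0 zK)) // ler_wpM2r ?cabs_ge0.
have h2 : cabs (\prod_(k < K) (1 + u k) - 1) <= 2 * t.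
  by apply: prod_near1 => //; apply: le_trans St; exact: node_ratio_circle.
have -> : 4 * t = 2 * t + 2 * t by ring.
by apply: near1_mul => //; lra.
Qed.

Lemma tail_prod_near1 K M z : (0 < K)%N -> cabs z / K%:R <= 4^-1 ->
  cabs (tail_prod K M z - 1) <= 6 * (cabs z / K%:R).
Proof.
move=> K0 zK; rewrite /tail_prod big_split /=.
have h : cabs (\prod_(K <= k < M) (1 - z / (node k)%:C) - 1) <= 2 * (cabs z / K%:R).
  apply: prod_near1; last by apply: (le_trans zK); lra.
  apply: (@le_trans _ _ (\sum_(K <= k < M) cabs z * (k.+1%:R ^+ 2)^-1)).
    apply: ler_sum => k _; rewrite cabsN cabsM cabsV cabs_real gtr0_norm ?node_gt0 //.
    by rewrite ler_wpM2l ?cabs_ge0 // lef_pV2 ?node_ge // posrE ?node_gt0 // exprn_gt0.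
  by rewrite -mulr_sumr ler_wpM2l ?cabs_ge0 // sum_inv_sqr_tail.
have -> : 6 * (cabs z / K%:R) = 2 * (2 * (cabs z / K%:R)) + 2 * (cabs z / K%:R) by ring.
by apply: near1_mul => //; lra.
Qed.

(** [F] divided by its first [K] pairs of factors is compared with the free tail. That tail has its
    zeros outside the circle, so [H] is approximable on the disc. On the circle [H] is the product
    of F / F0, the Euler remainder and the inverse ratio of partial products, all near 1; the weak
    maximum principle moves this inside. *)
Lemma remainder_near1 K z t : (0 < K)%N -> cabs z <= circle_radius K / 2 ->
  A / K%:R <= t -> (S + 2) / K%:R <= t -> 0 < t -> t <= 8^-1 ->
  exists M H, F z = partial_prod K z * (tail_prod K M z * H) /\ cabs (H - 1) <= 28 * t.
Proof.
move=> K0 zr At St t0 t8.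
have rad0 : 0 < circle_radius K by rewrite (lt_le_trans _ (circle_radius_ge K0)) // ltr0n.
have [G [Ge GF]] := F_factor K.
(* [M] is chosen after [K], so that the Euler remainder is within [t] of 1 on the whole disc bounded
   by the K-th circle. *)
have [N NE] := E_cvg (circle_radius K) t0.
pose M := maxn N K.
have KM : (K <= M)%N by rewrite leq_maxr.
have M0 : (0 < M)%N by exact: leq_trans KM.
have tn0 v : cabs v <= circle_radius K -> tail_prod K M v != 0.
  move=> vr; rewrite /tail_prod prodf_seq_neq0; apply/allP => k.
  rewrite mem_index_iota => /andP[Kk _]; rewrite implyTb expf_neq0 //.
  rewrite subr_eq0 eq_sym; apply/eqP => e.
  have := circle_radius_lt_node Kk; rewrite ltNge; apply/negP/negPn.
  have -> : node k = cabs v.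
    by rewrite -[v](divfK (nodeC_neq0 k)) e mul1r cabs_real gtr0_norm ?node_gt0.
  exact: vr.
pose H v := G v * (tail_prod K M v)^-1.
exists M, (H z); split.
  rewrite GF /H; congr (_ * _); rewrite mulrCA mulfV ?mulr1 // tn0 //.
  by rewrite (le_trans zr) // ler_pdivrMr // ler_peMr ?ler1n // ltW.
have He : disc_approx (circle_radius K) H.
  apply: disc_approxM; first exact: Ge.
  apply: (@disc_approx_ext _ _ (fun v => \prod_(k <- index_iota K M)
    (if (K <= k)%N then ((node k)%:C * ((node k)%:C - v)^-1) ^+ 2 else 1))).
    move=> v vr; rewrite /tail_prod -prodfV big_seq [RHS]big_seq.
    apply: eq_bigr => k; rewrite mem_index_iota => /andP[Kk _]; rewrite Kk.
    rewrite -exprVn; congr (_ ^+ _).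
    rewrite -[1 in RHS](divff (nodeC_neq0 k)) -mulrBl invfM invrK mulrC //.
  apply: disc_approx_prod => k; case: leqP => Kk; last exact: disc_approx_cst.
  have h : disc_approx (circle_radius K) (fun v => (node k)%:C * ((node k)%:C - v)^-1).
    apply: disc_approxM; first exact: disc_approx_cst.
    apply: disc_approx_inv_sub; first exact: ltW.
    by rewrite cabs_real gtr0_norm ?node_gt0 // circle_radius_lt_node.
  by apply: disc_approx_ext (disc_approxM h h) => v _; rewrite expr2.
(* On the circle the three factors deviate by [t], [t] and, after inversion, 8t, which combine to
   2(2t + t) + 8t = 14t. *)
have -> : 28 * t = 2 * (14 * t) by ring.
apply: (disc_approx_weak_max (f := fun v => H v - 1) (r := circle_radius K)) => //.
  by apply: disc_approxD => //; exact: disc_approx_cst.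
move=> v vr.
have [F0n Fc] := F_circle K0 vr.
have [|y Py y1] := partial_prod_circle K0 vr At St; first lra.
have vle : cabs v <= circle_radius K by rewrite vr.
have E1 := NE M v (leq_maxl _ _) vle.
pose x := F v / F0 v.
have x1 : cabs (x - 1) <= t.
  have -> : x - 1 = (F v - F0 v) / F0 v by rewrite mulrBl divff.
  rewrite cabsM cabsV ler_pdivrMr ?cabs_gt0 // (le_trans Fc) //.
  by rewrite ler_wpM2r ?cabs_ge0.
have F0E : F0 v = partial_prod0 K v * tail_prod K M v * E M v.
  by rewrite (F0_prod v M0) (partial_prod0_split v KM).
have yn0 : y != 0 by rewrite -cabs_gt0 (lt_le_trans _ (near1_ge y1)) //; lra.
have HE : H v = x * E M v * y^-1.
  have p0 : partial_prod0 K v != 0 by apply: contraNneq F0n => h; rewrite F0E h !mul0r.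
  have e0 : E M v != 0 by apply: contraNneq F0n => h; rewrite F0E h mulr0.
  rewrite /H /x (GF v) Py F0E.
  move: (partial_prod0 K v) (tail_prod K M v) (E M v) p0 (tn0 v vle) e0 => p q c p0 q0 c0.
  by field; rewrite p0 q0 c0 yn0.
rewrite HE; have -> : 14 * t = 2 * (2 * t + t) + 2 * (4 * t) by ring.
apply: near1_mul; [apply: near1_mul => //; lra|apply: near1_inv => //; lra|lra].
Qed.

(** At a fixed point both the tail and [H] tend to 1, so F z = P h with [h] near 1. Then |P| <= 2 |F
    z|, which bounds the partial product by a number independent of [K], and |P - F z| = |P| |1 -
    h|. *)
Theorem hadamard_core z (e : R) : 0 < e ->
  exists N, forall K, (N <= K)%N -> cabs (partial_prod K z - F z) < e.
Proof.
move=> e0; pose c := A + (S + 2).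
have c0 : 0 < c by rewrite ltr_wpDl // ltr_wpDl.
pose D := 12 * cabs z + 56 * c.
have D0 : 0 < D by rewrite ltr_wpDl ?mulr_ge0 ?cabs_ge0 // mulr_gt0.
pose f := cabs (F z).
have f0 : 0 <= f := cabs_ge0 _.
(* One summand for each requirement: D / K <= 1/2, final error below [e], and [z] within half the
   circle radius. *)
pose B := 2 * D + 2 * f * D / e + 2 * cabs z.
have B0 : 0 <= B.
  by rewrite !addr_ge0 ?divr_ge0 ?mulr_ge0 ?cabs_ge0 ?(ltW D0) ?(ltW e0).
exists (Num.truncn B).+1 => K NK.
have BK : B < K%:R by rewrite (lt_le_trans (truncnS_gt _)) // ler_nat.
have K0 : 0 < K%:R :> R by exact: le_lt_trans BK.
have K0n : (0 < K)%N by rewrite -(ltr0n R).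
have b1 : 0 <= 2 * f * D / e by rewrite !mulr_ge0 ?invr_ge0 ?(ltW e0) ?(ltW D0).
have z0 := cabs_ge0 z.
pose t := c / K%:R.
have t0 : 0 < t by rewrite divr_gt0.
have DK : D / K%:R <= 2^-1.
  rewrite ler_pdivrMr // mulrC ler_pdivlMr // mulrC (le_trans _ (ltW BK)) //.
  by rewrite /B -addrA lerDl addr_ge0 // mulr_ge0.
have DE : D / K%:R = 12 * (cabs z / K%:R) + 56 * t by rewrite /D /t; field; rewrite gt_eqF.
have zK0 : 0 <= cabs z / K%:R by rewrite divr_ge0 // ltW.
have At : A / K%:R <= t by rewrite ler_pM2r ?invr_gt0 // lerDl addr_ge0.
have St : (S + 2) / K%:R <= t by rewrite ler_pM2r ?invr_gt0 // lerDr.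
have zr : cabs z <= circle_radius K / 2.
  rewrite ler_pdivlMr // mulrC (le_trans _ (circle_radius_ge K0n)) // (le_trans _ (ltW BK)) //.
  by rewrite /B lerDr addr_ge0 // mulr_ge0 // ltW.
have [|M [H [FE H1]]] := remainder_near1 K0n zr At St t0; first lra.
have T1 : cabs (tail_prod K M z - 1) <= 6 * (cabs z / K%:R).
  by apply: tail_prod_near1 => //; lra.
have TH : cabs (tail_prod K M z * H - 1) <= D / K%:R.
  rewrite (le_trans (near1_mul T1 H1 _)) //; last by rewrite DE; lra.
  by rewrite DE in DK; lra.
set P := partial_prod K z in FE *; set h := _ * H in FE TH.
have h2 : 2^-1 <= cabs h by rewrite (le_trans _ (near1_ge TH)) //; lra.
have P2 : cabs P <= 2 * f.
  have : cabs P * 2^-1 <= cabs P * cabs h by rewrite ler_wpM2l ?cabs_ge0.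
  rewrite -cabsM -FE -/f; lra.
rewrite FE -[P in P - _]mulr1 -mulrBr cabsM cabs_distC.
apply: (@le_lt_trans _ _ (2 * f * (D / K%:R))).
  by rewrite ler_pM ?cabs_ge0.
rewrite mulrA ltr_pdivrMr // [ltRHS]mulrC -ltr_pdivrMr // (le_lt_trans _ BK) //.
by rewrite /B addrAC lerDr addr_ge0 // mulr_ge0 // ltW.
Qed.

End HadamardCore.

Lemma le_of_sqr_le (R : realType) (x S : R) : x ^+ 2 <= S -> x <= 1 + S.
Proof.
move=> xS; have := sqr_ge0 (x - 2^-1).
have -> : (x - 2^-1) ^+ 2 = x ^+ 2 - x + 4^-1 by field.
lra.
Qed.

(** * The product formula for both values of gamma *)

Section CharacteristicProduct.
Context {R : realType}.
Notation mu := (@lebesgue_measure R).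
Notation TR := (measurableTypeR R).
Implicit Types (w : R -> R[i]) (z rho gamma : R[i]) (lam : nat -> R[i]).

Definition F_w gamma w z : R[i] := 2 - 2 * gamma * ccos (sqrtC z) -
  cintegral `]0, 1[ (fun y => sin_div (sqrtC z) y * w y).

Definition F_free gamma z : R[i] := 2 - 2 * gamma * ccos (sqrtC z).

Lemma entire_F_w gamma w : cintegrable `]0, 1[ w -> entire (F_w gamma w).
Proof.
move=> wi r.
have h1 : disc_approx r (fun z => 2 + (- 2 * gamma) * ccos (sqrtC z)).
  apply: disc_approxD; first exact: disc_approx_cst.
  apply: disc_approxM; [exact: disc_approx_cst|exact: entire_ccos_sqrt].
have h2 : disc_approx r (fun z => -1 * cintegral `]0, 1[ (fun y => sin_div (sqrtC z) y * w y)).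
  apply: disc_approxM; [exact: disc_approx_cst|exact: entire_sin_integral].
apply: disc_approx_ext (disc_approxD h1 h2) => z _.
by rewrite /F_w mulN1r !mulNr.
Qed.

(** Numerator and denominator both grow like exp |Im rho|, but the kernel sin (rho y) / rho has an
    extra 1 / |rho| = 1 / T. *)
Lemma F_w_circle (g T : R) w z : cintegrable `]0, 1[ w -> g ^+ 2 = 1 ->
  cos T = - g -> sin T = 0 -> 3 <= T -> cabs z = T ^+ 2 ->
  F_free g%:C z != 0 /\
  cabs (F_w g%:C w z - F_free g%:C z) <= 4 * L1norm `]0, 1[ w / T * cabs (F_free g%:C z).
Proof.
move=> wi g2 cT sT T3 zT; set rho := sqrtC z.
have T0 : 0 < T by apply: lt_le_trans T3.
have rT : cabs rho = T.
  apply/eqP; rewrite -(@eqrXn2 _ 2) ?cabs_ge0 ?(ltW T0) // -cabsX sqrtCK zT //.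
have low := circle_lower_bound g2 cT sT T3 rT.
have F2 : F_free g%:C z = 2 * (1 - g%:C * ccos rho) by rewrite /F_free -/rho; ring.
set e := expR _ in low.
have e0 : 0 < e := expR_gt0 _.
have Fe : e / 2 <= cabs (F_free g%:C z).
  rewrite F2 cabsM cabs_nat (_ : e / 2 = 2 * (e / 4)); last by field.
  by rewrite ler_pM2l.
split; first by rewrite -cabs_gt0 (lt_le_trans _ Fe) // divr_gt0.
have -> : F_w g%:C w z - F_free g%:C z = - cintegral `]0, 1[ (fun y => sin_div rho y * w y).
  by rewrite /F_w /F_free addrAC subrr add0r.
have d x : is_cderive (sin_div rho) x (ccos (rho * x%:C)).
  have := is_cderive_sin_div rho 0 x; rewrite addr0; congr (is_cderive _ _ _).
  by apply/funext => t; rewrite addr0.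
have [k1 k2] := is_cderive_measurable `]0, 1[ d.
have rn0 : rho != 0 by rewrite -cabs_gt0 rT.
have kB t : `]0, 1[%classic t -> cabs (sin_div rho t) <= e / T.
  rewrite /= in_itv /= => /andP[t0 t1].
  by rewrite -rT cabs_sin_div_le_Im // !ltW.
have m01 : measurable (`]0, 1[%classic : set TR) by exact: measurable_itv.
rewrite cabsN (le_trans (cabs_cintegral_mul_le m01 k1 k2 kB wi)) //.
have L0 := L1norm_ge0 `]0, 1[ w.
have -> : 2 * (e / T) * L1norm `]0, 1[ w = 4 * L1norm `]0, 1[ w / T * (e / 2).
  by field; rewrite gt_eqF.
by rewrite ler_wpM2l // divr_ge0 ?mulr_ge0 // ltW.
Qed.

Lemma cos_sin_natpi n : cos (n%:R * pi : R) = (-1) ^+ n /\ sin (n%:R * pi : R) = 0.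
Proof.
elim: n => [|n [IH1 IH2]]; first by rewrite mul0r cos0 sin0.
rewrite -natr1 mulrDl mul1r (cosD (n%:R * pi)) (sinD (n%:R * pi)) cospi sinpi IH1 IH2 exprSr.
by rewrite !mulr0 subr0 mul0r add0r.
Qed.

Lemma prod_pairs (T : comPzRingType) (f : nat -> T) K :
  \prod_(n < 2 * K) f n = \prod_(k < K) (f (2 * k)%N * f (2 * k + 1)%N).
Proof.
elim: K => [|K IH]; first by rewrite !big_ord0.
rewrite (_ : (2 * K.+1 = (2 * K).+2)%N); last by rewrite mulnS.
by rewrite !big_ord_recr /= IH mulrA addn1.
Qed.

(** The comparison on circles handles factors in pairs, so it only gives the partial products of
    even length. An odd one has a single extra factor, which tends to 1. *)
Lemma cvg_prod_even (f : nat -> R[i]) (l : R[i]) (C : R) :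
  (forall e : R, 0 < e -> exists N, forall K, (N <= K)%N ->
     cabs (\prod_(n < 2 * K) f n - l) < e) ->
  0 <= C -> (forall k, cabs (f (2 * k)%N - 1) <= C / k.+1%:R) ->
  ((fun n => \prod_(i < n) f i) : nat -> R[i]^o) @ \oo --> (l : R[i]^o).
Proof.
move=> fe C0 f1; apply: cvg_cabsP => e e0.
have e2 : 0 < e / 2 by rewrite divr_gt0.
have [N NP] := fe _ e2.
have [N1 N1P] := fe _ ltr01.
pose B := cabs l + 1.
have B0 : 0 < B by rewrite ltr_wpDl ?cabs_ge0.
have [N2 N2P] := small_div C0 (divr_gt0 e2 B0).
pose M := maxn N (maxn N1 N2).
exists (2 * M)%N => // n /= Mn.
have [k [kM kE]] : exists k, (M <= k)%N /\ (n = (2 * k)%N \/ n = (2 * k).+1).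
  exists n./2; split; first by lia.
  by have := odd_double_half n; case: (odd n); rewrite -mul2n; [right|left]; lia.
have Nk : (N <= k)%N by apply: leq_trans kM; rewrite leq_maxl.
have N1k : (N1 <= k)%N by apply: leq_trans kM; rewrite leq_max leq_max leqnn orbT.
have N2k : (N2 <= k)%N by apply: leq_trans kM; rewrite leq_max leq_max leqnn !orbT.
have h := NP k Nk.
case: kE => ->; first by rewrite (lt_trans h) // ltr_pdivrMr // ltr_pMr // ltr1n.
rewrite big_ord_recr /=; set P := \prod_(i < _) _ in h *.
have -> : P * f (2 * k)%N - l = (P - l) + P * (f (2 * k)%N - 1) by ring.
rewrite (le_lt_trans (cabs_leD _ _)) // [ltRHS](splitr e) ltr_leD //.
have PB : cabs P <= B.
  have := N1P k N1k; rewrite -/P => h1.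
  by rewrite -(subrK l P) (le_trans (cabs_leD _ _)) // addrC lerD2l ltW.
rewrite cabsM (le_trans (ler_pM (cabs_ge0 _) (cabs_ge0 _) PB (f1 k))) //.
by rewrite mulrC -ler_pdivlMr // ltW // N2P.
Qed.

Lemma kappa_bound lam gamma : numbered gamma lam ->
  exists2 S, 0 <= S & forall K, \sum_(k < K) cabs (lam (2 * k)%N - lam0 gamma (2 * k)) ^+ 2 <= S.
Proof.
move=> [[kappa [ks kE]] _].
set s := (\sum_(0 <= k <oo) _)%E in ks.
have s0 : (0 <= s)%E by apply: nneseries_ge0 => k _ _; rewrite lee_fin sqr_ge0.
have sf : s \is a fin_num by rewrite ge0_fin_numE.
exists (fine s); first by rewrite fine_ge0.
move=> K; rewrite -lee_fin fineK //.
apply: (@le_trans _ _ (\sum_(0 <= k < K) ((cabs (kappa k)) ^+ 2)%:E)%E).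
  rewrite sumEFin lee_fin big_mkord; apply: ler_sum => k _.
  by rewrite kE addrC addKr.
by apply: nneseries_lim_ge => k _ _; rewrite lee_fin sqr_ge0.
Qed.

Lemma lam0_minus n : lam0 (-1 : R[i]) n = (((2 * n./2 + 1)%:R * pi) ^+ 2)%:C.
Proof.
rewrite /lam0 /alpha (_ : (-1 == 1 :> R[i]) = false); last first.
  by rewrite eqNr oner_eq0.
congr (((_%:R * _) ^+ 2)%:C); have := odd_double_half n.
by case: (odd n) => /=; rewrite -mul2n; lia.
Qed.

Lemma lam0_plus n : lam0 (1 : R[i]) n.+1 = (((2 * n./2 + 2)%:R * pi) ^+ 2)%:C.
Proof.
rewrite /lam0 /alpha eqxx; congr (((_%:R * _) ^+ 2)%:C).
have := odd_double_half n.
by rewrite /= ; case: (odd n) => /=; rewrite -mul2n; lia.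
Qed.

(** Eigenvalues 2k and 2k + 1 share the node ((2k + 1) pi)^2, and the free function is 4 cos^2 (rho
    / 2), so its product is the square of the one for the cosine. *)
Lemma Delta_prod_minus lam w z : numbered (-1) lam -> cintegrable `]0, 1[ w ->
  (forall x, exists m, zero_order (F_w (-1) w) x m /\ ([set n | lam n = x] #= `I_m)%card) ->
  Delta_prod (-1) lam z = F_w (-1) w z.
Proof.
move=> num wi spec.
have [S S0 SP] := kappa_bound num.
have [_ lodd] := num.
have half_even k : ((2 * k)./2 = k)%N by rewrite mul2n doubleK.
have half_odd k : ((2 * k + 1)./2 = k)%N by lia.
have E0 k : lam0 (-1 : R[i]) (2 * k) = (node 1%N k)%:C by rewrite lam0_minus half_even.
have E1 k : lam0 (-1 : R[i]) (2 * k + 1) = (node 1%N k)%:C by rewrite lam0_minus half_odd.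
have L1 k : lam (2 * k + 1)%N = (node 1%N k)%:C.
  by have := lodd k.+1 isT; rewrite (_ : (2 * k.+1 - 1 = 2 * k + 1)%N) ?E1 //; lia.
pose b k := lam (2 * k)%N.
have bS K : \sum_(k < K) cabs (b k - (node 1%N k)%:C) ^+ 2 <= S.
  by under eq_bigr => k _ do rewrite -E0; exact: SP.
have pair k x : (x - lam (2 * k)%N) * (x - lam (2 * k + 1)%N) =
   (1 - x / (node 1%N k)%:C) * ((b k - x) / (node 1%N k)%:C) * (node 1%N k)%:C ^+ 2.
  rewrite L1 /b; move: ((node 1%N k)%:C) (nodeC_neq0 (R := R) (dl := 1%N) isT k) => n n0.
  by field.
have fact K : exists G, entire G /\ forall x, F_w (-1) w x =
    partial_prod 1%N (fun=> 4) b K x * G x.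
  have [G [Ge GE]] := zero_factorization (entire_F_w (-1) wi) spec (2 * K).
  pose c : R[i] := (\prod_(k < K) (node 1%N k)%:C ^+ 2) / 4.
  exists (fun x => c * G x); split.
    by move=> r; apply: disc_approxM; [exact: disc_approx_cst|exact: Ge].
  move=> x; rewrite GE (prod_pairs (fun n => x - lam n)) /partial_prod /c.
  under eq_bigr => k _ do rewrite pair.
  rewrite big_split /=; set p := \prod_(k < K) _; set q := \prod_(k < K) _.
  by field.
pose A := 4 * L1norm `]0, 1[ w.
have A0 : 0 <= A by rewrite mulr_ge0 ?L1norm_ge0.
have N1 : (-1 : R[i]) = (-1)%:C by rewrite rmorphN1.
have circ K x : (0 < K)%N -> cabs x = circle_radius 1%N K ->
    F_free (-1) x != 0 /\ cabs (F_w (-1) w x - F_free (-1) x) <= A / K%:R * cabs (F_free (-1) x).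
  move=> K0; rewrite /circle_radius addn1 /= => xK.
  have pi2 := pi_ge2 R; have K0' : 0 < K%:R :> R by rewrite ltr0n.
  have K1 : 1 <= K%:R :> R by rewrite ler1n.
  have T3 : 3 <= (2 * K)%:R * pi :> R.
    have : 2 * 1 * 2 <= 2 * K%:R * pi :> R by rewrite ler_pM // ler_pM2l.
    by rewrite natrM; lra.
  have [cT sT] := cos_sin_natpi (2 * K).
  have [h1 h2] : F_free (-1)%:C x != 0 /\
      cabs (F_w (-1)%:C w x - F_free (-1)%:C x) <= A / ((2 * K)%:R * pi) * cabs (F_free (-1)%:C x).
    apply: F_w_circle => //; rewrite ?sqrrN ?expr1n //.
    by rewrite cT exprM sqrrN expr1n expr1n opprK.
  move: h1 h2; rewrite -N1 => h1 h2; split=> //; apply: (le_trans h2); rewrite ler_wpM2r ?cabs_ge0 // ler_wpM2l //.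
  rewrite lef_pV2 ?posrE //; last by rewrite mulr_gt0 ?pi_gt0 // ltr0n muln_gt0.
  by rewrite natrM -[leLHS]mulr1 ler_pM // ?ler_peMl // ?ler1n //; lra.
(* [ccos_euler] with parameter [M.-1] has exactly [M] factors, hence the predecessor. *)
pose E M x := euler_rem (2 * M.-1 + 1) (sqrtC x / pi%:C) ^+ 2 : R[i].
have F0p M x : (0 < M)%N -> F_free (-1) x = partial_prod0 1%N (fun=> 4) M x * E M x.
  case: M => // M _.
  have -> : F_free (-1) x = 4 * ccos (sqrtC x / 2) ^+ 2.
    rewrite /F_free; have {1}-> : sqrtC x = sqrtC x / 2 + sqrtC x / 2 by field.
    rewrite ccosD; have := ccos2Dcsin2 (sqrtC x / 2).
    move: (ccos _) (csin _) => c s cs.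
    transitivity (2 * (c ^+ 2 + s ^+ 2) + 2 * c ^+ 2 - 2 * s ^+ 2); last by rewrite cs; transitivity (2 + 2 * c ^+ 2 - 2 * (c ^+ 2 + s ^+ 2) + 2 * c ^+ 2); [ring|rewrite cs; ring].
    by rewrite cs; ring.
  rewrite (ccos_euler M) exprMn mulrA -prodrXl /partial_prod0; congr (_ * _ * _).
  apply: eq_bigr => k _; rewrite sqrtCK /node.
  by rewrite rmorphXn rmorphM rmorph_nat.
have Ecvg (r e : R) : 0 < e -> exists N, forall M x, (N <= M)%N -> cabs x <= r ->
    cabs (E M x - 1) <= e.
  move=> e0; have [C C0 CP] := euler_rem_cvg (1 + r).
  have m0 : 0 < Num.min 1 (e / 3) by rewrite lt_min ltr01 divr_gt0.
  have [N NP] := small_div C0 m0.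
  exists N => M x NM xr.
  have h : cabs (euler_rem (2 * M.-1 + 1) (sqrtC x / pi%:C) - 1) <= C / M.+1%:R.
    apply: (le_trans (CP _ _ _)); last first.
      by rewrite ler_wpM2l // lef_pV2 ?posrE ?ltr0n // ler_nat; lia.
    rewrite cabsM cabsV cabs_real gtr0_norm ?pi_gt0 // ler_pdivrMr ?pi_gt0 //.
    have := cabs_sqrtC_le xr => h; rewrite (le_trans h) // ler_peMr ?(le_trans (cabs_ge0 _) h) //.
    by rewrite (le_trans _ (pi_ge2 R)) // ler1n.
  have := NP M NM; rewrite lt_min => /andP[h1 h3].
  rewrite /E expr2 (le_trans (near1_mul h h (ltW h1))) //.
  by move: h3; set X := C / _; lra.
have preq K (x : R[i]) : (0 < K)%N -> cabs x = circle_radius 1%N K ->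
  cabs ((fun=> 4) x - (fun=> 4) x : R[i]) <= A / K%:R * cabs ((fun=> 4) x : R[i]).
  by move=> K0 _; rewrite subrr cabs0 mulr_ge0 ?cabs_ge0 // divr_ge0.
have core := @hadamard_core R 1%N isT (F_w (-1) w) (F_free (-1)) (fun=> 4) (fun=> 4) E b S A S0 A0 bS fact circ F0p Ecvg preq z.
rewrite /Delta_prod (_ : (-1 == 1 :> R[i]) = false); last by rewrite eqNr oner_eq0.
pose f n := (lam n - z) / lam0 (-1) n.
have cv : ((fun n => \prod_(i < n) f i) : nat -> R[i]^o) @ \oo --> (F_w (-1) w z / 4 : R[i]^o).
  apply: (@cvg_prod_even f _ (1 + S + cabs z)).
  - move=> e e0; have [N NP] := core e e0; exists N => K NK.
    have -> : \prod_(n < 2 * K) f n = partial_prod 1%N (fun=> 4) b K z / 4.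
      rewrite prod_pairs /partial_prod mulrAC mulfV ?pnatr_eq0 // mul1r.
      apply: eq_bigr => k _; rewrite /f E0 E1 L1 /b.
      by move: ((node 1%N k)%:C) (nodeC_neq0 (R := R) (dl := 1%N) isT k) => n n0; field.
    rewrite -mulrBl cabsM cabsV cabs_nat ltr_pdivrMr //.
    by rewrite (lt_le_trans (NP K NK)) // ler_peMr ?ler1n // ltW.
  - by rewrite !addr_ge0 ?cabs_ge0.
  - move=> k; rewrite /f E0.
    have -> : (lam (2 * k)%N - z) / (node 1%N k)%:C - 1 = (b k - (node 1%N k)%:C - z) / (node 1%N k)%:C.
      by rewrite /b; move: ((node 1%N k)%:C) (nodeC_neq0 (R := R) (dl := 1%N) isT k) => n n0; field.
    rewrite cabsM cabsV cabs_real gtr0_norm ?(@node_gt0 R 1%N isT k) //.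
    apply: ler_pM; first exact: cabs_ge0.
    + by rewrite invr_ge0 (ltW (@node_gt0 R 1%N isT k)).
    + rewrite (le_trans (cabs_leB _ _)) // lerD2r.
      have : cabs (b k - (node 1%N k)%:C) ^+ 2 <= S.
        apply: le_trans (bS k.+1); rewrite big_ord_recr /= lerDr.
        by apply: sumr_ge0 => i _; rewrite sqr_ge0.
      exact: le_of_sqr_le.
    + rewrite lef_pV2 ?posrE ?ltr0n ?(@node_gt0 R 1%N isT k) // (le_trans _ (@node_ge R 1%N isT k)) //.
      by rewrite expr2 ler_peMl // ler1n.
rewrite (_ : (fun N => _) = (fun n => \prod_(i < n) f i)); last first.
  by apply/funext => n; rewrite big_mkord.
rewrite (cvg_lim _ cv); last exact: norm_hausdorff.
by rewrite mulrC divfK // pnatr_eq0.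
Qed.

(** Here [lam 0] has no partner: eigenvalues 2k + 1 and 2k + 2 share a node, and the leading factor
    [x - lam 0] is compared with the factor [x] of the free function 4 sin^2 (rho / 2). *)
Lemma Delta_prod_plus lam w z : numbered 1 lam -> cintegrable `]0, 1[ w ->
  (forall x, exists m, zero_order (F_w 1 w) x m /\ ([set n | lam n = x] #= `I_m)%card) ->
  Delta_prod 1 lam z = F_w 1 w z.
Proof.
move=> num wi spec.
have [S S0 SP] := kappa_bound num.
have [_ lodd] := num.
have E0 k : lam0 (1 : R[i]) (2 * k).+2 = (node 2%N k)%:C.
  by rewrite lam0_plus (_ : (2 * k).+1./2 = k)%N //; lia.
have E1 k : lam0 (1 : R[i]) (2 * k).+1 = (node 2%N k)%:C.
  by rewrite lam0_plus (_ : (2 * k)./2 = k)%N //; lia.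
have L1 k : lam (2 * k).+1 = (node 2%N k)%:C.
  by have := lodd k.+1 isT; rewrite (_ : (2 * k.+1 - 1 = (2 * k).+1)%N) ?E1 //; lia.
pose b k := lam (2 * k).+2.
have bS K : \sum_(k < K) cabs (b k - (node 2%N k)%:C) ^+ 2 <= S.
  apply: le_trans (SP K.+1); rewrite big_ord_recl ler_wpDl ?sqr_ge0 //.
  rewrite le_eqVlt; apply/orP; left; apply/eqP; apply: eq_bigr => k _.
  by rewrite -E0 /b lift0 (_ : (2 * k.+1 = (2 * k).+2)%N) // mulnS.
have pair k x : (x - lam (2 * k).+1) * (x - lam (2 * k).+2) =
   (1 - x / (node 2%N k)%:C) * ((b k - x) / (node 2%N k)%:C) * (node 2%N k)%:C ^+ 2.
  rewrite L1 /b; move: ((node 2%N k)%:C) (nodeC_neq0 (R := R) (dl := 2%N) isT k) => n n0.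
  by field.
have fact K : exists G, entire G /\ forall x, F_w 1 w x =
    partial_prod 2%N (fun x => x - lam 0%N) b K x * G x.
  have [G [Ge GE]] := zero_factorization (entire_F_w 1 wi) spec (2 * K).+1.
  pose c : R[i] := \prod_(k < K) (node 2%N k)%:C ^+ 2.
  exists (fun x => c * G x); split.
    by move=> r; apply: disc_approxM; [exact: disc_approx_cst|exact: Ge].
  move=> x; rewrite GE big_ord_recl /partial_prod /c.
  under [in LHS]eq_bigr => k _ do rewrite lift0.
  rewrite (prod_pairs (fun n => x - lam n.+1)).
  under eq_bigr => k _ do rewrite addn1 pair.
  by rewrite big_split /=; ring.
(* The second summand pays for the difference [lam 0] of the leading factors, measured against |x|
   >= K on the circle. *)
pose A := 4 * L1norm `]0, 1[ w + cabs (lam 0%N).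
have L0 : 0 <= 4 * L1norm `]0, 1[ w by rewrite mulr_ge0 ?L1norm_ge0.
have A0 : 0 <= A by rewrite addr_ge0 ?cabs_ge0.
have N1 : (1 : R[i]) = (1 : R)%:C by rewrite rmorph1.
have circ K x : (0 < K)%N -> cabs x = circle_radius 2%N K ->
    F_free 1 x != 0 /\ cabs (F_w 1 w x - F_free 1 x) <= A / K%:R * cabs (F_free 1 x).
  move=> K0; rewrite /circle_radius addn2 /= => xK.
  have pi2 := pi_ge2 R; have K0' : 0 < K%:R :> R by rewrite ltr0n.
  have K1 : 1 <= K%:R :> R by rewrite ler1n.
  have T3 : 3 <= (2 * K).+1%:R * pi :> R.
    have : 2 * 1 * 2 <= 2 * K%:R * pi :> R by rewrite ler_pM // ler_pM2l.
    have e : (2 * K).+1%:R = 2 * K%:R + 1 :> R by rewrite -natr1 natrM.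
    by rewrite e mulrDl mul1r; lra.
  have [cT sT] := cos_sin_natpi (2 * K).+1.
  have [h1 h2] : F_free (1 : R)%:C x != 0 /\
      cabs (F_w (1 : R)%:C w x - F_free (1 : R)%:C x) <=
      4 * L1norm `]0, 1[ w / ((2 * K).+1%:R * pi) * cabs (F_free (1 : R)%:C x).
    apply: F_w_circle => //; rewrite ?expr1n //.
    by rewrite cT exprS exprM sqrrN !expr1n mulr1.
  move: h1 h2; rewrite -N1 => h1 h2; split=> //; apply: (le_trans h2).
  rewrite ler_wpM2r ?cabs_ge0 // ler_pM ?invr_ge0 //.
  - by rewrite mulr_ge0 ?pi_ge0.
  - by rewrite lerDl cabs_ge0.
  rewrite lef_pV2 ?posrE //; last by rewrite mulr_gt0 ?pi_gt0 // ltr0n.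
  rewrite -[leLHS]mulr1 ler_pM // ?ler_nat; first by lia.
  by lra.
pose E M x := euler_rem (2 * M) (sqrtC x / pi%:C) ^+ 2 : R[i].
have F0p M x : (0 < M)%N -> F_free 1 x = partial_prod0 2%N id M x * E M x.
  move=> _.
  have cs : csin (sqrtC x / 2) = sqrtC x * sin_div (sqrtC x) 2^-1.
    rewrite /sin_div; case: eqP => [->|/eqP r0]; first by rewrite !mul0r csin0.
    by rewrite mulrCA divff // mulr1 fmorphV rmorph_nat.
  have -> : F_free 1 x = 4 * x * sin_div (sqrtC x) 2^-1 ^+ 2.
    rewrite /F_free (_ : 2 - _ = 2 * (1 - ccos (sqrtC x))); last by ring.
    by rewrite one_sub_ccos cs exprMn sqrtCK; ring.
  rewrite (sin_half_euler M) /partial_prod0 /E.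
  move: (euler_rem _ _) => c; rewrite !exprMn -prodrXl.
  rewrite (eq_bigr (fun k : 'I_M => (1 - x / (node 2%N k)%:C) ^+ 2)); last first.
    move=> k _; rewrite sqrtCK /node (_ : (2 * k.+1 = 2 * k + 2)%N); last by lia.
    by rewrite rmorphXn rmorphM rmorph_nat.
  by field.
have Ecvg (r e : R) : 0 < e -> exists N, forall M x, (N <= M)%N -> cabs x <= r ->
    cabs (E M x - 1) <= e.
  move=> e0; have [C C0 CP] := euler_rem_cvg (1 + r).
  have m0 : 0 < Num.min 1 (e / 3) by rewrite lt_min ltr01 divr_gt0.
  have [N NP] := small_div C0 m0.
  exists N => M x NM xr.
  have h : cabs (euler_rem (2 * M) (sqrtC x / pi%:C) - 1) <= C / M.+1%:R.
    apply: (le_trans (CP _ _ _)); last first.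
      by rewrite ler_wpM2l // lef_pV2 ?posrE ?ltr0n // ler_nat; lia.
    rewrite cabsM cabsV cabs_real gtr0_norm ?pi_gt0 // ler_pdivrMr ?pi_gt0 //.
    have := cabs_sqrtC_le xr => h; rewrite (le_trans h) // ler_peMr ?(le_trans (cabs_ge0 _) h) //.
    by rewrite (le_trans _ (pi_ge2 R)) // ler1n.
  have := NP M NM; rewrite lt_min => /andP[h1 h3].
  rewrite /E expr2 (le_trans (near1_mul h h (ltW h1))) //.
  by move: h3; set X := C / _; lra.
have preq K (x : R[i]) : (0 < K)%N -> cabs x = circle_radius 2%N K ->
  cabs ((fun x => x - lam 0%N) x - id x) <= A / K%:R * cabs (id x).
  move=> K0 xK; rewrite /= addrAC subrr add0r cabsN.
  have K0' : 0 < K%:R :> R by rewrite ltr0n.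
  rewrite mulrAC ler_pdivlMr // ler_pM ?cabs_ge0 //; first by rewrite lerDr.
  by rewrite xK; exact: (@circle_radius_ge R 2%N isT).
have core := @hadamard_core R 2%N isT (F_w 1 w) (F_free 1) (fun x => x - lam 0%N) id E b S A S0 A0 bS fact circ F0p Ecvg preq z.
rewrite /Delta_prod eqxx.
(* The leading factor cannot be divided out at [lam 0]; there both sides vanish. *)
have [zl|zl] := eqVneq z (lam 0%N).
  have [G [_ ->]] := zero_factorization (entire_F_w 1 wi) spec 1.
  by rewrite big_ord_recl big_ord0 zl subrr !mul0r.
have zl0 : z - lam 0%N != 0 by rewrite subr_eq0.
have zc0 : 0 < cabs (z - lam 0%N) by rewrite cabs_gt0.
pose f n := (lam n.+1 - z) / lam0 1 n.+1.
have cv : ((fun n => \prod_(i < n) f i) : nat -> R[i]^o) @ \oo --> (F_w 1 w z / (z - lam 0%N) : R[i]^o).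
  (* After the index shift the even positions of [f] hold the exact eigenvalues, so these factors
     differ from 1 only by z / node. *)
  apply: (@cvg_prod_even f _ (cabs z)).
  - move=> e e0; have [N NP] := core _ (mulr_gt0 e0 zc0); exists N => K NK.
    have -> : \prod_(n < 2 * K) f n = partial_prod 2%N (fun x => x - lam 0%N) b K z / (z - lam 0%N).
      rewrite prod_pairs /partial_prod mulrAC mulfV // mul1r.
      apply: eq_bigr => k _; rewrite /f addn1 E0 E1 L1 /b.
      by move: ((node 2%N k)%:C) (nodeC_neq0 (R := R) (dl := 2%N) isT k) => n n0; field.
    by rewrite -mulrBl cabsM cabsV ltr_pdivrMr // NP.
  - by rewrite cabs_ge0.
  - move=> k; rewrite /f E1 L1.
    have -> : ((node 2%N k)%:C - z) / (node 2%N k)%:C - 1 = - z / (node 2%N k)%:C.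
      by move: ((node 2%N k)%:C) (nodeC_neq0 (R := R) (dl := 2%N) isT k) => n n0; field.
    rewrite cabsM cabsV cabsN cabs_real gtr0_norm ?(@node_gt0 R 2%N isT k) //.
    rewrite ler_wpM2l ?cabs_ge0 //.
    rewrite lef_pV2 ?posrE ?ltr0n ?(@node_gt0 R 2%N isT k) // (le_trans _ (@node_ge R 2%N isT k)) //.
    by rewrite expr2 ler_peMl // ler1n.
have cv' : ((fun N => \prod_(1 <= n < N) ((lam n - z) / lam0 1 n)) : nat -> R[i]^o) @ \oo -->
    (F_w 1 w z / (z - lam 0%N) : R[i]^o).
  rewrite -cvg_shiftS /= (_ : (fun N => _) = (fun n => \prod_(i < n) f i)) //.
  by apply/funext => n; rewrite big_add1 big_mkord.
rewrite (cvg_lim _ cv'); last exact: norm_hausdorff.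
by rewrite mulrC divfK.
Qed.

Lemma Delta_prod_char_fun q a gamma lam z : 0 <= a <= 1 ->
  gamma = 1 \/ gamma = -1 -> L2 `]0, 1[ q -> is_spectrum q a gamma lam ->
  numbered gamma lam -> Delta_prod gamma lam z = char_fun q a gamma z.
Proof.
move=> aI gE qL spec num.
have wi := L2_cintegrable (w_pot_L2 gamma aI qL).
have E : char_fun q a gamma = F_w gamma (w_pot gamma q a).
  by apply/funext => x; rewrite char_fun_formula.
rewrite /is_spectrum E in spec; rewrite E.
by case: gE num spec wi => -> num spec wi; [exact: Delta_prod_plus|exact: Delta_prod_minus].
Qed.

End CharacteristicProduct.

(** * Completeness of the sines *)

Section Bernstein.
Context {R : realType}.
Implicit Types (y : R) (f g : nat -> R).

(* [bernstein n f] is [\sum_k f k 'C(n, k) 'X^k (1 - 'X)^(n - k)], the mean of [f]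
   over the number of successes in [n] trials. *)
Fixpoint bernstein n f : {poly R} :=
  if n is m.+1 then
    (1 - 'X) * bernstein m f + 'X * bernstein m (fun k => f k.+1)
  else (f 0%N)%:P.

Lemma bernstein_lincomb n f g (a b : R) y :
  (bernstein n (fun k => a * f k + b * g k)).[y] =
  a * (bernstein n f).[y] + b * (bernstein n g).[y].
Proof.
elim: n f g => [|n IH] f g /=; first by rewrite !hornerC.
rewrite !hornerD !hornerM !hornerD !hornerN !hornerC !hornerX.
by rewrite IH (IH (fun k => f k.+1) (fun k => g k.+1)); ring.
Qed.

Lemma bernstein_cst n (a : R) y : (bernstein n (fun=> a)).[y] = a.
Proof.
elim: n => [|n IH] /=; first by rewrite hornerC.
by rewrite hornerD !hornerM !hornerD !hornerN !hornerC !hornerX IH; ring.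
Qed.

Lemma bernstein_le n f g y : 0 <= y <= 1 ->
  (forall k, (k <= n)%N -> f k <= g k) -> (bernstein n f).[y] <= (bernstein n g).[y].
Proof.
move=> yI; have /andP[y0 y1] := yI.
elim: n f g => [|n IH] f g fg /=; first by rewrite !hornerC fg.
rewrite !hornerD !hornerM !hornerD !hornerN !hornerC !hornerX.
rewrite lerD // ler_wpM2l ?subr_ge0 ?IH // => k kn; rewrite fg //.
exact: leqW.
Qed.

(** The arbitrary centre [c] makes the induction close: the second branch of the recursion moves it
    to [c - 1]. *)
Lemma bernstein_variance n (c : R) y :
  (bernstein n (fun k => (k%:R - c) ^+ 2)).[y] = n%:R * (y * (1 - y)) + (n%:R * y - c) ^+ 2.
Proof.
elim: n c => [|n IH] c /=; first by rewrite hornerC; ring.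
rewrite !hornerD !hornerM !hornerD !hornerN !hornerC !hornerX IH.
have -> : bernstein n (fun k => (k.+1%:R - c) ^+ 2) = bernstein n (fun k => (k%:R - (c - 1)) ^+ 2).
  by congr bernstein; apply/funext => k; rewrite -natr1; ring.
by rewrite IH -natr1; ring.
Qed.

(** The operator is linear, monotone and fixes constants, so a pointwise bound by a quadratic in [k]
    passes to the mean, where the quadratic becomes the variance. *)
Lemma bernstein_dist_le n f (a e K c y : R) : 0 <= y <= 1 ->
  (forall k, (k <= n)%N -> `|f k - a| <= e + K * (k%:R - c) ^+ 2) ->
  `|(bernstein n f).[y] - a| <= e + K * (n%:R * (y * (1 - y)) + (n%:R * y - c) ^+ 2).
Proof.
move=> yI fa; rewrite -bernstein_variance.
have E s : e + K * (bernstein n (fun k => (k%:R - c) ^+ 2)).[y] =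
    s - (s - (bernstein n (fun k => 1 * e + K * (k%:R - c) ^+ 2)).[y]).
  by rewrite (bernstein_lincomb n (fun=> e)) bernstein_cst; ring.
rewrite (E 0) !sub0r opprK.
have D : (bernstein n f).[y] - a = (bernstein n (fun k => 1 * f k + -1 * a)).[y].
  by rewrite (bernstein_lincomb n f (fun=> a)) bernstein_cst; ring.
rewrite D ler_norml; apply/andP; split.
  have -> (h : nat -> R) : - (bernstein n h).[y] = (bernstein n (fun k => -1 * h k + 0 * h k)).[y].
    by rewrite bernstein_lincomb; ring.
  apply: bernstein_le => // k kn; have := fa k kn; rewrite ler_norml => /andP[+ _].
  by rewrite mul0r addr0 !mul1r !mulN1r.
apply: bernstein_le => // k kn; have := fa k kn; rewrite ler_norml => /andP[_].
by rewrite !mul1r mulN1r.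
Qed.

(** Strict monotonicity of the cosine on [0, pi] converts a distance in [t] into a distance in cos
    (pi t), the variable of the polynomials. *)
Lemma cos_pi_separated (x d : R) : 0 < d -> 0 <= x - d -> x + d <= 1 ->
  exists2 eta : R, 0 < eta &
    forall t : R, 0 <= t <= 1 -> d <= `|x - t| -> eta <= `|cos (pi * x) - cos (pi * t)|.
Proof.
move=> d0 xd0 xd1; have p0 := @pi_gt0 R.
have I (s : R) : 0 <= s -> s <= 1 -> pi * s \in `[0, (pi : R)].
  by move=> s0 s1; rewrite in_itv /= mulr_ge0 ?(ltW p0) //= ler_piMr // ltW.
have dec (s t : R) : 0 <= s -> s < t -> t <= 1 -> cos (pi * t) < cos (pi * s).
  move=> s0 st t1; have t0 := le_trans s0 (ltW st); have s1 := le_trans (ltW st) t1.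
  by rewrite (ltr_cos (I _ s0 s1) (I _ t0 t1)) ltr_pM2l.
have decw (s t : R) : 0 <= s -> s <= t -> t <= 1 -> cos (pi * t) <= cos (pi * s).
  move=> s0; rewrite le_eqVlt => /predU1P[-> //|st] t1; exact: ltW (dec _ _ s0 st t1).
have x0 : 0 <= x by lra.
have x1 : x <= 1 by lra.
exists (Num.min (cos (pi * x) - cos (pi * (x + d))) (cos (pi * (x - d)) - cos (pi * x))).
  by rewrite lt_min !subr_gt0 !dec //; lra.
move=> t /andP[t0 t1] dt; rewrite ge_min.
have [xt|tx] := leP x t.
  apply/orP; left; rewrite (le_trans _ (ler_norm _)) // lerD2l lerN2 decw //; first lra.
  by move: dt; rewrite distrC ger0_norm ?subr_ge0 //; lra.
apply/orP; right; rewrite distrC (le_trans _ (ler_norm _)) // lerD2r decw //; last lra.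
by move: dt; rewrite ger0_norm ?subr_ge0 ?(ltW tx) //; lra.
Qed.

(* Korovkin's argument in the variable [y = (1 - cos (pi x)) / 2]. *)
Lemma bernstein_cos_cvg (g : R -> R) (M x e : R) : 0 < x < 1 ->
  {for x, continuous g} -> (forall t, `|g t| <= M) -> 0 < e ->
  exists N, forall n, (N <= n)%N ->
    `|(bernstein n (fun k => g (acos (1 - 2 * (k%:R / n%:R)) / pi))).[(1 - cos (pi * x)) / 2] - g x| < e.
Proof.
move=> /andP[x0 x1] gc gM e0; have p0 := @pi_gt0 R.
have e2 : 0 < e / 2 by rewrite divr_gt0.
have M0 : 0 <= M := le_trans (normr_ge0 _) (gM 0).
have /cvgrPdist_lt /(_ _ e2) /nbhs_ballP[d1 /= d10 d1P] := gc.
pose d := Num.min d1 (Num.min x (1 - x)).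
have d0 : 0 < d by rewrite !lt_min d10 x0 subr_gt0.
have [dd1 dx d1x] : [/\ d <= d1, d <= x & d <= 1 - x] by rewrite /d !ge_min !lexx !orbT.
have xd0 : 0 <= x - d by rewrite subr_ge0.
have xd1 : x + d <= 1 by rewrite -lerBrDl.
have [eta eta0 etaP] := cos_pi_separated d0 xd0 xd1.
pose C := 8 * M / eta ^+ 2.
have C0 : 0 <= C by apply: divr_ge0 (sqr_ge0 _); rewrite mulr_ge0.
have [N NP] := small_div C0 e2.
exists N.+1 => -[//|n]; rewrite ltnS => Nn.
set y := (1 - _) / 2.
have yI : 0 <= y <= 1.
  by have := cos_le1 (pi * x); have := cos_geN1 (pi * x); rewrite /y; lra.
have n0 : 0 < n.+1%:R :> R by rewrite ltr0n.
(* Makes the quadratic exceed the trivial bound 2M as soon as |k - n y| >= eta n / 2, with [n.+1]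
   for n. The variance term is then C y (1 - y) / n. *)
pose K := 2 * M / (eta * n.+1%:R / 2) ^+ 2.
have K0 : 0 <= K by apply: divr_ge0 (sqr_ge0 _); rewrite mulr_ge0.
have q0 : 0 < (eta * n.+1%:R / 2) ^+ 2 by rewrite exprn_gt0 // divr_gt0 ?mulr_gt0.
have bound k : (k <= n.+1)%N -> `|g (acos (1 - 2 * (k%:R / n.+1%:R)) / pi) - g x| <=
    e / 2 + K * (k%:R - n.+1%:R * y) ^+ 2.
  move=> kn.
  have kn1 : k%:R / n.+1%:R <= 1 :> R by rewrite ler_pdivrMr // mul1r ler_nat.
  have kn0 : 0 <= k%:R / n.+1%:R :> R by rewrite divr_ge0 // ltW.
  have aI : -1 <= 1 - 2 * (k%:R / n.+1%:R : R) <= 1 by move: (_ / _) kn0 kn1 => s s0 s1; apply/andP; split; lra.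
  set t := acos _ / pi.
  have tI : 0 <= t <= 1.
    by rewrite divr_ge0 ?acos_ge0 ?(ltW p0) //= ler_pdivrMr // mul1r acos_lepi.
  have ct : cos (pi * t) = 1 - 2 * (k%:R / n.+1%:R).
    by rewrite /t mulrC divfK ?gt_eqF // acosK.
  have [xt|xt] := ltP `|x - t| d.
    rewrite (@le_trans _ _ (e / 2)) //; last by rewrite lerDl mulr_ge0 ?sqr_ge0.
    by rewrite distrC ltW // d1P // /ball /= (lt_le_trans xt).
  have := etaP _ tI xt; rewrite ct => h.
  have h2 : eta * n.+1%:R / 2 <= `|k%:R - n.+1%:R * y|.
    move: h; have -> : cos (pi * x) - (1 - 2 * (k%:R / n.+1%:R)) =
        (k%:R - n.+1%:R * y) * (2 / n.+1%:R).
      by rewrite /y; move: (cos _) (n.+1%:R) n0 => c u u0; field; rewrite gt_eqF.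
    have n2 : 0 < 2 / n.+1%:R :> R by rewrite divr_gt0.
    by rewrite normrM (gtr0_norm n2) -ler_pdivrMr // invf_div mulrA.
  have h3 : (eta * n.+1%:R / 2) ^+ 2 <= (k%:R - n.+1%:R * y) ^+ 2.
    rewrite -[leRHS]real_normK ?num_real // lerXn2r ?nnegrE // divr_ge0 // mulr_ge0 // ltW //.
  have h4 : 2 * M <= K * (k%:R - n.+1%:R * y) ^+ 2.
    by rewrite /K mulrAC ler_pdivlMr // ler_wpM2l // mulr_ge0.
  rewrite (le_trans (ler_normB _ _)) // (le_trans (lerD (gM _) (gM _))) //.
  have -> : M + M = 2 * M by ring.
  by rewrite (le_trans h4) // lerDr ltW.
apply: (le_lt_trans (bernstein_dist_le yI bound)).
rewrite subrr expr0n addr0 [ltRHS](splitr e) ltrD2l.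
apply: (le_lt_trans _ (NP n Nn)).
have -> : K * (n.+1%:R * (y * (1 - y))) = C / n.+1%:R * (y * (1 - y)).
  rewrite /K /C; move: (n.+1%:R) n0 => u u0; field.
  by rewrite !gt_eqF.
have /andP[y0 y1] := yI.
apply: ler_piMr; first by rewrite divr_ge0 ?(ltW n0).
by apply: mulr_ile1; rewrite ?subr_ge0 ?gerBl.
Qed.

End Bernstein.

(** * Approximation in the real space of square integrable functions on (0, 1) *)

Section SineCompleteness.
Context {R : realType}.
Notation mu := (@lebesgue_measure R).
Notation TR := (measurableTypeR R).
Notation D := (`]0%R, 1%R[%classic : set TR).
Implicit Types (u v g h : R -> R).

Definition R2 u := measurable_fun D u /\ mu.-integrable D (EFin \o (fun x => u x ^+ 2)).

Definition sqnorm u : R := \int[mu]_(x in D) (u x ^+ 2).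

Let mD : measurable D. Proof. exact: measurable_itv. Qed.

Lemma R2_le u (h : R -> R) : measurable_fun D u -> mu.-integrable D (EFin \o h) ->
  (forall x, D x -> u x ^+ 2 <= h x) -> R2 u.
Proof.
move=> um hi uh; split => //; apply: le_integrable hi => //.
  by apply/measurable_EFinP; exact: measurable_funX.
move=> x Dx; rewrite /= lee_fin ger0_norm ?sqr_ge0 // (le_trans (uh _ Dx)) //.
exact: ler_norm.
Qed.

Lemma integrable01_cst (M : R) : mu.-integrable D (EFin \o cst M).
Proof.
apply: measurable_bounded_integrable => //.
  by rewrite /= lebesgue_measure_itv /= lte_fin ltr01 -EFinB ltry.
by exists `|M|; split => [|B MB t _]; rewrite ?num_real //= ltW.
Qed.

Lemma R2_bounded u (M : R) : measurable_fun D u -> (forall x, D x -> `|u x| <= M) -> R2 u.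
Proof.
move=> um uM; apply: (R2_le um (integrable01_cst (M ^+ 2))) => x Dx /=.
by rewrite -real_normK ?num_real // lerXn2r ?nnegrE ?uM // (le_trans _ (uM _ Dx)).
Qed.

Lemma R2_lincomb u v (a b : R) : R2 u -> R2 v -> R2 (fun x => a * u x + b * v x).
Proof.
move=> [um ui] [vm vi].
have hi := integrableD mD (integrableZl mD (2 * a ^+ 2) ui) (integrableZl mD (2 * b ^+ 2) vi).
apply: (@R2_le _ (fun x => 2 * a ^+ 2 * u x ^+ 2 + 2 * b ^+ 2 * v x ^+ 2)).
- by apply: measurable_funD; apply: measurable_funM => //; exact: measurable_cst.
- exact: eq_integrable hi.
move=> x _.
have -> : 2 * a ^+ 2 * u x ^+ 2 + 2 * b ^+ 2 * v x ^+ 2 = 2 * (a * u x) ^+ 2 + 2 * (b * v x) ^+ 2 by ring.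
rewrite -[_ ^+ 2 in leLHS]real_normK ?num_real // -[(a * u x) ^+ 2]real_normK ?num_real //.
rewrite -[(b * v x) ^+ 2]real_normK ?num_real //.
by apply: sqr_le_twice => //; exact: ler_normD.
Qed.

Lemma R2_mul_integrable u v : R2 u -> R2 v -> mu.-integrable D (EFin \o (fun x => u x * v x)).
Proof.
move=> [um ui] [vm vi]; have hi := integrableD mD ui vi.
apply: le_integrable hi => //; first by apply/measurable_EFinP; exact: measurable_funM.
move=> x _; rewrite /= lee_fin [leRHS]ger0_norm ?addr_ge0 ?sqr_ge0 //.
rewrite -[u x ^+ 2]real_normK ?num_real // -[v x ^+ 2]real_normK ?num_real // normrM.
move: `|u x| `|v x| (normr_ge0 (u x)) (normr_ge0 (v x)) => a b a0 b0.
by have := sqr_ge0 (a - b); rewrite sqrrB; have := mulr_ge0 a0 b0; rewrite -mulr_natr; lra.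
Qed.

Lemma sqnorm_ge0 u : 0 <= sqnorm u.
Proof. by apply: Rintegral_ge0 => x _; exact: sqr_ge0. Qed.

Lemma sqnorm_le u (h : R -> R) : R2 u -> mu.-integrable D (EFin \o h) ->
  (forall x, D x -> u x ^+ 2 <= h x) -> sqnorm u <= \int[mu]_(x in D) h x.
Proof. by move=> [_ ui] hi uh; apply: le_Rintegral. Qed.

Lemma sqnorm_add_le u v : R2 u -> R2 v ->
  sqnorm (fun x => u x + v x) <= 2 * sqnorm u + 2 * sqnorm v.
Proof.
move=> uR vR; have [um ui] := uR; have [vm vi] := vR.
have ui' := integrableZl mD 2 ui; have vi' := integrableZl mD 2 vi.
rewrite /sqnorm -!RintegralZl // -RintegralD //.
apply: sqnorm_le.
- have := R2_lincomb 1 1 uR vR; congr R2; apply/funext => x.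
  by rewrite !mul1r.
- by apply: eq_integrable (integrableD mD ui' vi').
move=> x _.
rewrite -[_ ^+ 2 in leLHS]real_normK ?num_real // -[u x ^+ 2]real_normK ?num_real //.
rewrite -[v x ^+ 2]real_normK ?num_real //.
by apply: sqr_le_twice => //; exact: ler_normD.
Qed.

Lemma sqnorm_dct (f : nat -> R -> R) (h : R -> R) :
  (forall n, measurable_fun D (f n)) -> R2 h ->
  (forall n x, D x -> `|f n x| <= `|h x|) ->
  (forall x, D x -> f n x @[n --> \oo] --> 0) ->
  forall e : R, 0 < e -> exists n, R2 (f n) /\ sqnorm (f n) < e.
Proof.
move=> fm hR fh f0 e e0; have [hm hi] := hR.
have fh2 n x : D x -> f n x ^+ 2 <= h x ^+ 2.
  move=> Dx; rewrite -real_normK ?num_real // -[leRHS]real_normK ?num_real //.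
  by rewrite lerXn2r ?nnegrE ?fh.
have fR n : R2 (f n) by apply: R2_le (fh2 n).
have c0 : measurable_fun D (cst 0%E : R -> \bar R) by exact: measurable_cst.
have [] := @dominated_convergence _ TR R mu D mD (fun n x => (f n x ^+ 2)%:E) (cst 0%E)
  (EFin \o (fun x => h x ^+ 2)) _ c0 _ hi _.
- by move=> n; apply/measurable_EFinP; exact: measurable_funX.
- apply: aeW => x Dx; apply: cvg_EFin; first exact: nearW.
  have := cvgM (f0 x Dx) (f0 x Dx); rewrite mulr0 => h2.
  have E : (fun n => fine (f n x ^+ 2)%:E) = (fun n => f n x * f n x).
    by apply/funext => n; rewrite /= expr2.
  suff : (fun n => fine (f n x ^+ 2)%:E) @ \oo --> (0 : R) by [].
  by rewrite E; exact: h2.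
- by apply: aeW => x n Dx; rewrite /= lee_fin ger0_norm ?sqr_ge0 // fh2.
move=> _ _; rewrite integral0 => /fine_cvgP[_ /cvgrPdist_lt /(_ _ e0)[n _ /(_ n (leqnn n))]].
rewrite /= sub0r normrN => h1; exists n; split => //.
by rewrite (le_lt_trans (ler_norm _)).
Unshelve. all: by end_near. Qed.

Definition clip (M x : R) : R := Num.max (- M) (Num.min M x).

Lemma clip_id (M x : R) : `|x| <= M -> clip M x = x.
Proof.
rewrite ler_norml => /andP[h1 h2]; rewrite /clip (min_idPr h2) //.
exact/max_idPr.
Qed.

Lemma clip_norm (M x : R) : 0 <= M -> `|clip M x| <= M.
Proof.
move=> M0; rewrite ler_norml /clip le_max lexx /= ge_max ge_min lexx /= andbT.
by rewrite (le_trans _ M0) // oppr_le0.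
Qed.

Lemma clip_cases (M x : R) : 0 <= M ->
  [\/ `|x| <= M /\ clip M x = x, M < x /\ clip M x = M | x < - M /\ clip M x = - M].
Proof.
move=> M0; have [xM|xM] := leP `|x| M; first by constructor 1; rewrite clip_id.
have [x0|x0] := leP 0 x.
  rewrite ger0_norm // in xM; constructor 2; split => //.
  rewrite /clip (min_idPl (ltW xM)) (max_idPr _) //.
  by rewrite (le_trans _ M0) // oppr_le0.
rewrite ltr0_norm // ltrNr in xM; constructor 3; split => //.
rewrite /clip (min_idPr _); last by rewrite (le_trans (ltW x0)).
by rewrite (max_idPl (ltW xM)).
Qed.

Lemma clip_dist (M x y : R) : 0 <= M -> `|y| <= M -> `|y - clip M x| <= `|y - x|.
Proof.
move=> M0; rewrite ler_norml => /andP[y1 y2].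
case: (clip_cases x M0) => [[_ ->] //|[h ->]|[h ->]].
  by rewrite !ler0_norm; clear -y1 y2 h; lra.
by rewrite !ger0_norm; clear -y1 y2 h; lra.
Qed.

Lemma clip_dist0 (M x : R) : 0 <= M -> `|x - clip M x| <= `|x|.
Proof.
move=> M0; case: (clip_cases x M0) => [[_ ->]|[h ->]|[h ->]].
- by rewrite subrr normr0.
- by rewrite !ger0_norm; clear -M0 h; lra.
- by rewrite !ler0_norm; clear -M0 h; lra.
Qed.

Lemma measurable_clip (M : R) u : measurable_fun D u -> measurable_fun D (fun x => clip M (u x)).
Proof.
move=> um; apply: measurable_maxr; first exact: measurable_cst.
by apply: measurable_minr => //; exact: measurable_cst.
Qed.

Lemma continuous_clip (M : R) g (x : R) : {for x, continuous g} -> {for x, continuous (fun t => clip M (g t))}.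
Proof.
move=> gc; apply: continuous_max; first exact: cst_continuous.
by apply: continuous_min => //; exact: cst_continuous.
Qed.

Lemma sin_pi_gt0 (x : R) : D x -> 0 < sin (pi * x).
Proof.
rewrite /= in_itv /= => /andP[x0 x1]; apply: sin_gt0_pi.
by rewrite mulr_gt0 ?pi_gt0 //= gtr_pMr // pi_gt0.
Qed.

Lemma continuous_sin_pi (k x : R) : {for x, continuous (fun t => sin (k * t))}.
Proof.
apply: (@continuous_comp _ _ _ (fun t => k * t) sin); last exact: continuous_sin.
exact: mulrl_continuous.
Qed.

Lemma continuous_cos_pi (k x : R) : {for x, continuous (fun t => cos (k * t))}.
Proof.
apply: (@continuous_comp _ _ _ (fun t => k * t) cos); last exact: continuous_cos.
exact: mulrl_continuous.
Qed.

Lemma measurable_sin_pi (k : R) : measurable_fun D (fun t => sin (k * t)).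
Proof.
apply: measurable_funTS; apply: continuous_measurable_fun => x.
exact: continuous_sin_pi.
Qed.

Lemma measurable_inv_sin_pi : measurable_fun D (fun t => (sin (pi * t))^-1).
Proof.
apply: open_continuous_measurable_fun; first exact: interval_open.
move=> x; rewrite inE => Dx; apply: cvgV; first by rewrite gt_eqF // sin_pi_gt0.
exact: continuous_sin_pi.
Qed.

(** The factor sin (pi x) is extracted because sin (pi x) p(cos (pi x)) is a sine polynomial. The
    quotient by it may blow up at the end points; clipping keeps the error below |u|, so dominated
    convergence applies. *)
Lemma approx_by_sin_mul_bounded u (e : R) : R2 u -> 0 < e ->
  exists (M : R) v, [/\ 0 <= M, measurable_fun D v, forall x, `|v x| <= M,
    R2 (fun x => u x - sin (pi * x) * v x) & sqnorm (fun x => u x - sin (pi * x) * v x) < e].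
Proof.
move=> uR e0; have [um ui] := uR.
pose v n x := clip n%:R (u x / sin (pi * x)).
have vm n : measurable_fun D (v n).
  by apply: measurable_clip; apply: measurable_funM => //; exact: measurable_inv_sin_pi.
have E n x : D x -> u x - sin (pi * x) * v n x =
    sin (pi * x) * (u x / sin (pi * x) - v n x).
  by move=> /sin_pi_gt0 s0; rewrite mulrBr (mulrC _ (u x / _)) divfK // gt_eqF.
have [|||n [nR nE]] := @sqnorm_dct (fun n x => u x - sin (pi * x) * v n x) u _ uR _ _ e e0.
- by move=> n; apply: measurable_funB => //; apply: measurable_funM => //; exact: measurable_sin_pi.
- move=> n x Dx; rewrite (E _ _ Dx) normrM.
  have s0 := sin_pi_gt0 Dx.
  apply: (@le_trans _ _ (`|sin (pi * x)| * `|u x / sin (pi * x)|)).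
    by rewrite ler_wpM2l // clip_dist0.
  by rewrite -normrM (mulrC _ (u x / _)) divfK // gt_eqF.
- move=> x Dx; apply/cvgrPdist_lt => d d0.
  exists (Num.truncn `|u x / sin (pi * x)|).+1 => // n /= hn.
  have h : `|u x / sin (pi * x)| <= n%:R.
    by rewrite (le_trans (ltW (truncnS_gt _))) // ler_nat.
  by rewrite (E _ _ Dx) /v clip_id // subrr mulr0 subr0 normr0.
exists n%:R, (v n); split => //.
by move=> x; exact: clip_norm.
Qed.

(** Density of continuous functions is available in the mean of order one; clipping at [M] upgrades
    it, since |v - g|^2 <= 2M |v - g|. *)
Lemma approx_by_continuous v (M e : R) : 0 <= M -> measurable_fun D v -> (forall x, `|v x| <= M) ->
  0 < e -> exists g, [/\ continuous g, forall x, `|g x| <= M & sqnorm (fun x => v x - g x) < e].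
Proof.
move=> M0 vm vM e0.
have vi : mu.-integrable D (EFin \o v).
  apply: measurable_bounded_integrable => //.
    by rewrite /= lebesgue_measure_itv /= lte_fin ltr01 -EFinB ltry.
  by exists M; split => [|B MB t _]; rewrite ?num_real //= (le_trans (vM _)) // ltW.
have Df : (mu D < +oo)%E.
  by rewrite /= lebesgue_measure_itv /= lte_fin ltr01 -EFinB ltry.
have [g_ [gc gi g0]] := approximation_continuous_integrable mD Df vi.
have e1 : 0 < e / (2 * M + 1) by rewrite divr_gt0 // ltr_wpDl // mulr_ge0.
have /fine_cvgP[_ /cvgrPdist_lt /(_ _ e1)[n _ /(_ n (leqnn n))]] := g0.
rewrite /= sub0r normrN => hn.
have hn' : \int[mu]_(x in D) `|v x - g_ n x| < e / (2 * M + 1).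
  by rewrite (le_lt_trans (ler_norm _)).
pose g x := clip M (g_ n x).
have gm : measurable_fun D (g_ n) by apply/measurable_EFinP; exact: measurable_int (gi n).
have di := integrable_norm (integrableB mD vi (gi n)).
have di' : mu.-integrable D (EFin \o (fun x => `|v x - g_ n x|)) by exact: eq_integrable di.
exists g; split.
- by move=> x; apply: continuous_clip; exact: gc.
- by move=> x; exact: clip_norm.
have dR : R2 (fun x => v x - g x).
  apply: (@R2_bounded _ (M + M)).
    by apply: measurable_funB => //; exact: measurable_clip.
  by move=> x _; rewrite (le_trans (ler_normB _ _)) // lerD // clip_norm.
apply: (@le_lt_trans _ _ (\int[mu]_(x in D) (2 * M * `|v x - g_ n x|))).
  apply: sqnorm_le => //; first by apply: eq_integrable (integrableZl mD (2 * M) di').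
  move=> x _; rewrite -real_normK ?num_real // expr2 ler_pM //.
    by rewrite (le_trans (ler_normB _ _)) // mulr_natl mulr2n lerD // clip_norm.
  exact: clip_dist.
rewrite RintegralZl //.
have M1 : 0 < 2 * M + 1 by rewrite ltr_wpDl // mulr_ge0.
move: hn'; rewrite ltr_pdivlMr // mulrC; apply: le_lt_trans.
by rewrite ler_wpM2r ?lerDl // Rintegral_ge0.
Qed.

(** Bernstein polynomials in (1 - cos (pi x)) / 2 converge pointwise on (0, 1) and inherit the bound
    [M], so dominated convergence gives convergence in square mean. *)
Lemma approx_by_cos_poly g (M e : R) : continuous g -> (forall x, `|g x| <= M) -> 0 < e ->
  exists p : {poly R}, R2 (fun x => g x - p.[cos (pi * x)]) /\
    sqnorm (fun x => g x - p.[cos (pi * x)]) < e.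
Proof.
move=> gc gM e0.
have M0 : 0 <= M := le_trans (normr_ge0 _) (gM 0).
pose q n : {poly R} := bernstein n (fun k => g (acos (1 - 2 * (k%:R / n%:R)) / pi)) \Po
   ((2^-1)%:P * (1 - 'X)).
have qE n x : (q n).[x] = (bernstein n (fun k => g (acos (1 - 2 * (k%:R / n%:R)) / pi))).[(1 - x) / 2].
  by rewrite /q horner_comp !hornerE mulrC.
have qM n x : `|(q n).[cos (pi * x)]| <= M.
  have yI : 0 <= (1 - cos (pi * x)) / 2 <= 1.
    by have := cos_le1 (pi * x); have := cos_geN1 (pi * x); lra.
  rewrite qE; set f := fun k : nat => _; rewrite -[X in `|X|]subr0.
  have h := @bernstein_dist_le R n f 0 M 0 0 _ yI.
  apply: (le_trans (h _)) => [k _|]; last by rewrite mul0r addr0.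
  by rewrite subr0 mul0r addr0 gM.
have qc n x : {for x, continuous (fun t => (q n).[cos (pi * t)])}.
  apply: (@continuous_comp _ _ _ (fun t => cos (pi * t)) (horner (q n))).
    exact: continuous_cos_pi.
  exact: continuous_horner.
have M2 : R2 (cst (M + M)).
  apply: (@R2_bounded _ (M + M)); first exact: measurable_cst.
  by move=> x _; rewrite /= ger0_norm // addr_ge0.
have [|||n [nR nE]] := @sqnorm_dct (fun n x => g x - (q n).[cos (pi * x)]) (cst (M + M)) _ M2 _ _ e e0.
- move=> n; apply: measurable_funTS; apply: continuous_measurable_fun => x.
  by apply: cvgB; [exact: gc|exact: qc].
- move=> n x _; rewrite (le_trans (ler_normB _ _)) //= [leRHS]ger0_norm ?addr_ge0 //.
  by rewrite lerD.
- move=> x; rewrite /= in_itv /= => xI; apply/cvgrPdist_lt => d d0.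
  have [N NP] := bernstein_cos_cvg xI (gc x) gM d0.
  by exists N => // n /= Nn; rewrite sub0r normrN distrC qE NP.
by exists (q n).
Qed.

End SineCompleteness.

(** * Sine polynomials and Fourier remainders *)

Section SineBasis.
Context {R : realType}.
Notation mu := (@lebesgue_measure R).
Notation TR := (measurableTypeR R).
Notation D := (`]0%R, 1%R[%classic : set TR).
Implicit Types (u v g h : R -> R).

Let mD : measurable D. Proof. exact: measurable_itv. Qed.

Definition sine (k : nat) (x : R) : R := sin (pi *+ k * x).

Lemma sine0 x : sine 0 x = 0.
Proof. by rewrite /sine mulr0n mul0r sin0. Qed.

Lemma cos_mul_sine k x :
  cos (pi * x) * sine k.+1 x = (sine k.+2 x + sine k x) / 2.
Proof.
have E1 : pi *+ k.+2 * x = pi *+ k.+1 * x + pi * x :> R by rewrite mulrSr mulrDl.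
have E2 : pi *+ k * x = pi *+ k.+1 * x - pi * x :> R by rewrite (mulrSr _ k) mulrDl addrK.
rewrite /sine E1 E2 (sinD (pi *+ k.+1 * x)) (sinB (pi *+ k.+1 * x)).
by move: (sin _) (cos _) (sin _) (cos _) => A B C E; field.
Qed.

Definition sine_poly u := exists m (c : nat -> R), forall x, u x = \sum_(k < m) c k * sine k x.

Lemma sine_poly_lincomb u v (a b : R) : sine_poly u -> sine_poly v ->
  sine_poly (fun x => a * u x + b * v x).
Proof.
move=> [m [c uE]] [n [d vE]].
have W (l : nat) (f : nat -> R) x : (l <= maxn m n)%N -> \sum_(k < l) f k * sine k x =
    \sum_(k < maxn m n) (if (k < l)%N then f k else 0) * sine k x.
  move=> lm; rewrite (big_ord_widen _ (fun k => f k * sine k x) lm) big_mkcond /=.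
  by apply: eq_bigr => k _; case: ifP => // _; rewrite mul0r.
exists (maxn m n), (fun k => a * (if (k < m)%N then c k else 0) + b * (if (k < n)%N then d k else 0)).
move=> x; rewrite uE vE (W _ _ _ (leq_maxl m n)) (W _ _ _ (leq_maxr m n)).
rewrite !mulr_sumr -big_split; apply: eq_bigr => k _ /=.
by rewrite [RHS]mulrDl !mulrA.
Qed.

Lemma sine_poly_sine k : sine_poly (sine k).
Proof.
exists k.+1, (fun j => (j == k)%:R) => x.
rewrite big_ord_recr /= eqxx mul1r big1 ?add0r // => i _.
by rewrite (ltn_eqF (ltn_ord i)) mul0r.
Qed.

Lemma sine_poly0 : sine_poly (fun=> 0).
Proof. by exists 0%N, (fun=> 0) => x; rewrite big_ord0. Qed.

Lemma sine_poly_cos u : sine_poly u -> sine_poly (fun x => cos (pi * x) * u x).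
Proof.
move=> [m [c uE]]; have -> : u = fun x => \sum_(k < m) c k * sine k x by apply/funext.
elim: m {uE} => [|m IH].
  by have := sine_poly0; congr sine_poly; apply/funext => x; rewrite big_ord0 mulr0.
have H : sine_poly (fun x => cos (pi * x) * sine m x).
  case: m {IH} => [|m].
    by have := sine_poly0; congr sine_poly; apply/funext => x; rewrite sine0 mulr0.
  have := sine_poly_lincomb 2^-1 2^-1 (sine_poly_sine m.+2) (sine_poly_sine m).
  by congr sine_poly; apply/funext => x; rewrite cos_mul_sine -mulrDr mulrC.
have := sine_poly_lincomb 1 (c m) IH H; congr sine_poly; apply/funext => x.
by rewrite big_ord_recr /= mul1r mulrDr; congr (_ + _); rewrite mulrCA.
Qed.

(** Multiplication by cos (pi x) preserves sine polynomials by [cos_mul_sine]; induction follows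
    Horner's scheme from sin (pi x) itself. *)
Lemma sine_poly_horner (p : {poly R}) : sine_poly (fun x => sin (pi * x) * p.[cos (pi * x)]).
Proof.
elim/poly_ind: p => [|p c IH].
  by have := sine_poly0; congr sine_poly; apply/funext => x; rewrite horner0 mulr0.
have := sine_poly_lincomb 1 c (sine_poly_cos IH) (sine_poly_sine 1).
congr sine_poly; apply/funext => x; rewrite hornerMXaddC /sine mulr1n.
by move: (sin _) (cos _) => s t; ring.
Qed.

Definition ip u v : R := \int[mu]_(x in D) (u x * v x).

Lemma ip_lincombr u v w (a b : R) : R2 u -> R2 v -> R2 w ->
  ip u (fun x => a * v x + b * w x) = a * ip u v + b * ip u w.
Proof.
move=> uR vR wR; have vi := R2_mul_integrable uR vR; have wi := R2_mul_integrable uR wR.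
have vi' := integrableZl mD a vi; have wi' := integrableZl mD b wi.
rewrite /ip -!RintegralZl // -RintegralD //.
by apply: eq_Rintegral => x _; move: (u x) (v x) (w x) => U V W; ring.
Qed.

Lemma ipC u v : ip u v = ip v u.
Proof. by apply: eq_Rintegral => x _; rewrite mulrC. Qed.

Lemma sqnorm_ip u : sqnorm u = ip u u.
Proof. by apply: eq_Rintegral => x _; rewrite expr2. Qed.

Lemma sine_R2 k : R2 (sine k).
Proof.
apply: (@R2_bounded R _ 1); first exact: measurable_sin_pi.
by move=> x _; rewrite ler_norml sin_le1 sin_geN1.
Qed.

Lemma R2_0 : R2 (cst 0 : R -> R).
Proof. by apply: (@R2_bounded R _ 0); [exact: measurable_cst|move=> x _; rewrite normr0]. Qed.

Lemma sine_sum_R2 (c : nat -> R) (s : seq nat) : R2 (fun x => \sum_(k <- s) c k * sine k x).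
Proof.
elim: s => [|k s IH].
  by have := R2_0; congr R2; apply/funext => x; rewrite big_nil.
have := R2_lincomb (c k) 1 (sine_R2 k) IH; congr R2; apply/funext => x.
by rewrite big_cons mul1r.
Qed.

Lemma ip_sine_sum u (c : nat -> R) (s : seq nat) : R2 u ->
  ip u (fun x => \sum_(k <- s) c k * sine k x) = \sum_(k <- s) c k * ip u (sine k).
Proof.
move=> uR; elim: s => [|k s IH].
  transitivity (ip u (fun x => 0 * cst 0 x + 0 * cst 0 x)).
    by apply: eq_Rintegral => x _; rewrite big_nil !mul0r addr0.
  by rewrite (ip_lincombr 0 0 uR R2_0 R2_0) big_nil !mul0r addr0.
have := ip_lincombr (c k) 1 uR (sine_R2 k) (sine_sum_R2 c s).
rewrite big_cons IH mul1r => <-; apply: eq_Rintegral => x _.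
by rewrite big_cons mul1r.
Qed.

Lemma integral_cos_mul (c : R) : c != 0 -> sin c = 0 -> \int[mu]_(x in D) cos (c * x) = 0.
Proof.
move=> c0 sc.
have dc (x : R) : is_derive x (1 : R) (fun t => c * t) c.
  by have := @is_deriveZ _ _ _ _ c _ _ _ (is_derive_id x (1 : R)); rewrite /GRing.scale /= mulr1.
have h (x : R) : is_cderive (fun t => (c^-1 * sin (c * t))%:C) x (cos (c * x))%:C.
  apply: is_cderive_real.
  have ds := @is_derive1_comp R sin (fun t => c * t) x _ _ (is_derive_sin (c * x)) (dc x).
  have := @is_deriveZ _ _ _ _ c^-1 _ _ _ ds.
  by rewrite /GRing.scale /= mulrCA mulVf // mulr1.
have h' (x : R) : is_cderive (fun t => (cos (c * t))%:C) x (- sin (c * x) * c)%:C.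
  have ds := @is_derive1_comp R cos (fun t => c * t) x _ _ (is_derive_cos (c * x)) (dc x).
  exact: is_cderive_real ds.
have := cintegral_FTC2 (@ltr01 R) h h'.
rewrite cintegral_oo_cc; last first.
  exact: (@is_cderive_cintegrable R _ _ 0 1 h').
move/(congr1 (@complex.Re R)).
by rewrite cReD cReN /= mulr1 mulr0 sc sin0 mulr0 subr0.
Qed.

Lemma ip_sine j k : ip (sine j.+1) (sine k.+1) = (j == k)%:R / 2.
Proof.
have s0 n : sin (pi *+ n) = 0 :> R.
  by have [_] := @cos_sin_natpi R n; rewrite mulr_natl.
have P (c : R) : mu.-integrable D (EFin \o (fun x : R => cos (c * x))).
  apply: measurable_bounded_integrable => //.
  - by rewrite /= lebesgue_measure_itv /= lte_fin ltr01 -EFinB ltry.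
  - apply: measurable_funTS; apply: continuous_measurable_fun => x.
    exact: continuous_cos_pi.
  by exists 1; split => [|B MB t _]; rewrite ?num_real //= (le_trans _ (ltW MB)) // ler_norml cos_le1 cos_geN1.
have E x : sine j.+1 x * sine k.+1 x = 
   2^-1 * cos ((pi *+ j.+1 - pi *+ k.+1) * x) - 2^-1 * cos ((pi *+ j.+1 + pi *+ k.+1) * x).
  rewrite /sine mulrBl mulrDl (cosB (pi *+ j.+1 * x)) (cosD (pi *+ j.+1 * x)).
  by move: (sin _) (cos _) (sin _) (cos _) => A B C F; field.
have -> : ip (sine j.+1) (sine k.+1) = 
   2^-1 * \int[mu]_(x in D) cos ((pi *+ j.+1 - pi *+ k.+1) * x) -
   2^-1 * \int[mu]_(x in D) cos ((pi *+ j.+1 + pi *+ k.+1) * x).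
  rewrite /ip -!RintegralZl // -RintegralB //.
  - by apply: eq_Rintegral => x _; rewrite E.
  - exact: (integrableZl mD 2^-1 (P _)).
  - exact: (integrableZl mD 2^-1 (P _)).
rewrite (integral_cos_mul (c := pi *+ j.+1 + pi *+ k.+1)); last 2 first.
- by rewrite gt_eqF // addr_gt0 // pmulrn_lgt0 // pi_gt0.
- by rewrite (sinD (pi *+ j.+1)) !s0 mulr0 mul0r addr0.
rewrite mulr0 subr0 mulrC; congr (_ / _); case: eqP => [->|/eqP jk].
  rewrite subrr; under eq_Rintegral do rewrite mul0r cos0.
  by rewrite Rintegral_cst // /= lebesgue_measure_itv /= lte_fin ltr01 -EFinB /= subr0 mulr1.
rewrite (integral_cos_mul (c := pi *+ j.+1 - pi *+ k.+1)) //.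
- apply: contra jk; rewrite subr_eq0 -[pi *+ j.+1]mulr_natl -[pi *+ k.+1]mulr_natl.
  by rewrite (inj_eq (mulIf _)) ?eqr_nat ?eqSS // gt_eqF ?pi_gt0.
- by rewrite (sinB (pi *+ j.+1)) !s0 mulr0 mul0r subr0.
Qed.

(** The factor 2 normalizes the coefficients, as each sine has squared norm 1/2. *)
Definition sine_remainder u n x := u x - \sum_(1 <= k < n.+1) 2 * ip u (sine k) * sine k x.

Lemma sine_remainder_R2 u n : R2 u -> R2 (sine_remainder u n).
Proof.
move=> uR; have := R2_lincomb 1 (-1) uR (sine_sum_R2 (fun k => 2 * ip u (sine k)) (index_iota 1 n.+1)).
by congr R2; apply/funext => x; rewrite mul1r mulN1r.
Qed.

Lemma sine_remainder_ip u n j : R2 u -> (0 < j <= n)%N -> ip (sine_remainder u n) (sine j) = 0.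
Proof.
move=> uR; case: j => // j /= jn.
have sR := sine_sum_R2 (fun k => 2 * ip u (sine k)) (index_iota 1 n.+1).
transitivity (ip (sine j.+1) (fun x => 1 * u x + -1 * \sum_(1 <= k < n.+1) 2 * ip u (sine k) * sine k x)).
  by rewrite ipC; apply: eq_Rintegral => x _; rewrite mul1r mulN1r.
rewrite (ip_lincombr _ _ (sine_R2 _) uR sR) (ip_sine_sum _ _ (sine_R2 _)).
rewrite mul1r mulN1r (bigD1_seq j.+1) ?iota_uniq ?mem_index_iota //=.
rewrite big_add1 /= big1_seq ?addr0 => [|k]; last first.
  by rewrite eqSS eq_sym => /andP[/negPf jk _]; rewrite ip_sine jk mul0r mulr0.
by rewrite ip_sine eqxx (ipC u) /=; move: (ip _ _) => A; field.
Qed.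

(* The remainder is orthogonal to every sine polynomial of degree at most n. *)
Lemma sine_remainder_best u n m (c : nat -> R) : R2 u -> (m <= n.+1)%N ->
  sqnorm (sine_remainder u n) <= sqnorm (fun x => u x - \sum_(k < m) c k * sine k x).
Proof.
move=> uR mn; have rR := sine_remainder_R2 n uR.
pose v x := \sum_(1 <= k < n.+1) 2 * ip u (sine k) * sine k x.
pose w x := \sum_(k <- iota 0 m) c k * sine k x.
have vR : R2 v by exact: (sine_sum_R2 (fun k => 2 * ip u (sine k))).
have wR : R2 w by exact: sine_sum_R2.
have dR := R2_lincomb 1 (-1) vR wR.
have s0 : ip (sine_remainder u n) (sine 0) = 0.
  transitivity (ip (sine_remainder u n) (fun x => 0 * cst 0 x + 0 * cst 0 x)).
    by apply: eq_Rintegral => x _; rewrite sine0 !mul0r addr0.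
  by rewrite (ip_lincombr 0 0 rR R2_0 R2_0) !mul0r addr0.
have rd : ip (sine_remainder u n) (fun x => 1 * v x + -1 * w x) = 0.
  rewrite (ip_lincombr 1 (-1) rR vR wR).
  rewrite (ip_sine_sum (fun k => 2 * ip u (sine k)) (index_iota 1 n.+1) rR).
  rewrite (ip_sine_sum c (iota 0 m) rR) !big1_seq ?mulr0 ?addr0 //.
  - move=> [|k]; rewrite ?s0 ?mulr0 // mem_iota add0n /= => km.
    by rewrite (sine_remainder_ip uR) ?mulr0 //= -ltnS (leq_trans _ mn).
  - move=> k; rewrite mem_index_iota => /= kn.
    by rewrite (sine_remainder_ip uR) ?mulr0.
have E : sqnorm (fun x => u x - \sum_(k < m) c k * sine k x) =
  ip (fun x => 1 * sine_remainder u n x + 1 * (1 * v x + -1 * w x))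
     (fun x => 1 * sine_remainder u n x + 1 * (1 * v x + -1 * w x)).
  rewrite sqnorm_ip; apply: eq_Rintegral => x _.
  suff -> : u x - \sum_(k < m) c k * sine k x = 1 * sine_remainder u n x + 1 * (1 * v x + -1 * w x) by [].
  have -> : \sum_(k < m) c k * sine k x = w x by rewrite -(big_mkord xpredT (fun k => c k * sine k x)) /w /index_iota subn0.
  by rewrite /sine_remainder -/(v x); move: (u x) (v x) (w x) => U V W; ring.
have sR := R2_lincomb 1 1 rR dR.
rewrite E (ip_lincombr 1 1 sR rR dR) !mul1r ipC (ip_lincombr 1 1 rR rR dR) rd.
rewrite ipC (ip_lincombr 1 1 dR rR dR) (ipC _ (sine_remainder u n)) rd -!sqnorm_ip.
rewrite ?mul1r ?mulr0 ?addr0 ?add0r lerDl; exact: sqnorm_ge0.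
Qed.

(** Best approximation reduces the claim to one good sine polynomial. It is found through the chain
    u, sin v, sin g, sin p(cos), where multiplication by the sine does not increase errors. *)
Lemma sine_remainder_cvg u (e : R) : R2 u -> 0 < e ->
  exists N, forall n, (N <= n)%N -> sqnorm (sine_remainder u n) < e.
Proof.
(* Three errors of e/16 each; two applications of [sqnorm_add_le] give the total 2/16 + 8/16 of
   [e]. *)
move=> uR e0; have e8 : 0 < e / 16 by rewrite divr_gt0.
have [M [v [M0 vm vM dR dE]]] := approx_by_sin_mul_bounded uR e8.
have [g [gc gM gE]] := approx_by_continuous M0 vm vM e8.
have [p [pR pE]] := approx_by_cos_poly gc gM e8.
have [m [c cE]] := sine_poly_horner p.
exists m => n mn; apply: le_lt_trans (sine_remainder_best c uR (leqW mn)) _.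
have vgR : R2 (fun x => v x - g x).
  apply: (@R2_bounded R _ (M + M)).
    apply: measurable_funB => //; apply: measurable_funTS; exact: continuous_measurable_fun.
  by move=> x _; rewrite (le_trans (ler_normB _ _)) // lerD.
have vpR := R2_lincomb 1 1 vgR pR.
have sR : R2 (fun x => sin (pi * x) * (v x - p.[cos (pi * x)])).
  apply: (R2_le _ vpR.2).
    apply: measurable_funM; first exact: measurable_sin_pi.
    have := vpR.1; congr measurable_fun; apply/funext => x; rewrite !mul1r.
    by rewrite addrA subrK.
  move=> x _; rewrite !mul1r addrA subrK exprMn ler_piMl ?sqr_ge0 //.
  
have sE : sqnorm (fun x => sin (pi * x) * (v x - p.[cos (pi * x)])) <= 2 * (e / 16) + 2 * (e / 16).
  apply: (@le_trans _ _ (sqnorm (fun x => (v x - g x) + (g x - p.[cos (pi * x)])))).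
    have vpR' : R2 (fun x => (v x - g x) + (g x - p.[cos (pi * x)])).
      by have := vpR; congr R2; apply/funext => x; rewrite !mul1r.
    apply: sqnorm_le vpR'.2 _ => // x _.
    rewrite addrA subrK exprMn ler_piMl ?sqr_ge0 //.
  apply: le_trans (sqnorm_add_le vgR pR) _.
  by rewrite lerD // ler_pM2l // ltW.
have -> : (fun x => u x - \sum_(k < m) c k * sine k x) =
    (fun x => (u x - sin (pi * x) * v x) + sin (pi * x) * (v x - p.[cos (pi * x)])).
  by apply/funext => x; rewrite -cE mulrBr addrA subrK.
apply: le_lt_trans (sqnorm_add_le dR sR) _.
move: dE sE; move: (sqnorm _) (sqnorm _) => A B; clear -e0; lra.
Qed.

End SineBasis.

(** * Recovering the potential *)

Section SineSeries.
Context {R : realType}.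
Notation mu := (@lebesgue_measure R).
Notation TR := (measurableTypeR R).
Notation D := (`]0%R, 1%R[%classic : set TR).
Implicit Types (q w : R -> R[i]) (a : R) (gamma : R[i]) (lam : nat -> R[i]).

Let mD : measurable D. Proof. exact: measurable_itv. Qed.

Lemma L2_R2 w : L2 D w -> R2 (fun x => Re (w x)) /\ R2 (fun x => Im (w x)).
Proof.
move=> wL; have [w1 w2 _] := wL; have wi := L2_integrable_sqr wL.
by split; apply: (R2_le _ wi) => // x _; rewrite sqr_cabs ?lerDl ?lerDr sqr_ge0.
Qed.

Lemma L2_of_R2 u v : R2 u -> R2 v -> L2 D (fun x => u x +i* v x).
Proof.
move=> [um ui] [vm vi]; apply: (L2_le mD (h := fun x => u x ^+ 2 + v x ^+ 2)) => //.
  by move=> x _; rewrite sqr_cabs.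
by apply: eq_integrable (integrableD mD ui vi).
Qed.

Lemma integral_sqr_cabs u v : R2 u -> R2 v ->
  (\int[mu]_(x in D) (cabs (u x +i* v x) ^+ 2)%:E = (sqnorm u + sqnorm v)%:E)%E.
Proof.
move=> [um ui] [vm vi].
rewrite /sqnorm -RintegralD // /Rintegral fineK; last first.
  by apply: integrable_fin_num => //; exact: eq_integrable (integrableD mD ui vi).
by apply: eq_integral => x _; rewrite sqr_cabs.
Qed.

(** The sines are real, so the partial sums split into the Fourier sums of the real and the
    imaginary part, and real completeness applies to each. *)
Lemma is_w_of_coef gamma lam w : L2 D w ->
  (forall k, f_of gamma lam (pi *+ k.+1)%:C =
     cintegral D (fun y => (sine k.+1 y)%:C * w y)) ->
  is_w gamma lam w.
Proof.
move=> wL fE; split => //; have [w1 w2] := L2_R2 wL.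
have E n x : w x - 2 * (\sum_(1 <= k < n.+1)
   f_of gamma lam (pi *+ k)%:C * (sin (pi *+ k * x))%:C) =
   sine_remainder (fun x => Re (w x)) n x +i* sine_remainder (fun x => Im (w x)) n x.
  have cE k : f_of gamma lam (pi *+ k)%:C * (sin (pi *+ k * x))%:C =
      (ip (fun x => Re (w x)) (sine k) * sine k x) +i* (ip (fun x => Im (w x)) (sine k) * sine k x).
    case: k => [|k].
      by rewrite -/(sine 0 x) sine0 !mulr0.
    rewrite fE /cintegral -/(sine k.+1 x).
    have -> : \int[mu]_(y in D) Re ((sine k.+1 y)%:C * w y) = ip (fun x => Re (w x)) (sine k.+1).
      by apply: eq_Rintegral => y _; rewrite cReM /= mul0r subr0 mulrC.
    have -> : \int[mu]_(y in D) Im ((sine k.+1 y)%:C * w y) = ip (fun x => Im (w x)) (sine k.+1).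
      by apply: eq_Rintegral => y _; rewrite cImM /= mul0r addr0 mulrC.
    by apply: complex_eqP; rewrite ?cReM ?cImM /= !mulr0 ?subr0 ?add0r.
  under eq_bigr do rewrite cE; clear cE.
  rewrite /sine_remainder; under [X in _ = (_ - X) +i* _]eq_bigr do rewrite -mulrA.
  under [X in _ = _ +i* (_ - X)]eq_bigr do rewrite -mulrA.
  rewrite -!mulr_sumr; elim: n.+1 => [|m IH].
    rewrite !big_geq // !mulr0 !subr0; by case: (w x).
  case: m IH => [_|m IH]; first by rewrite !big_geq // !mulr0 !subr0; case: (w x).
  rewrite !(@big_nat_recr _ _ _ m.+1) //= !mulrDr !opprD !addrA IH.
  by apply: complex_eqP; rewrite ?cReD ?cImD ?cReN ?cImN ?cReM ?cImM /=; set A := ip _ _; set B := sine _ _; ring.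
apply/fine_cvgP; split.
  apply: nearW => n; under eq_integral do rewrite E.
  by rewrite integral_sqr_cabs //; exact: sine_remainder_R2.
apply/cvgrPdist_lt => e e0; have e2 : 0 < e / 2 by rewrite divr_gt0.
have [N1 h1] := sine_remainder_cvg w1 e2; have [N2 h2] := sine_remainder_cvg w2 e2.
exists (maxn N1 N2) => // n; rewrite /= geq_max => /andP[/h1 {}h1 /h2 {}h2].
under eq_integral do rewrite E.
rewrite integral_sqr_cabs; [|exact: sine_remainder_R2|exact: sine_remainder_R2].
rewrite /= sub0r normrN ger0_norm; last by rewrite addr_ge0 ?sqnorm_ge0.
by rewrite [ltRHS](splitr e); exact: ltrD h1 h2.
Qed.

Lemma sin_div_real (c y : R) : c != 0 -> c%:C * sin_div c%:C y = (sin (c * y))%:C.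
Proof.
move=> c0; have c0' : c%:C != 0 :> R[i] by rewrite eq_complex /= (negPf c0).
rewrite /sin_div (negPf c0') mulrCA mulfV // mulr1 -rmorphM csinE /=.
rewrite /coshR /sinhR oppr0 subrr mul0r mulr0 !expR0 -(natrD _ 1 1) divff ?mulr1 //.
Qed.

Lemma f_of_coef q a gamma lam k : 0 <= a <= 1 -> gamma = 1 \/ gamma = -1 ->
  L2 D q -> is_spectrum q a gamma lam -> numbered gamma lam ->
  f_of gamma lam (pi *+ k.+1)%:C = cintegral D (fun y => (sine k.+1 y)%:C * w_pot gamma q a y).
Proof.
move=> aI gE qL qS num; have wi := L2_cintegrable (w_pot_L2 gamma aI qL).
have p0 : pi *+ k.+1 != 0 :> R by rewrite mulrn_eq0 /= gt_eqF // pi_gt0.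
rewrite /f_of (Delta_prod_char_fun _ aI gE qL qS num) (char_fun_formula _ aI gE qL).
rewrite /sine; move: (pi *+ k.+1) p0 => c c0.
(* The chosen root may be [c] or [- c]; the cosine and [sin_div] are even, so both give the same
   value. *)
have r2 : sqrtC (c%:C ^+ 2) ^+ 2 = c%:C ^+ 2 by exact: sqrtCK.
rewrite (ccos_sqr r2) (gamma2 gE).
have sE y : sin_div (sqrtC (c%:C ^+ 2)) y = sin_div c%:C y.
  by move/eqP: r2; rewrite eqf_sqr => /orP[] /eqP->; rewrite ?sin_divN.
have -> : cintegral D (fun y => sin_div (sqrtC (c%:C ^+ 2)) y * w_pot gamma q a y) =
   cintegral D (fun y => sin_div c%:C y * w_pot gamma q a y).
  by apply: eq_cintegral => y _; rewrite sE.
have -> : cintegral D (fun y => (sin (c * y))%:C * w_pot gamma q a y) =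
   c%:C * cintegral D (fun y => sin_div c%:C y * w_pot gamma q a y).
  rewrite -cintegralZ //; last exact: sin_div_integrable01.
  by apply: eq_cintegral => y _; rewrite mulrA sin_div_real.
move: (cintegral _ _) (ccos _) => I C; ring.
Qed.

Lemma is_w_w_pot q a gamma lam : 0 <= a <= 1 -> gamma = 1 \/ gamma = -1 ->
  L2 D q -> is_spectrum q a gamma lam -> numbered gamma lam ->
  is_w gamma lam (w_pot gamma q a).
Proof.
move=> aI gE qL qS num; apply: is_w_of_coef; first exact: w_pot_L2.
by move=> k; exact: f_of_coef.
Qed.

End SineSeries.

(** * Almost everywhere identities and uniqueness of [w] *)

Section AlmostEverywhere.
Context {R : realType}.
Notation mu := (@lebesgue_measure R).
Notation TR := (measurableTypeR R).
Notation D := (`]0%R, 1%R[%classic : set TR).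
Implicit Types (q w p : R -> R[i]) (a : R) (gamma : R[i]) (lam : nat -> R[i]).

Let mD : measurable D. Proof. exact: measurable_itv. Qed.

Lemma ae_mono (P Q : R -> Prop) : (forall x, P x -> Q x) ->
  (\forall x \ae mu, P x) -> \forall x \ae mu, Q x.
Proof.
by have F : Filter (almost_everywhere mu) := ae_filter_ringOfSetsType mu; exact: filterS.
Qed.

Lemma ae_and (P Q : R -> Prop) : (\forall x \ae mu, P x) -> (\forall x \ae mu, Q x) ->
  \forall x \ae mu, P x /\ Q x.
Proof.
by have F : Filter (almost_everywhere mu) := ae_filter_ringOfSetsType mu; exact: filterI.
Qed.

Lemma ae_affine (P : R -> Prop) (s b : R) : s = 1 \/ s = -1 ->
  (\forall x \ae mu, P x) -> \forall x \ae mu, P (s * x + b).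
Proof.
move=> s1 [A [mA A0 PA]].
exists ((fun x : R => s * x + b) @^-1` A); split.
- exact: (measurable_affine_preimage s b mA).
- by rewrite -(lebesgue_measure_affine b s1 mA).
- by move=> x /= h; apply: PA.
Qed.

Lemma ae_shift (P : R -> Prop) (b : R) : (\forall x \ae mu, P x) -> \forall x \ae mu, P (x + b).
Proof.
move=> /(ae_affine b (or_introl erefl : 1 = 1 \/ 1 = -1)); apply: ae_mono => x.
by rewrite mul1r.
Qed.

Lemma ae_onem (P : R -> Prop) : (\forall x \ae mu, P x) -> \forall x \ae mu, P (1 - x).
Proof.
move=> /(ae_affine 1 (or_intror erefl : -1 = 1 \/ -1 = -1)); apply: ae_mono => x.
by rewrite mulN1r addrC.
Qed.

Lemma ae_neq (c : R) : \forall x \ae mu, x != c.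
Proof.
exists [set c]; split; [exact: measurable_set1|exact: lebesgue_measure_set1|].
by move=> x /= /negP; rewrite negbK => /eqP.
Qed.

Lemma ae_eq_cintegral (f g : R -> R[i]) : cintegrable D f -> cintegrable D g ->
  (\forall x \ae mu, D x -> f x = g x) -> cintegral D f = cintegral D g.
Proof.
move=> [f1 f2] [g1 g2] fg; rewrite /cintegral /Rintegral; congr (fine _ +i* fine _).
- have h := @ae_eq_integral _ TR R mu D (fun x => (Re (g x))%:E) (fun x => (Re (f x))%:E) mD (measurable_int _ f1) (measurable_int _ g1).
  apply: h.
  by apply: ae_mono fg => x h /h ->.
- have h := @ae_eq_integral _ TR R mu D (fun x => (Im (g x))%:E) (fun x => (Im (f x))%:E) mD (measurable_int _ f2) (measurable_int _ g2).
  apply: h.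
  by apply: ae_mono fg => x h /h ->.
Qed.

Lemma L2Z (E : set TR) (f : R -> R[i]) c : measurable E -> L2 E f -> L2 E (fun x => c * f x).
Proof.
move=> mE fL; have := L2_addM (c - 1) mE fL fL; congr L2; apply/funext => x.
by move: (f x) => y; ring.
Qed.

Lemma sine_sum_L2 (c : nat -> R[i]) n :
  L2 D (fun x => 2 * \sum_(1 <= k < n.+1) c k * (sin (pi *+ k * x))%:C).
Proof.
apply: L2Z => //; elim: (index_iota _ _) => [|k s IH].
  have := L2_of_R2 (@R2_0 R) (@R2_0 R); apply: L2_eq => // x _.
  by rewrite big_nil.
have := L2_addM (c k) mD IH (L2_of_R2 (sine_R2 k) R2_0); apply: L2_eq => // x _.
by rewrite big_cons addrC.
Qed.

Lemma is_w_unique gamma lam w1 w2 : is_w gamma lam w1 -> is_w gamma lam w2 ->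
  \forall x \ae mu, D x -> w1 x = w2 x.
Proof.
move=> [L1 /fine_cvgP[_ c1]] [L2w /fine_cvgP[_ c2]].
pose S n x := 2 * \sum_(1 <= k < n.+1) f_of gamma lam (pi *+ k)%:C * (sin (pi *+ k * x))%:C.
have SL n : L2 D (S n) := sine_sum_L2 (fun k => f_of gamma lam (pi *+ k)%:C) n.
have dL : L2 D (fun x => w1 x + -1 * w2 x) by exact: L2_addM.
have di := L2_integrable_sqr dL.
have I0 : \int[mu]_(x in D) (cabs (w1 x + -1 * w2 x) ^+ 2) = 0.
  apply/eqP; rewrite eq_le; apply/andP; split; last by apply: Rintegral_ge0 => x _; exact: sqr_ge0.
  apply/ler_addgt0Pr => e e0; rewrite add0r.
  have e4 : 0 < e / 4 by rewrite divr_gt0.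
  have /cvgrPdist_lt /(_ _ e4) [n1 _ h1] := c1.
  have /cvgrPdist_lt /(_ _ e4) [n2 _ h2] := c2.
  have {}h1 := h1 (maxn n1 n2) (leq_maxl n1 n2); have {}h2 := h2 (maxn n1 n2) (leq_maxr n1 n2).
  move: h1 h2; rewrite /= !sub0r !normrN; set n := maxn n1 n2 => h1 h2.
  have i1 := L2_integrable_sqr (L2_addM (-1) mD L1 (SL n)).
  have i2 := L2_integrable_sqr (L2_addM (-1) mD L2w (SL n)).
  have i1' := integrableZl mD 2 i1; have i2' := integrableZl mD 2 i2.
  have h1' : \int[mu]_(x in D) (cabs (w1 x + -1 * S n x) ^+ 2) < e / 4.
    apply: le_lt_trans h1; apply: le_trans (ler_norm _).
    by rewrite le_eqVlt; apply/orP; left; apply/eqP; apply: eq_Rintegral => x _; rewrite mulN1r.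
  have h2' : \int[mu]_(x in D) (cabs (w2 x + -1 * S n x) ^+ 2) < e / 4.
    apply: le_lt_trans h2; apply: le_trans (ler_norm _).
    by rewrite le_eqVlt; apply/orP; left; apply/eqP; apply: eq_Rintegral => x _; rewrite mulN1r.
  apply: (@le_trans _ _ (\int[mu]_(x in D) (2 * cabs (w1 x + -1 * S n x) ^+ 2 + 2 * cabs (w2 x + -1 * S n x) ^+ 2))).
    apply: le_Rintegral => //; first by apply: eq_integrable (integrableD mD i1' i2').
    move=> x _; apply: sqr_le_twice; first exact: cabs_ge0.
    have -> : w1 x + -1 * w2 x = (w1 x + -1 * S n x) - (w2 x + -1 * S n x) by ring.
    exact: cabs_leB.
  rewrite RintegralD // !RintegralZl //.
  move: h1' h2'; move: (Rintegral _ _ _) (Rintegral _ _ _) => A B; clear; lra.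
have I0' : (\int[mu]_(x in D) `|(cabs (w1 x + -1 * w2 x) ^+ 2)%:E| = 0)%E.
  under eq_integral do rewrite gee0_abs ?lee_fin ?sqr_ge0 //.
  by rewrite -[LHS]fineK ?integrable_fin_num // -[fine _]/(Rintegral _ _ _) I0.
have /ae_eq_integral_abs := I0'.
move=> /(_ mD (measurable_int _ di)); apply: ae_mono => x h Dx; have := h Dx => /=.
move=> [] /eqP; rewrite sqrf_eq0 cabs_eq0.
by rewrite mulN1r subr_eq0 => /eqP.
Qed.

End AlmostEverywhere.

(** * The two inclusions *)

Section Isospectral.
Context {R : realType}.
Notation mu := (@lebesgue_measure R).
Notation TR := (measurableTypeR R).
Notation D := (`]0%R, 1%R[%classic : set TR).
Implicit Types (q w p : R -> R[i]) (a : R) (gamma : R[i]) (lam : nat -> R[i]).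

Let mD : measurable D. Proof. exact: measurable_itv. Qed.

Lemma L2_comp_add (b c d : R) (f : R -> R[i]) : L2 `]c, d[ f ->
  L2 `]c - b, d - b[ (fun x => f (x + b)).
Proof.
move=> /(L2_affine b (or_introl erefl : 1 = 1 \/ 1 = -1) (measurable_itv _)).
have -> : (fun x : R => 1 * x + b) @^-1` `]c, d[ = `]c - b, d - b[%classic.
  by apply/seteqP; split=> x /=; rewrite !in_itv /= mul1r ltrBlDr ltrBrDr.
by apply: L2_eq; [exact: measurable_itv|move=> x _; rewrite mul1r].
Qed.

Lemma L2_comp_sub (b c d : R) (f : R -> R[i]) : L2 `]c, d[ f ->
  L2 `]b - d, b - c[ (fun x => f (b - x)).
Proof.
move=> /(L2_affine b (or_intror erefl : -1 = 1 \/ -1 = -1) (measurable_itv _)).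
have -> : (fun x : R => -1 * x + b) @^-1` `]c, d[ = `]b - d, b - c[%classic.
  by apply/seteqP; split=> x /=; rewrite !in_itv /= => /andP[h1 h2]; apply/andP; split; lra.
by apply: L2_eq; [exact: measurable_itv|move=> x _; rewrite mulN1r addrC].
Qed.

Lemma L2_subitv (a b c d : R) (f : R -> R[i]) : a <= c -> d <= b ->
  L2 `]a, b[ f -> L2 `]c, d[ f.
Proof.
move=> ac db; apply: L2_sub; try exact: measurable_itv.
by move=> x /=; rewrite !in_itv /= => /andP[cx xd]; rewrite (le_lt_trans ac) // (lt_le_trans xd).
Qed.

Lemma qa_of_L2 gamma w p : L2 D w -> L2 `]0, 2^-1[ p -> L2 D (qa_of gamma w p).
Proof.
move=> wL pL; have h0 : 0 <= 2^-1 :> R by rewrite invr_ge0.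
have h1 : 2^-1 <= 1 :> R by rewrite invf_le1 // ler1n.
have mI (c d : R) : measurable (`]c, d[%classic : set TR) by exact: measurable_itv.
apply: (L2_glue h0 h1).
  have := L2_comp_sub 2^-1 pL; rewrite subrr subr0; apply: L2_eq => // y.
  by rewrite inE /= in_itv /= => /andP[_ y1]; rewrite /qa_of y1.
have w1 := L2_subitv h0 (lexx _) (L2_onem wL).
have p1 := L2_comp_add (- 2^-1) pL; rewrite sub0r opprK in p1.
rewrite (_ : 2^-1 + 2^-1 = 1 :> R) in p1; last by field.
have := L2_addM (- gamma) (mI _ _) (L2Z gamma (mI _ _) w1) p1; apply: L2_eq => // y.
rewrite inE /= in_itv /= => /andP[y1 _]; rewrite /qa_of ltNge (ltW y1) /= mulNr.
by congr (_ * w _ - _); field.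
Qed.

Lemma q_of_L2 a gamma lam p : 0 <= a <= 1 -> L2 D (w_of gamma lam) ->
  L2 `]0, 2^-1[ p -> L2 D (q_of a gamma lam p).
Proof.
move=> /andP[a0 a1] wL pL; have qL := qa_of_L2 gamma wL pL.
have mI (c d : R) : measurable (`]c, d[%classic : set TR) by exact: measurable_itv.
apply: (L2_glue a0 a1).
  have h : 0 <= 1 - a by rewrite subr_ge0.
  have := L2_comp_add (1 - a) (L2_subitv h (lexx 1) qL).
  rewrite subrr subKr => h'; have := L2Z gamma (mI _ _) h'; apply: L2_eq => // x.
  rewrite inE /= in_itv /= => /andP[_ xa]; rewrite /q_of xa.
  by congr (_ * qa_of _ _ _ _); rewrite addrA addrAC.
have h : 1 - a <= 1 by rewrite gerBl.
have := L2_comp_add (- a) (L2_subitv (lexx 0) h qL).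
rewrite opprK subrK add0r; apply: L2_eq => // x.
by rewrite inE /= in_itv /= => /andP[ax _]; rewrite /q_of ltNge (ltW ax).
Qed.

(** Below 1/2 this is the definition of [qa_of] with gamma^2 = 1; above 1/2 it rests on the symmetry
    of [w]. At 1/2 itself both points fall into the second branch, hence the exclusion. *)
Lemma qa_of_sub_half gamma w p y : 0 < y < 1 -> y != 2^-1 -> gamma ^+ 2 = 1 ->
  w (1 - y) = gamma * w y -> qa_of gamma w p y + gamma * qa_of gamma w p (1 - y) = w y.
Proof.
move=> /andP[y0 y1] yh g2 wE.
have [y2|y2] := ltP y 2^-1.
  have h : (1 - y < 2^-1) = false by apply/negbTE; rewrite -leNgt; lra.
  rewrite /qa_of y2 h (_ : 2^-1 - (1 - y - 2^-1) = y); last by field.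
  rewrite (_ : 1 - y - 2^-1 = 2^-1 - y); last by field.
  by rewrite mulrBr !mulrA -expr2 g2 !mul1r addrC subrK.
have h : 1 - y < 2^-1 by move: yh; rewrite neq_lt => /orP[|]; lra.
rewrite /qa_of ltNge y2 /= h (_ : 2^-1 - (y - 2^-1) = 1 - y); last by field.
rewrite (_ : 2^-1 - (1 - y) = y - 2^-1); last by field.
by rewrite subrK wE mulrA -expr2 g2 mul1r.
Qed.

(** The choice in [w_of] is genuine because a potential with the given spectrum exhibits a function
    satisfying [is_w]. *)
Lemma w_ofP q a gamma lam : 0 <= a <= 1 -> gamma = 1 \/ gamma = -1 ->
  L2 D q -> is_spectrum q a gamma lam -> numbered gamma lam ->
  is_w gamma lam (w_of gamma lam).
Proof.
move=> aI gE qL qS num.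
by apply: (xgetPex _ (ex_intro _ _ (is_w_w_pot aI gE qL qS num))).
Qed.

Lemma w_pot_ae q a gamma lam : 0 <= a <= 1 -> gamma = 1 \/ gamma = -1 ->
  L2 D q -> is_spectrum q a gamma lam -> numbered gamma lam ->
  \forall x \ae mu, D x -> w_pot gamma q a x = w_of gamma lam x.
Proof.
move=> aI gE qL qS num.
exact: is_w_unique (is_w_w_pot aI gE qL qS num) (w_ofP aI gE qL qS num).
Qed.

(** The parameter is read off from the shifted potential on (0, 1/2); the other half is then forced
    by [w], which the spectrum determines almost everywhere. *)
Lemma spectrum_sub q a gamma lam : 0 <= a <= 1 -> gamma = 1 \/ gamma = -1 ->
  L2 D q -> is_spectrum q a gamma lam -> numbered gamma lam ->
  exists p, L2 `]0, 2^-1[ p /\ \forall x \ae mu, D x -> q x = q_of a gamma lam p x.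
Proof.
move=> aI gE qL qS num; have g2 := gamma2 gE; have /andP[a0 a1] := aI.
have wE := w_pot_ae aI gE qL qS num.
pose p x := q_shift gamma q a (2^-1 - x); exists p; split.
  have h1 : 2^-1 <= 1 :> R by rewrite invf_le1 // ler1n.
  by have := L2_comp_sub 2^-1 (L2_subitv (lexx 0) h1 (q_shift_L2 gamma aI qL)); rewrite subrr subr0.
have QE : \forall y \ae mu, D y -> qa_of gamma (w_of gamma lam) p y = q_shift gamma q a y.
  (* Above 1/2 the construction uses [w] at [1 - y], so the almost everywhere identity is
     transported by the reflection. *)
  apply: ae_mono (ae_onem wE) => y h; rewrite /= in_itv /= => /andP[y0 y1].
  rewrite /qa_of /p; case: ifPn => y2; first by rewrite subKr.
  rewrite (_ : 2^-1 - (y - 2^-1) = 1 - y); last by field.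
  rewrite -h; last by rewrite /= in_itv /=; apply/andP; split; lra.
  rewrite /w_pot subKr mulrDr mulrA -expr2 g2 mul1r addrAC subrr add0r //.
have h1 := ae_shift (1 - a) QE; have h2 := ae_shift (- a) QE.
apply: ae_mono (ae_and (ae_and h1 h2) (ae_neq a)) => x [[{}h1 {}h2] xa].
rewrite /= in_itv /= => /andP[x0 x1]; rewrite /q_of; case: ifPn => xa'.
  rewrite -addrA [- a + 1]addrC h1; last by rewrite /= in_itv /=; apply/andP; split; lra.
  rewrite /q_shift ifF; last by apply/negbTE; rewrite -leNgt; lra.
  by rewrite mulrA -expr2 g2 mul1r; congr q; ring.
have {}xa' : a < x by rewrite lt_neqAle eq_sym xa leNgt.
rewrite h2; last by rewrite /= in_itv /=; apply/andP; split; lra.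
by rewrite /q_shift ltrD2r x1 subrK.
Qed.

(** [q] and [qstar] have the same [w_pot] almost everywhere, hence the same characteristic function
    and the same zeros with multiplicities. *)
Lemma spectrum_sup qstar q p a gamma lam : 0 <= a <= 1 -> gamma = 1 \/ gamma = -1 ->
  L2 D qstar -> is_spectrum qstar a gamma lam -> numbered gamma lam -> L2 D q ->
  (\forall x \ae mu, D x -> q x = q_of a gamma lam p x) -> is_spectrum q a gamma lam.
Proof.
move=> aI gE sL sS num qL qE; have g2 := gamma2 gE; have /andP[a0 a1] := aI.
have wE := w_pot_ae aI gE sL sS num.
have QE : \forall y \ae mu, D y -> q_shift gamma q a y = qa_of gamma (w_of gamma lam) p y.
  have h1 := ae_shift a qE; have h2 := ae_shift (a - 1) qE.
  apply: ae_mono (ae_and (ae_and h1 h2) (ae_neq (1 - a))) => y [[{}h1 {}h2] ya].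
  rewrite /= in_itv /= => /andP[y0 y1]; rewrite /q_shift; case: ifPn => ya'.
    rewrite h1; last by rewrite /= in_itv /=; apply/andP; split; lra.
    by rewrite /q_of ifF ?addrK //; apply/negbTE; rewrite -leNgt; lra.
  have {}ya' : 1 - a < y by rewrite lt_neqAle eq_sym ya leNgt.
  rewrite -addrA h2; last by rewrite /= in_itv /=; apply/andP; split; lra.
  rewrite /q_of ifT; last by lra.
  by rewrite mulrA -expr2 g2 mul1r; congr qa_of; ring.
have E : \forall y \ae mu, D y -> w_pot gamma q a y = w_pot gamma qstar a y.
  (* The chosen representative [w_of] has its symmetry only almost everywhere, inherited from
     [w_pot] of [qstar]; this takes the identity at [y] and at [1 - y]. *)
  apply: ae_mono (ae_and (ae_and (ae_and QE (ae_onem QE)) (ae_and wE (ae_onem wE))) (ae_neq 2^-1)).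
  move=> y [[[h1 h2] [h3 h4]] yh] Dy; have D1y : D (1 - y).
    by move: Dy; rewrite /= !in_itv /= => /andP[y0 y1]; apply/andP; split; lra.
  rewrite {1}/w_pot h1 // h2 // h3 // qa_of_sub_half //.
  by rewrite -h3 // -h4 // w_pot_onem.
suff -> : is_spectrum q a gamma lam = is_spectrum qstar a gamma lam by [].
rewrite /is_spectrum; suff -> : char_fun q a gamma = char_fun qstar a gamma by [].
apply/funext => z; rewrite !char_fun_formula //; congr (_ - _).
apply: ae_eq_cintegral.
- by apply: sin_div_integrable01; apply: L2_cintegrable; exact: w_pot_L2.
- by apply: sin_div_integrable01; apply: L2_cintegrable; exact: w_pot_L2.
by apply: ae_mono E => y h /h ->.
Qed.

End Isospectral.

Unset Implicit Arguments.

(** Elements of the function spaces are represented by functions, so equality with the constructed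
    potential is almost everywhere on (0, 1) and the right-hand set contains every representative.
    The first conjunct ensures that each [p] contributes. *)
Theorem theorem4 (R : realType) (a : R) (gamma : R[i]) (lam : nat -> R[i])
    (qstar : R -> R[i]) :
  0 <= a <= 1 ->
  gamma = 1 \/ gamma = -1 ->
  L2 `]0, 1[ qstar ->
  is_spectrum qstar a gamma lam ->
  numbered gamma lam ->
  (forall p : R -> R[i], L2 `]0, 2^-1[ p -> L2 `]0, 1[ (q_of a gamma lam p)) /\
  [set q : R -> R[i] | L2 `]0, 1[ q /\ is_spectrum q a gamma lam] =
  [set q : R -> R[i] | L2 `]0, 1[ q /\
     exists p : R -> R[i], L2 `]0, 2^-1[ p /\
       (q = q_of a gamma lam p %[ae (@lebesgue_measure R) in [set` `]0, 1[]])].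
Proof.
move=> aI gE sL sS num; split.
  by move=> p; apply: q_of_L2 => //; have [] := w_ofP aI gE sL sS num.
apply/seteqP; split => q /= [qL].
  by move=> qS; split; [exact: qL|exact: spectrum_sub].
by move=> [p [pL qE]]; split; [exact: qL|exact: (spectrum_sup aI gE sL sS num qL qE)].
Qed.
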